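(* Let $k\in(0,1)$. For $u\in V_{1/4}\cup V_{3/4}$, $$G(u)=\frac{4}{k'^2(\wp(2u)-e_2)}.$$ Hence $G_1\to\infty$ on $V'_{1/4}\cup V'_{3/4}$ as $k\to1$; that is, for every $M>0$ there is $k_M<1$ such that for all $k\in(k_M,1)$, $G_1(z)>M$ for all $z\in V'_{1/4}\cup V'_{3/4}$.
   Context: For $k\in(0,1)$: $k'=\sqrt{1-k^2}$, $K(k)=\int_0^{\pi/2}\frac{d\psi}{\sqrt{1-k^2\sin^2\psi}}$, $\omega_1=2\sqrt{kk'}K(k)$, $\omega_2=2i\sqrt{kk'}K(k')$, $\omega_3=\omega_1+\omega_2$; $\wp$ is the Weierstrass function of $\mathbb{Z}\omega_1+\mathbb{Z}\omega_2$, $e_j=\wp(\omega_j/2)$. $g(u)=\wp(u)-e_3$ is the Gauss map of the auxiliary minimal surface of the charge 2 monopole with parameter $k$, and $G=\frac{4|g'|^2}{(1+|g|^2)^2}$ is the density (with respect to $dx\,dy$, $u=x+iy$) of the area measure it induces. $G_1(z)=|\omega_1|^2G(\omega_1z)$. $V_a=\{a\omega_1+iy:0\le y<|\omega_2|\}$, and $V'_a=\{a+iy:0\le y<|\tau_2|\}$, where $\tau_2=\omega_2/\omega_1$. *)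

(* Defs.v *)
From Stdlib Require Export Reals List ZArith Lra Lia.
From Coquelicot Require Export Coquelicot.
Open Scope R_scope.

(** * Sums over [Z * Z] *)

(* The filter of finite subsets of [Z * Z] directed by inclusion.  Finite
   subsets are duplicate-free lists. *)
Definition finite_subsets (P : list (Z * Z) -> Prop) : Prop :=
  exists s0, forall s, NoDup s -> incl s0 s -> P s.

Definition partial_sum (f : Z * Z -> C) (s : list (Z * Z)) : C :=
  fold_right Cplus (RtoC 0) (map f s).

(* Unconditional sum: the limit of the net of finite partial sums, so no order
   of summation is chosen. *)
Definition is_lattice_sum (f : Z * Z -> C) (l : C) : Prop :=
  filterlim (partial_sum f) finite_subsets (locally l).

Definition lattice_sum (f : Z * Z -> C) : C :=
  iota (T := CompleteNormedModule.CompleteSpace _ C_CompleteNormedModule)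
    (is_lattice_sum f).

Lemma ZZ_eq_dec (p q : Z * Z) : {p = q} + {p <> q}.
Proof. decide equality; apply Z.eq_dec. Defined.

Global Instance finite_subsets_filter : ProperFilter finite_subsets.
Proof.
  split; [|split].
  - intros P [s0 H]. exists (nodup ZZ_eq_dec s0). apply H.
    + apply NoDup_nodup.
    + intros x Hx. now apply nodup_In.
  - exists nil. intros; exact I.
  - intros P Q [s0 HP] [s1 HQ]. exists (s0 ++ s1). intros s Hs Hi.
    split; [apply HP | apply HQ]; trivial;
      intros x Hx; apply Hi, in_or_app; auto.
  - intros P Q HPQ [s0 H]. exists s0. intros s Hs Hi. now apply HPQ, H.
Qed.

Lemma is_lattice_sum_unique (f : Z * Z -> C) (l : C) :
  is_lattice_sum f l -> lattice_sum f = l.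
Proof.
  apply (iota_filterlim_locally (V := C_CompleteNormedModule)
           (F := finite_subsets)).
Qed.

(** * The Weierstrass function of the lattice [Z w1 + Z w2] *)

Definition lattice_pt (w1 w2 : C) (p : Z * Z) : C :=
  (RtoC (IZR (fst p)) * w1 + RtoC (IZR (snd p)) * w2)%C.

(* [w1] and [w2] are full periods and are meant to be R-linearly independent.
   At lattice points the value is junk. *)
Definition wp (w1 w2 u : C) : C :=
  (1 / u ^ 2 +
   lattice_sum (fun p =>
     if ZZ_eq_dec p (0%Z, 0%Z) then 0
     else 1 / (u - lattice_pt w1 w2 p) ^ 2 - 1 / lattice_pt w1 w2 p ^ 2))%C.

(** * The elliptic data of the charge 2 monopole with parameter [k] *)

Definition compl_mod (k : R) : R := sqrt (1 - k ^ 2).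

Definition ellK (k : R) : R :=
  RInt (fun psi => / sqrt (1 - k ^ 2 * sin psi ^ 2)) 0 (PI / 2).

Definition omega1 (k : R) : C := RtoC (2 * sqrt (k * compl_mod k) * ellK k).

Definition omega2 (k : R) : C :=
  (Ci * RtoC (2 * sqrt (k * compl_mod k) * ellK (compl_mod k)))%C.

Definition omega3 (k : R) : C := (omega1 k + omega2 k)%C.

Definition tau2 (k : R) : C := (omega2 k / omega1 k)%C.

Definition wpk (k : R) : C -> C := wp (omega1 k) (omega2 k).

Definition e2 (k : R) : C := wpk k (omega2 k / 2)%C.

Definition e3 (k : R) : C := wpk k (omega3 k / 2)%C.

Definition gauss (k : R) (u : C) : C := (wpk k u - e3 k)%C.

(* Off the lattice [gauss k] is holomorphic, so the total operator [C_derive]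
   is its complex derivative there ([C_derive_correct]). *)
Definition G (k : R) (u : C) : R :=
  4 * Cmod (C_derive (gauss k) u) ^ 2 / (1 + Cmod (gauss k u) ^ 2) ^ 2.

Definition G1 (k : R) (z : C) : R :=
  Cmod (omega1 k) ^ 2 * G k (omega1 k * z)%C.

Definition V (k a : R) (u : C) : Prop :=
  exists y : R, 0 <= y < Cmod (omega2 k) /\
    u = (RtoC a * omega1 k + Ci * RtoC y)%C.

Definition V' (k a : R) (z : C) : Prop :=
  exists y : R, 0 <= y < Cmod (tau2 k) /\ z = (RtoC a + Ci * RtoC y)%C.

(* Main.v *)
Require Import Defs.
From Stdlib Require Import Permutation Classical.

(* The identities for the Weierstrass function (second-order differential equation,
   translation by half periods, duplication) come from one Liouville argument: a doubly
   periodic function, holomorphic off the lattice and with a finite limit at [0], is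
   constant, because a maximum of its real part off the lattice propagates, by the mean
   value property, up to the nearest lattice point.

   The parameter [k] enters through the half-period values.  Integrating the differential
   equation along the two axes gives [sqrt (e1 - e2) * |omega1| / 2 = K(kappa)] and
   [sqrt (e1 - e2) * |omega2| / 2 = K(kappa')] with [kappa^2 = (e3 - e2) / (e1 - e2)].
   As [K(kappa') / K(kappa)] is strictly decreasing, [kappa = k] and
   [e1 - e2 = 1 / (k k')].

   On [V_(1/4)] and [V_(3/4)] the conjugate of [u] is [- u + omega1 / 2] modulo periods, so
   [|wp u - e1|^2 = (wp (u + omega1 / 2) - e1) (wp u - e1) = 1 / k^2].  This gives
   [1 + |g|^2 = k' |(wp u - e2)^2 - (e2 - e1) (e2 - e3)|], and the differential equation and
   the duplication formula turn [G] into [4 / (k'^2 |wp (2 u) - e2|)].  There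
   [e3 <= wp (2 u) <= e1], hence [G1 >= (4 k K(k))^2], and [K(k) >= - ln k']. *)

(** * Unconditional sums *)

(** The Liouville argument uses limits only, neither Laurent series nor removable singularities. To
    make this possible, every identity is set up over a lattice modulo which [0] is its sole
    singular point: the product [(wp (u + omega1 / 2) - e1) (wp u - e1)] has the smaller period
    [omega1 / 2], and the sum behind the duplication formula has both half periods. The second-order
    equation comes first because a single coefficient removes its pole; the first-order one follows
    by integration over a strip.

    The rectangular shape of the lattice does much of the work. Conjugation makes the half-period
    values real. Multiplication by [i] exchanges the two periods and changes the sign of [wp], so
    each fact about [e1] is also one about [e2].

    No zeros are counted: [e1] is separated from [e2] and [e3] by uniqueness for the differential
    equation on the real axis, and this yields [e1 + e2 + e3 = 0] and the order of the three values.

    Integrals along both axes are needed because the lattice leaves two unknowns, the modulus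
    [kappa] and the scale [e1 - e2]; each axis supplies one equation. *)

Definition rsum (f : Z * Z -> R) (s : list (Z * Z)) : R :=
  fold_right Rplus 0 (map f s).

Lemma rsum_nonneg f s : (forall p, 0 <= f p) -> 0 <= rsum f s.
Proof.
  intros H; induction s as [|p s IH]; cbn; [lra|]. specialize (H p). unfold rsum in IH. lra.
Qed.

Lemma rsum_le f g s : (forall p, In p s -> f p <= g p) -> rsum f s <= rsum g s.
Proof.
  induction s as [|p s IH]; intros H; cbn; [lra|].
  pose proof (H p (or_introl eq_refl)). specialize (IH (fun q Hq => H q (or_intror Hq))).
  unfold rsum in IH. lra.
Qed.

Lemma rsum_app f s t : rsum f (s ++ t) = rsum f s + rsum f t.
Proof. unfold rsum. induction s as [|p s IH]; cbn; [lra|]. rewrite IH. lra. Qed.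

Lemma rsum_scal c f s : rsum (fun p => c * f p) s = c * rsum f s.
Proof. unfold rsum. induction s as [|p s IH]; cbn; [lra|]. rewrite IH. lra. Qed.

Lemma rsum_perm f s t : Permutation s t -> rsum f s = rsum f t.
Proof. unfold rsum. induction 1; cbn; lra. Qed.

Lemma csum_app f s t : partial_sum f (s ++ t) = (partial_sum f s + partial_sum f t)%C.
Proof.
  unfold partial_sum. induction s as [|p s IH]; cbn [app map fold_right]; [ring|].
  rewrite IH. ring.
Qed.

Lemma csum_perm f s t : Permutation s t -> partial_sum f s = partial_sum f t.
Proof.
  unfold partial_sum. induction 1; cbn [map fold_right];
    [reflexivity | now rewrite IHPermutation | ring | congruence].
Qed.

Lemma csum_plus f g s :
  partial_sum (fun p => f p + g p)%C s = (partial_sum f s + partial_sum g s)%C.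
Proof.
  unfold partial_sum. induction s as [|p s IH]; cbn [map fold_right]; [ring|].
  rewrite IH. ring.
Qed.

Lemma csum_scal c f s :
  partial_sum (fun p => c * f p)%C s = (c * partial_sum f s)%C.
Proof.
  unfold partial_sum. induction s as [|p s IH]; cbn [map fold_right]; [ring|].
  rewrite IH. ring.
Qed.

Lemma csum_conj f s :
  partial_sum (fun p => Cconj (f p)) s = Cconj (partial_sum f s).
Proof.
  unfold partial_sum. induction s as [|p s IH]; cbn [map fold_right].
  - unfold Cconj, RtoC; cbn. now rewrite Ropp_0.
  - now rewrite IH, Cplus_conj.
Qed.

Lemma csum_ext f g s : (forall p, In p s -> f p = g p) -> partial_sum f s = partial_sum g s.
Proof. intros H. unfold partial_sum. f_equal. now apply map_ext_in. Qed.

Lemma Cmod_csum_le f s : Cmod (partial_sum f s) <= rsum (fun p => Cmod (f p)) s.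
Proof.
  unfold partial_sum, rsum. induction s as [|p s IH]; cbn [map fold_right].
  - rewrite Cmod_0. lra.
  - eapply Rle_trans; [apply Cmod_triangle|]. lra.
Qed.

Lemma incl_Permutation {A : Type} (s0 s : list A) :
  NoDup s0 -> incl s0 s -> exists t, Permutation s (s0 ++ t).
Proof.
  revert s; induction s0 as [|p s0 IH]; intros s H0 Hi.
  - exists s. reflexivity.
  - inversion_clear H0 as [|? ? Hp Hn].
    destruct (in_split p s (Hi p (or_introl eq_refl))) as [u [v E]]; subst s.
    assert (P : Permutation (u ++ p :: v) (p :: u ++ v))
      by (symmetry; apply Permutation_middle).
    destruct (IH (u ++ v) Hn) as [t Pt].
    + intros q Hq. specialize (Hi q (or_intror Hq)).
      apply (Permutation_in _ P) in Hi. destruct Hi as [<-|Hi]; [contradiction|exact Hi].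
    + exists t. rewrite P. now constructor.
Qed.

Lemma rsum_incl f s t :
  (forall p, 0 <= f p) -> NoDup s -> incl s t -> rsum f s <= rsum f t.
Proof.
  intros Hf Hs Hi. destruct (incl_Permutation s t Hs Hi) as [r P].
  rewrite (rsum_perm _ _ _ P), rsum_app. pose proof (rsum_nonneg f r Hf). lra.
Qed.

(** The balls behind [locally] on [C] are squares, hence the factor [sqrt 2] between radius and
    modulus. *)
Lemma locally_Cmod (l : C) (P : C -> Prop) :
  locally l P <-> exists eps, 0 < eps /\ forall z, Cmod (z - l) < eps -> P z.
Proof.
  split.
  - intros [e He]. exists e. split; [apply cond_pos|]. intros z Hz. apply He.
    apply C_NormedModule_mixin_compat1. exact Hz.
  - intros [e [He H]]. assert (Hs : 0 < e / sqrt 2) by (apply Rdiv_lt_0_compat; [lra | apply sqrt_lt_R0; lra]).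
    exists (mkposreal _ Hs). intros z Hz. apply H.
    pose proof (C_NormedModule_mixin_compat2 l z (mkposreal _ Hs) Hz) as Hb. cbn in Hb.
    replace (sqrt 2 * (e / sqrt 2)) with e in Hb; [exact Hb|].
    field. apply Rgt_not_eq, sqrt_lt_R0; lra.
Qed.

Lemma is_lattice_sum_eps (f : Z * Z -> C) (l : C) :
  is_lattice_sum f l <->
  forall eps, 0 < eps -> exists s0, forall s, NoDup s -> incl s0 s ->
    Cmod (partial_sum f s - l) < eps.
Proof.
  split.
  - intros H e He.
    assert (Hl : locally l (fun z => Cmod (z - l) < e)) by (apply locally_Cmod; eauto).
    destruct (H _ Hl) as [s0 Hs]. exists s0. exact Hs.
  - intros H P HP. apply locally_Cmod in HP. destruct HP as [e [He HP]].
    destruct (H e He) as [s0 Hs]. exists s0. intros s Hn Hi. apply HP. now apply Hs.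
Qed.

Lemma is_lattice_sum_ext f g l :
  (forall p, f p = g p) -> is_lattice_sum f l -> is_lattice_sum g l.
Proof.
  intros E. rewrite !is_lattice_sum_eps. intros H e He. destruct (H e He) as [s0 Hs].
  exists s0. intros s Hn Hi. rewrite <- (csum_ext f g) by auto. now apply Hs.
Qed.

Lemma is_lattice_sum_plus f g l m :
  is_lattice_sum f l -> is_lattice_sum g m ->
  is_lattice_sum (fun p => f p + g p)%C (l + m)%C.
Proof.
  rewrite !is_lattice_sum_eps. intros Hf Hg e He.
  destruct (Hf (e / 2) ltac:(lra)) as [s1 H1]. destruct (Hg (e / 2) ltac:(lra)) as [s2 H2].
  exists (s1 ++ s2). intros s Hn Hi.
  specialize (H1 s Hn (fun x Hx => Hi x (in_or_app _ _ _ (or_introl Hx)))).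
  specialize (H2 s Hn (fun x Hx => Hi x (in_or_app _ _ _ (or_intror Hx)))).
  rewrite csum_plus.
  replace (partial_sum f s + partial_sum g s - (l + m))%C
    with ((partial_sum f s - l) + (partial_sum g s - m))%C by ring.
  eapply Rle_lt_trans; [apply Cmod_triangle|]. lra.
Qed.

Lemma is_lattice_sum_scal c f l :
  is_lattice_sum f l -> is_lattice_sum (fun p => c * f p)%C (c * l)%C.
Proof.
  rewrite !is_lattice_sum_eps. intros Hf e He.
  assert (Hc : 0 < Cmod c + 1) by (pose proof (Cmod_ge_0 c); lra).
  destruct (Hf (e / (Cmod c + 1)) ltac:(apply Rdiv_lt_0_compat; lra)) as [s1 H1].
  exists s1. intros s Hn Hi. specialize (H1 s Hn Hi). rewrite csum_scal.
  replace (c * partial_sum f s - c * l)%C with (c * (partial_sum f s - l))%C by ring.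
  rewrite Cmod_mult. pose proof (Cmod_ge_0 (partial_sum f s - l)).
  apply Rle_lt_trans with ((Cmod c + 1) * Cmod (partial_sum f s - l)); [nra|].
  replace e with ((Cmod c + 1) * (e / (Cmod c + 1))) by (field; lra).
  now apply Rmult_lt_compat_l.
Qed.

Lemma is_lattice_sum_minus f g l m :
  is_lattice_sum f l -> is_lattice_sum g m ->
  is_lattice_sum (fun p => f p - g p)%C (l - m)%C.
Proof.
  intros Hf Hg. pose proof (is_lattice_sum_plus _ _ _ _ Hf (is_lattice_sum_scal (-(1)) _ _ Hg)) as H.
  replace (l - m)%C with (l + -(1) * m)%C by ring.
  eapply is_lattice_sum_ext; [|exact H]. intros p. cbn beta. ring.
Qed.

Lemma is_lattice_sum_conj f l :
  is_lattice_sum f l -> is_lattice_sum (fun p => Cconj (f p)) (Cconj l).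
Proof.
  rewrite !is_lattice_sum_eps. intros Hf e He. destruct (Hf e He) as [s0 H]. exists s0.
  intros s Hn Hi. rewrite csum_conj, <- Cminus_conj, Cmod_conj. now apply H.
Qed.

Lemma is_lattice_sum_reindex (sigma tau : Z * Z -> Z * Z) f l :
  (forall p, sigma (tau p) = p) -> (forall p, tau (sigma p) = p) ->
  is_lattice_sum f l -> is_lattice_sum (fun p => f (sigma p)) l.
Proof.
  intros H1 H2. rewrite !is_lattice_sum_eps. intros Hf e He.
  destruct (Hf e He) as [s0 H]. exists (map tau s0). intros s Hn Hi.
  replace (partial_sum (fun p => f (sigma p)) s) with (partial_sum f (map sigma s))
    by (unfold partial_sum; now rewrite map_map).
  apply H.
  - apply FinFun.Injective_map_NoDup; [|exact Hn].
    intros x y E. rewrite <- (H2 x), <- (H2 y). now rewrite E.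
  - intros x Hx. rewrite <- (H1 x). apply in_map, Hi, in_map, Hx.
Qed.

(** Allows the polar term [1 / u ^ 2] to be absorbed into a sum over the whole lattice, as its term
    at the origin. *)
Lemma is_lattice_sum_single (q : Z * Z) (c : C) :
  is_lattice_sum (fun p => if ZZ_eq_dec p q then c else 0) c.
Proof.
  apply is_lattice_sum_eps. intros e He. exists (q :: nil). intros s Hn Hi.
  destruct (incl_Permutation (q :: nil) s) as [t P]; auto.
  { constructor; [easy|constructor]. }
  pose proof (Permutation_NoDup P Hn) as N.
  rewrite (csum_perm _ _ _ P), csum_app.
  cbn in N. inversion_clear N as [|? ? Nq _].
  rewrite (csum_ext _ (fun p => 0 * 0)%C t), csum_scal.
  - unfold partial_sum at 1. cbn [map fold_right]. destruct (ZZ_eq_dec q q); [|easy].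
    replace (c + 0 + _ - c)%C with (RtoC 0) by ring. now rewrite Cmod_0.
  - intros p Hp. destruct (ZZ_eq_dec p q) as [->|_]; [contradiction|ring].
Qed.

Lemma is_lattice_sum_le f l B :
  is_lattice_sum f l ->
  (forall s, NoDup s -> rsum (fun p => Cmod (f p)) s <= B) -> Cmod l <= B.
Proof.
  rewrite is_lattice_sum_eps. intros H HB. apply Rnot_lt_le. intro Hlt.
  destruct (H (Cmod l - B) ltac:(lra)) as [s0 Hs].
  specialize (Hs (nodup ZZ_eq_dec s0) (NoDup_nodup _ _) (fun x Hx => proj2 (nodup_In _ _ _) Hx)).
  specialize (HB (nodup ZZ_eq_dec s0) (NoDup_nodup _ _)).
  pose proof (Cmod_csum_le f (nodup ZZ_eq_dec s0)).
  pose proof (Cmod_triangle (partial_sum f (nodup ZZ_eq_dec s0)) (l - partial_sum f (nodup ZZ_eq_dec s0))) as T.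
  replace (partial_sum f (nodup ZZ_eq_dec s0) + (l - partial_sum f (nodup ZZ_eq_dec s0)))%C with l in T by ring.
  replace (l - partial_sum f (nodup ZZ_eq_dec s0))%C
    with (- (partial_sum f (nodup ZZ_eq_dec s0) - l))%C in T by ring.
  rewrite Cmod_opp in T. lra.
Qed.

(* Absolutely convergent families have a sum: the partial sums of the moduli
   have a supremum, so the net of partial sums is Cauchy. *)
Lemma ex_lattice_sum f B :
  (forall s, NoDup s -> rsum (fun p => Cmod (f p)) s <= B) ->
  exists l, is_lattice_sum f l.
Proof.
  intros HB.
  destruct (completeness (fun r => exists s, NoDup s /\ r = rsum (fun p => Cmod (f p)) s)) as [S [Hub Hlub]].
  { exists B. intros r [s [Hn ->]]. auto. }
  { exists (rsum (fun p => Cmod (f p)) nil). exists nil. split; [constructor|reflexivity]. }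
  apply (proj1 (filterlim_locally_cauchy (U := CompleteNormedModule.CompleteSpace _ C_CompleteNormedModule)
    (F := finite_subsets) (partial_sum f))).
  intros eps.
  assert (He : 0 < eps / 2) by (pose proof (cond_pos eps); lra).
  assert (exists s0, NoDup s0 /\ S - eps / 2 < rsum (fun p => Cmod (f p)) s0) as [s0 [Hn0 H0]].
  { apply NNPP. intro Hno. assert (S <= S - eps / 2); [|lra].
    apply Hlub. intros r [s [Hn ->]]. apply Rnot_lt_le. intro. apply Hno. eauto. }
  assert (Hclose : forall s, NoDup s -> incl s0 s -> Cmod (partial_sum f s - partial_sum f s0) < eps / 2).
  { intros s Hn Hi. destruct (incl_Permutation s0 s Hn0 Hi) as [t P].
    pose proof (Permutation_NoDup P Hn) as N.
    rewrite (csum_perm _ _ _ P), csum_app.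
    replace (partial_sum f s0 + partial_sum f t - partial_sum f s0)%C with (partial_sum f t) by ring.
    eapply Rle_lt_trans; [apply Cmod_csum_le|].
    pose proof (Hub _ (ex_intro _ _ (conj N eq_refl))) as Hu. rewrite rsum_app in Hu. lra. }
  exists (fun u => Cmod (partial_sum f u - partial_sum f s0) < eps / 2).
  split.
  - exists s0. auto.
  - intros u v Hu Hv.
    apply C_NormedModule_mixin_compat1.
    change (Cmod (partial_sum f v - partial_sum f u)%C < eps).
    replace (partial_sum f v - partial_sum f u)%C
      with ((partial_sum f v - partial_sum f s0) + - (partial_sum f u - partial_sum f s0))%C by ring.
    eapply Rle_lt_trans; [apply Cmod_triangle|]. rewrite Cmod_opp. lra.
Qed.

Lemma is_lattice_sum_lattice_sum f B :
  (forall s, NoDup s -> rsum (fun p => Cmod (f p)) s <= B) ->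
  is_lattice_sum f (lattice_sum f).
Proof.
  intros H. destruct (ex_lattice_sum f B H) as [l Hl].
  now rewrite (is_lattice_sum_unique _ _ Hl).
Qed.

(** * Absolute convergence over a rectangular lattice *)

Definition rect (a b : R) (p : Z * Z) : C := lattice_pt (RtoC a) (Ci * RtoC b)%C p.

Lemma re_rect a b p : Re (rect a b p) = IZR (fst p) * a.
Proof. unfold rect, lattice_pt. cbn. ring. Qed.

Lemma im_rect a b p : Im (rect a b p) = IZR (snd p) * b.
Proof. unfold rect, lattice_pt. cbn. ring. Qed.

Lemma im_le_Cmod (c : C) : Rabs (Im c) <= Cmod c.
Proof. eapply Rle_trans; [apply Rmax_r | apply Rmax_Cmod]. Qed.

Lemma C_ext (z w : C) : Re z = Re w -> Im z = Im w -> z = w.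
Proof. destruct z, w; cbn; congruence. Qed.

(** The weight [(1 + |m|) ^ (-3/2)]. Since [(1 + |m|) (1 + |n|) <= (2 max (|m|, |n|)) ^ 2], the
    product [hz m * hz n] dominates the inverse cube of a lattice point up to a constant, and the
    double sum factors into two simple ones. *)
Definition hz (m : Z) : R := / sqrt (1 + IZR (Z.abs m)) ^ 3.

Lemma hz_pos m : 0 < hz m.
Proof.
  apply Rinv_0_lt_compat, pow_lt, sqrt_lt_R0.
  pose proof (IZR_le 0 (Z.abs m) ltac:(lia)). lra.
Qed.

Definition lsum (h : Z -> R) (l : list Z) : R := fold_right Rplus 0 (map h l).

Lemma lsum_app h l l' : lsum h (l ++ l') = lsum h l + lsum h l'.
Proof. unfold lsum. induction l as [|x l IH]; cbn; [lra|]. rewrite IH. lra. Qed.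

(** For [N > 0] the entry [0] occurs twice; this does no harm, as only upper bounds of positive sums
    over [zbox] are taken. *)
Definition zbox (N : nat) : list Z :=
  map Z.of_nat (seq 0 N) ++ map (fun k => (- Z.of_nat k)%Z) (seq 0 N).

(* Telescoping against [2 / sqrt N]. *)
Lemma hz_seq_bound N :
  (1 <= N)%nat -> lsum hz (map Z.of_nat (seq 0 N)) <= 3 - 2 / sqrt (INR N).
Proof.
  induction N as [|N IH]; intros HN; [lia|].
  destruct (Nat.eq_dec N 0) as [->|Hn0].
  - unfold lsum, hz. cbn -[sqrt pow IZR].
    replace (1 + 0) with 1 by ring. rewrite sqrt_1. lra.
  - specialize (IH ltac:(lia)). rewrite seq_S, map_app, lsum_app. cbn [plus map].
    unfold lsum at 2. cbn [map fold_right].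
    unfold hz at 2. rewrite Z.abs_eq, <- INR_IZR_INZ, Nat.add_0_l by lia.
    rewrite S_INR. assert (Hp : 1 <= INR N) by (change 1 with (INR 1); apply le_INR; lia).
    rewrite (Rplus_comm 1).
    assert (Hs : sqrt (INR N) * sqrt (INR N) = INR N) by (apply sqrt_sqrt; lra).
    assert (Ht : sqrt (INR N + 1) * sqrt (INR N + 1) = INR N + 1) by (apply sqrt_sqrt; lra).
    assert (Hs0 : 0 < sqrt (INR N)) by (apply sqrt_lt_R0; lra).
    assert (Hst : sqrt (INR N) < sqrt (INR N + 1)) by (apply sqrt_lt_1; lra).
    set (s := sqrt (INR N)) in *. set (t := sqrt (INR N + 1)) in *.
    assert (E : t * t - s * s = 1) by lra.
    enough (/ t ^ 3 <= 2 / s - 2 / t) by lra.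
    replace (2 / s - 2 / t) with (2 * ((t * t - s * s) / (s * t * (t + s)))) by (field; lra).
    rewrite E. unfold Rdiv. rewrite Rmult_1_l.
    replace (/ t ^ 3) with (2 * / (2 * t ^ 3)) by (field; lra).
    apply Rmult_le_compat_l; [lra|]. apply Rinv_le_contravar; [|nra].
    repeat apply Rmult_lt_0_compat; lra.
Qed.

Lemma hz_zbox_bound N : lsum hz (zbox N) <= 6.
Proof.
  assert (H : lsum hz (map Z.of_nat (seq 0 N)) <= 3).
  { destruct N; [cbn; lra|]. pose proof (hz_seq_bound (S N) ltac:(lia)).
    assert (0 < 2 / sqrt (INR (S N))); [|lra].
    apply Rdiv_lt_0_compat; [lra|]. apply sqrt_lt_R0, lt_0_INR; lia. }
  unfold zbox. rewrite lsum_app.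
  replace (lsum hz (map (fun k : nat => (- Z.of_nat k)%Z) (seq 0 N)))
    with (lsum hz (map Z.of_nat (seq 0 N))); [lra|].
  unfold lsum. rewrite !map_map. f_equal. apply map_ext. intros k.
  unfold hz. now rewrite Z.abs_opp.
Qed.

Lemma rsum_list_prod (h : Z -> R) l l' :
  rsum (fun p => h (fst p) * h (snd p)) (list_prod l l') = lsum h l * lsum h l'.
Proof.
  induction l as [|x l IH]; cbn [list_prod]; [unfold rsum, lsum; cbn; lra|].
  rewrite rsum_app, IH.
  replace (rsum (fun p => h (fst p) * h (snd p)) (map (fun y => (x, y)) l'))
    with (h x * lsum h l'); [unfold lsum; cbn; lra|].
  clear. unfold rsum, lsum. rewrite map_map. cbn [fst snd].
  induction l' as [|y l' IH]; cbn; [lra|]. rewrite <- IH. lra.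
Qed.

Lemma in_zbox N m : (Z.abs m < Z.of_nat N)%Z -> In m (zbox N).
Proof.
  intros H. apply in_or_app. destruct (Z_le_gt_dec 0 m).
  - left. apply in_map_iff. exists (Z.to_nat m). split; [lia|]. apply in_seq. lia.
  - right. apply in_map_iff. exists (Z.to_nat (- m)). split; [lia|]. apply in_seq. lia.
Qed.

Lemma incl_zbox (s : list (Z * Z)) : exists N, incl s (list_prod (zbox N) (zbox N)).
Proof.
  assert (exists N, forall p, In p s -> (Z.abs (fst p) < Z.of_nat N)%Z /\ (Z.abs (snd p) < Z.of_nat N)%Z) as [N H].
  { induction s as [|p s [N IH]]; [exists 0%nat; easy|].
    exists (N + S (Z.to_nat (Z.abs (fst p)) + Z.to_nat (Z.abs (snd p))))%nat.
    intros q [<-|Hq]; [lia|]. specialize (IH q Hq). lia. }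
  exists N. intros [m n] Hp. destruct (H _ Hp). apply in_prod; now apply in_zbox.
Qed.

(** The constant is the square of the bound [6] for one coordinate, any finite set being contained
    in a square box. *)
Lemma rsum_hz_bound s : NoDup s -> rsum (fun p => hz (fst p) * hz (snd p)) s <= 36.
Proof.
  intros Hn. destruct (incl_zbox s) as [N Hi].
  eapply Rle_trans; [apply rsum_incl; eauto|].
  - intros p. pose proof (hz_pos (fst p)). pose proof (hz_pos (snd p)). nra.
  - rewrite rsum_list_prod. pose proof (hz_zbox_bound N).
    assert (0 <= lsum hz (zbox N)); [|nra].
    clear. unfold lsum. induction (zbox N) as [|x l IH]; cbn; [lra|]. pose proof (hz_pos x). lra.
Qed.

(** Same shape as the summand in [wp], so that [wp] unfolds to a polar term plus a sum of this form
    by computation. *)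
Definition offO {A : Type} (z : A) (f : Z * Z -> A) (p : Z * Z) : A :=
  if ZZ_eq_dec p (0%Z, 0%Z) then z else f p.

Lemma rect_Cmod_ge a b p :
  0 < a -> 0 < b ->
  Rmin a b * Rmax (IZR (Z.abs (fst p))) (IZR (Z.abs (snd p))) <= Cmod (rect a b p).
Proof.
  intros Ha Hb. rewrite !abs_IZR.
  pose proof (re_le_Cmod (rect a b p)) as H1. pose proof (im_le_Cmod (rect a b p)) as H2.
  rewrite re_rect, Rabs_mult, (Rabs_pos_eq a) in H1 by lra.
  rewrite im_rect, Rabs_mult, (Rabs_pos_eq b) in H2 by lra.
  pose proof (Rmin_l a b). pose proof (Rmin_r a b).
  pose proof (Rabs_pos (IZR (fst p))). pose proof (Rabs_pos (IZR (snd p))).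
  apply Rmax_case; nra.
Qed.

Lemma max_abs_ge_1 (p : Z * Z) :
  p <> (0%Z, 0%Z) -> 1 <= Rmax (IZR (Z.abs (fst p))) (IZR (Z.abs (snd p))).
Proof.
  intros Hp. destruct p as [m n]; cbn [fst snd].
  destruct (Z.eq_dec m 0) as [->|Hm].
  - assert (n <> 0%Z) by congruence.
    eapply Rle_trans; [|apply Rmax_r]. apply IZR_le. lia.
  - eapply Rle_trans; [|apply Rmax_l]. apply IZR_le. lia.
Qed.

Lemma inv_cube_le_hz a b p :
  0 < a -> 0 < b -> p <> (0%Z, 0%Z) ->
  / Cmod (rect a b p) ^ 3 <= 8 / Rmin a b ^ 3 * (hz (fst p) * hz (snd p)).
Proof.
  intros Ha Hb Hp. pose proof (rect_Cmod_ge a b p Ha Hb) as H.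
  pose proof (max_abs_ge_1 p Hp) as HM.
  assert (Hc : 0 < Rmin a b) by (now apply Rmin_pos).
  pose proof (Rmax_l (IZR (Z.abs (fst p))) (IZR (Z.abs (snd p)))) as Hl.
  pose proof (Rmax_r (IZR (Z.abs (fst p))) (IZR (Z.abs (snd p)))) as Hr.
  pose proof (IZR_le 0 (Z.abs (fst p)) ltac:(lia)) as P1.
  pose proof (IZR_le 0 (Z.abs (snd p)) ltac:(lia)) as P2.
  set (M := Rmax _ _) in *. set (c := Rmin a b) in *. unfold hz.
  set (x := IZR (Z.abs (fst p))) in *. set (y := IZR (Z.abs (snd p))) in *.
  assert (Hq : 0 < sqrt (1 + x)) by (apply sqrt_lt_R0; lra).
  assert (Hr' : 0 < sqrt (1 + y)) by (apply sqrt_lt_R0; lra).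
  assert (Hqr : sqrt (1 + x) * sqrt (1 + y) <= 2 * M).
  { rewrite <- sqrt_mult by lra. replace (2 * M) with (sqrt ((2 * M) * (2 * M))) by (apply sqrt_square; lra).
    apply sqrt_le_1_alt. nra. }
  replace (8 / c ^ 3 * (/ sqrt (1 + x) ^ 3 * / sqrt (1 + y) ^ 3))
    with (/ (c ^ 3 * ((sqrt (1 + x) * sqrt (1 + y)) ^ 3 / 8))) by (field; lra).
  assert (0 < sqrt (1 + x) * sqrt (1 + y)) by nra.
  apply Rinv_le_contravar.
  - apply Rmult_lt_0_compat; [now apply pow_lt|]. apply Rdiv_lt_0_compat; [now apply pow_lt|lra].
  - apply Rle_trans with ((c * M) ^ 3).
    + rewrite (Rpow_mult_distr c M). apply Rmult_le_compat_l; [left; now apply pow_lt|].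
      assert (Hcube : (sqrt (1 + x) * sqrt (1 + y)) ^ 3 <= (2 * M) ^ 3) by (apply pow_incr; lra).
      replace ((2 * M) ^ 3) with (8 * M ^ 3) in Hcube by ring. lra.
    + apply pow_incr. split; [nra|exact H].
Qed.

(** Only the nonzero lattice points are kept at distance [d]: the point [0] is allowed, because the
    regular parts of the Weierstrass function and its derivatives are studied there too. *)
Definition away (a b : R) (u : C) (d : R) : Prop :=
  0 < d /\ forall p, p <> (0%Z, 0%Z) -> d <= Cmod (u - rect a b p).

Lemma away_near a b u d v :
  away a b u d -> Cmod (v - u) <= d / 2 -> away a b v (d / 2).
Proof.
  intros [Hd H] Hv. split; [lra|]. intros p Hp. specialize (H p Hp).
  pose proof (Cmod_triangle (v - rect a b p) (u - v)) as T.
  replace (v - rect a b p + (u - v))%C with (u - rect a b p)%C in T by ring.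
  replace (u - v)%C with (- (v - u))%C in T by ring. rewrite Cmod_opp in T. lra.
Qed.

Lemma inv_pow_summable a b u d n :
  0 < a -> 0 < b -> away a b u d ->
  exists B, forall s, NoDup s ->
    rsum (offO 0 (fun p => / Cmod (u - rect a b p) ^ (3 + n))) s <= B.
Proof.
  intros Ha Hb [Hd H].
  (* From [d <= |u - w|] follows [|w| <= |u| + |u - w| <= K |u - w|], so three powers of [|u - w|]
     compare with [|w| ^ 3]; the other [n] are bounded below by [d ^ n]. *)
  set (K := 1 + Cmod u / d).
  assert (HK : 1 <= K) by (unfold K; assert (0 <= Cmod u / d) by (apply Rdiv_le_0_compat; [apply Cmod_ge_0|lra]); lra).
  set (D := / d ^ n * (K ^ 3 * (8 / Rmin a b ^ 3))).
  assert (HD : 0 < / d ^ n) by (apply Rinv_0_lt_compat, pow_lt; lra).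
  assert (HD2 : 0 < D).
  { apply Rmult_lt_0_compat; [exact HD|]. apply Rmult_lt_0_compat; [apply pow_lt; lra|].
    apply Rdiv_lt_0_compat; [lra|]. apply pow_lt. now apply Rmin_pos. }
  exists (D * 36). intros s Hn.
  apply Rle_trans with (rsum (fun p => D * (hz (fst p) * hz (snd p))) s).
  - apply rsum_le. intros p _. unfold offO.
    destruct (ZZ_eq_dec p (0%Z, 0%Z)) as [E|Hp].
    + pose proof (hz_pos (fst p)). pose proof (hz_pos (snd p)).
      apply Rmult_le_pos; [lra|]. nra.
    + specialize (H p Hp).
      assert (HR : Cmod (rect a b p) <= K * Cmod (u - rect a b p)).
      { pose proof (Cmod_triangle u (- (u - rect a b p))) as T. rewrite Cmod_opp in T.
        replace (u + - (u - rect a b p))%C with (rect a b p) in T by ring.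
        unfold K. assert (Cmod u <= Cmod u / d * Cmod (u - rect a b p)); [|nra].
        replace (Cmod u) with (Cmod u / d * d) at 1 by (field; lra).
        apply Rmult_le_compat_l; [apply Rdiv_le_0_compat; [apply Cmod_ge_0|lra]|lra]. }
      assert (Hw : 0 < Cmod (rect a b p)).
      { pose proof (rect_Cmod_ge a b p Ha Hb). pose proof (max_abs_ge_1 p Hp).
        pose proof (Rmin_pos a b Ha Hb). nra. }
      pose proof (inv_cube_le_hz a b p Ha Hb Hp) as H3.
      rewrite (Nat.add_comm 3), pow_add, Rinv_mult. unfold D. rewrite Rmult_assoc.
      apply Rmult_le_compat; [left; apply Rinv_0_lt_compat, pow_lt; lra..| |].
      * apply Rinv_le_contravar; [apply pow_lt; lra|]. apply pow_incr; lra.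
      * rewrite Rmult_assoc. eapply Rle_trans; [|apply Rmult_le_compat_l; [|exact H3]].
        -- replace (K ^ 3 * / Cmod (rect a b p) ^ 3) with (/ (Cmod (rect a b p) / K) ^ 3)
             by (field; lra).
           assert (0 < Cmod (rect a b p) / K) by (apply Rdiv_lt_0_compat; lra).
           apply Rinv_le_contravar; [apply pow_lt; lra|]. apply pow_incr. split; [lra|].
           apply Rmult_le_reg_l with K; [lra|]. 
           replace (K * (Cmod (rect a b p) / K)) with (Cmod (rect a b p)) by (field; lra). lra.
        -- left; apply pow_lt; lra.
  - rewrite rsum_scal. apply Rmult_le_compat_l; [lra|]. now apply rsum_hz_bound.
Qed.

(** * Complex limits and derivatives *)

(** The limit is punctured, so it makes sense at a pole, where the value of the function is junk. *)
Definition clim (f : C -> C) (u l : C) : Prop :=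
  forall eps, 0 < eps -> exists del, 0 < del /\
    forall v, v <> u -> Cmod (v - u) < del -> Cmod (f v - l) < eps.

Definition ccont (f : C -> C) (u : C) : Prop := clim f u (f u).

(** Free of quotients: the case [v = u] needs no exception, and remainders of lattice sums can be
    bounded term by term. *)
Definition cder (f : C -> C) (u l : C) : Prop :=
  forall eps, 0 < eps -> exists del, 0 < del /\
    forall v, Cmod (v - u) < del ->
      Cmod (f v - f u - (v - u) * l) <= eps * Cmod (v - u).

Lemma Cmod_minus_sym (u v : C) : Cmod (u - v) = Cmod (v - u).
Proof. rewrite <- Cmod_opp. f_equal. ring. Qed.

Lemma Cmod_minus_pos (u v : C) : v <> u -> 0 < Cmod (v - u).
Proof. intros H. apply Cmod_gt_0. intro E. apply H, Ceq_minus, E. Qed.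

Lemma clim_const c u : clim (fun _ => c) u c.
Proof.
  intros e He. exists 1. split; [lra|]. intros. replace (c - c)%C with (RtoC 0) by ring.
  now rewrite Cmod_0.
Qed.

Lemma ccont_id u : ccont (fun v => v) u.
Proof. intros e He. exists e. split; auto. Qed.

Lemma clim_ext_loc f g u l d :
  0 < d -> (forall v, v <> u -> Cmod (v - u) < d -> f v = g v) -> clim f u l -> clim g u l.
Proof.
  intros Hd H Hf e He. destruct (Hf e He) as [d1 [Hd1 H1]].
  exists (Rmin d d1). split; [now apply Rmin_pos|]. intros v Hn Hv.
  rewrite <- H; [|auto|eapply Rlt_le_trans; [apply Hv|apply Rmin_l]].
  apply H1; [auto|]. eapply Rlt_le_trans; [apply Hv|apply Rmin_r].
Qed.

Lemma clim_plus f g u l m :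
  clim f u l -> clim g u m -> clim (fun v => f v + g v)%C u (l + m)%C.
Proof.
  intros Hf Hg e He. destruct (Hf (e / 2) ltac:(lra)) as [d1 [Hd1 H1]].
  destruct (Hg (e / 2) ltac:(lra)) as [d2 [Hd2 H2]].
  exists (Rmin d1 d2). split; [now apply Rmin_pos|]. intros v Hn Hv.
  specialize (H1 v Hn (Rlt_le_trans _ _ _ Hv (Rmin_l _ _))).
  specialize (H2 v Hn (Rlt_le_trans _ _ _ Hv (Rmin_r _ _))).
  replace (f v + g v - (l + m))%C with ((f v - l) + (g v - m))%C by ring.
  eapply Rle_lt_trans; [apply Cmod_triangle|]. lra.
Qed.

Lemma clim_mult f g u l m :
  clim f u l -> clim g u m -> clim (fun v => f v * g v)%C u (l * m)%C.
Proof.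
  intros Hf Hg e He.
  pose proof (Cmod_ge_0 l) as Pl. pose proof (Cmod_ge_0 m) as Pm.
  set (k := Cmod l + Cmod m + 1). assert (Hk : 0 < k) by (unfold k; lra).
  set (e' := Rmin 1 (e / k)).
  assert (He' : 0 < e') by (apply Rmin_pos; [lra|now apply Rdiv_lt_0_compat]).
  destruct (Hf e' He') as [d1 [Hd1 H1]]. destruct (Hg e' He') as [d2 [Hd2 H2]].
  exists (Rmin d1 d2). split; [now apply Rmin_pos|]. intros v Hn Hv.
  specialize (H1 v Hn (Rlt_le_trans _ _ _ Hv (Rmin_l _ _))).
  specialize (H2 v Hn (Rlt_le_trans _ _ _ Hv (Rmin_r _ _))).
  replace (f v * g v - l * m)%C
    with ((f v - l) * (g v - m) + (f v - l) * m + l * (g v - m))%C by ring.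
  eapply Rle_lt_trans; [apply Cmod_triangle|].
  eapply Rle_lt_trans; [apply Rplus_le_compat_r, Cmod_triangle|]. rewrite !Cmod_mult.
  pose proof (Cmod_ge_0 (f v - l)). pose proof (Cmod_ge_0 (g v - m)).
  assert (e' <= 1) by apply Rmin_l. assert (e' <= e / k) by apply Rmin_r.
  assert (e' * k <= e).
  { apply Rle_trans with (e / k * k); [nra|]. right. field. lra. }
  unfold k in *. nra.
Qed.

Lemma clim_opp f u l : clim f u l -> clim (fun v => - f v)%C u (- l)%C.
Proof.
  intros H. apply clim_ext_loc with (f := fun v => (-(1) * f v)%C) (d := 1); [lra|intros; ring|].
  replace (- l)%C with (-(1) * l)%C by ring. apply clim_mult; [apply clim_const|exact H].
Qed.

Lemma clim_minus f g u l m :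
  clim f u l -> clim g u m -> clim (fun v => f v - g v)%C u (l - m)%C.
Proof. intros Hf Hg. apply clim_plus; [exact Hf|now apply clim_opp]. Qed.

Lemma clim_affine f al be u l :
  al <> RtoC 0 -> clim f (al * u + be)%C l -> clim (fun v => f (al * v + be)%C) u l.
Proof.
  intros Ha Hf e He. destruct (Hf e He) as [d [Hd H]].
  assert (Hc : 0 < Cmod al) by (now apply Cmod_gt_0).
  assert (E : forall v, (al * v + be - (al * u + be))%C = (al * (v - u))%C) by (intros; ring).
  exists (d / Cmod al). split; [now apply Rdiv_lt_0_compat|]. intros v Hn Hv. apply H.
  - intro E'. apply Hn. apply Ceq_minus. apply Ceq_minus in E'. rewrite E in E'.
    destruct (Ceq_dec (v - u) 0) as [?|Hne]; [assumption|]. now apply Cmult_neq_0 in E'.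
  - rewrite E, Cmod_mult. apply (Rmult_lt_compat_l _ _ _ Hc) in Hv.
    replace (Cmod al * (d / Cmod al)) with d in Hv by (field; lra). exact Hv.
Qed.

Lemma ccont_ball f u : ccont f u -> forall eps, 0 < eps ->
  exists del, 0 < del /\ forall v, Cmod (v - u) < del -> Cmod (f v - f u) < eps.
Proof.
  intros H e He. destruct (H e He) as [d [Hd Hf]]. exists d. split; [exact Hd|].
  intros v Hv. destruct (Ceq_dec v u) as [->|Hn]; [|auto].
  replace (f u - f u)%C with (RtoC 0) by ring. now rewrite Cmod_0.
Qed.

Lemma cder_ccont f u l : cder f u l -> ccont f u.
Proof.
  intros H e He. destruct (H 1 ltac:(lra)) as [d [Hd Hf]].
  pose proof (Cmod_ge_0 l) as Pl.
  exists (Rmin d (e / (2 + Cmod l))). split.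
  { apply Rmin_pos; [exact Hd|]. apply Rdiv_lt_0_compat; lra. }
  intros v _ Hv. specialize (Hf v (Rlt_le_trans _ _ _ Hv (Rmin_l _ _))).
  pose proof (Rlt_le_trans _ _ _ Hv (Rmin_r _ _)) as Hv2.
  apply (Rmult_lt_compat_l (2 + Cmod l)) in Hv2; [|lra].
  replace ((2 + Cmod l) * (e / (2 + Cmod l))) with e in Hv2 by (field; lra).
  pose proof (Cmod_triangle (f v - f u - (v - u) * l) ((v - u) * l)) as T.
  replace (f v - f u - (v - u) * l + (v - u) * l)%C with (f v - f u)%C in T by ring.
  rewrite Cmod_mult in T. pose proof (Cmod_ge_0 (v - u)). nra.
Qed.

Lemma cder_const c u : cder (fun _ => c) u 0.
Proof.
  intros e He. exists 1. split; [lra|]. intros v _.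
  replace (c - c - (v - u) * 0)%C with (RtoC 0) by ring. rewrite Cmod_0.
  pose proof (Cmod_ge_0 (v - u)). nra.
Qed.

Lemma cder_id u : cder (fun v => v) u 1.
Proof.
  intros e He. exists 1. split; [lra|]. intros v _.
  replace (v - u - (v - u) * 1)%C with (RtoC 0) by ring. rewrite Cmod_0.
  pose proof (Cmod_ge_0 (v - u)). nra.
Qed.

Lemma cder_ext_loc f g u l d :
  0 < d -> (forall v, Cmod (v - u) < d -> f v = g v) -> cder f u l -> cder g u l.
Proof.
  intros Hd H Hf e He. destruct (Hf e He) as [d1 [Hd1 H1]].
  exists (Rmin d d1). split; [now apply Rmin_pos|]. intros v Hv.
  rewrite <- !H; [|replace (u - u)%C with (RtoC 0) by ring; now rewrite Cmod_0|eapply Rlt_le_trans; [apply Hv|apply Rmin_l]].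
  apply H1. eapply Rlt_le_trans; [apply Hv|apply Rmin_r].
Qed.

Lemma cder_ext f g u l : (forall v, f v = g v) -> cder f u l -> cder g u l.
Proof. intros H. apply cder_ext_loc with 1; [lra|auto]. Qed.

Lemma cder_plus f g u l m :
  cder f u l -> cder g u m -> cder (fun v => f v + g v)%C u (l + m)%C.
Proof.
  intros Hf Hg e He. destruct (Hf (e / 2) ltac:(lra)) as [d1 [Hd1 H1]].
  destruct (Hg (e / 2) ltac:(lra)) as [d2 [Hd2 H2]].
  exists (Rmin d1 d2). split; [now apply Rmin_pos|]. intros v Hv.
  specialize (H1 v (Rlt_le_trans _ _ _ Hv (Rmin_l _ _))).
  specialize (H2 v (Rlt_le_trans _ _ _ Hv (Rmin_r _ _))).
  replace (f v + g v - (f u + g u) - (v - u) * (l + m))%C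
    with ((f v - f u - (v - u) * l) + (g v - g u - (v - u) * m))%C by ring.
  eapply Rle_trans; [apply Cmod_triangle|]. lra.
Qed.

Lemma cder_mult f g u l m :
  cder f u l -> cder g u m ->
  cder (fun v => f v * g v)%C u (l * g u + f u * m)%C.
Proof.
  intros Hf Hg e He.
  pose proof (Cmod_ge_0 l) as Pl. pose proof (Cmod_ge_0 (f u)) as Pf.
  pose proof (Cmod_ge_0 (g u)) as Pg.
  set (k := Cmod l + Cmod (f u) + Cmod (g u) + 1). assert (Hk : 0 < k) by (unfold k; lra).
  set (e' := Rmin 1 (e / k)).
  assert (He' : 0 < e') by (apply Rmin_pos; [lra|now apply Rdiv_lt_0_compat]).
  destruct (Hf e' He') as [d1 [Hd1 H1]]. destruct (Hg e' He') as [d2 [Hd2 H2]].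
  destruct (ccont_ball g u (cder_ccont _ _ _ Hg) e' He') as [d3 [Hd3 H3]].
  exists (Rmin d1 (Rmin d2 d3)). split; [repeat apply Rmin_pos; assumption|]. intros v Hv.
  pose proof (Rmin_l d1 (Rmin d2 d3)). pose proof (Rmin_r d1 (Rmin d2 d3)).
  pose proof (Rmin_l d2 d3). pose proof (Rmin_r d2 d3).
  specialize (H1 v ltac:(lra)). specialize (H2 v ltac:(lra)). specialize (H3 v ltac:(lra)).
  replace (f v * g v - f u * g u - (v - u) * (l * g u + f u * m))%C
    with ((f v - f u - (v - u) * l) * (g v - g u) + (f v - f u - (v - u) * l) * g u
          + (v - u) * l * (g v - g u) + f u * (g v - g u - (v - u) * m))%C by ring.
  eapply Rle_trans; [apply Cmod_triangle|].
  eapply Rle_trans; [apply Rplus_le_compat_r, Cmod_triangle|].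
  eapply Rle_trans; [apply Rplus_le_compat_r, Rplus_le_compat_r, Cmod_triangle|].
  rewrite !Cmod_mult.
  assert (E1 : e' <= 1) by apply Rmin_l. assert (e' <= e / k) by apply Rmin_r.
  assert (E2 : e' * k <= e).
  { apply Rle_trans with (e / k * k); [nra|]. right. field. lra. }
  pose proof (Cmod_ge_0 (f v - f u - (v - u) * l)) as Q1. pose proof (Cmod_ge_0 (g v - g u)) as Q2.
  pose proof (Cmod_ge_0 (g v - g u - (v - u) * m)) as Q3. pose proof (Cmod_ge_0 (v - u)) as Q4.
  set (x := Cmod (v - u)) in *. set (A := Cmod (f v - f u - (v - u) * l)) in *.
  set (B := Cmod (g v - g u)) in *. set (D := Cmod (g v - g u - (v - u) * m)) in *.
  assert (T1 : A * B <= e' * x * 1) by (apply Rmult_le_compat; lra).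
  assert (T2 : A * Cmod (g u) <= e' * x * Cmod (g u)) by (apply Rmult_le_compat_r; lra).
  assert (T3 : x * Cmod l * B <= x * Cmod l * e') by (apply Rmult_le_compat_l; [nra|lra]).
  assert (T4 : Cmod (f u) * D <= Cmod (f u) * (e' * x)) by (apply Rmult_le_compat_l; lra).
  apply Rle_trans with (e' * k * x); [unfold k; lra|]. apply Rmult_le_compat_r; lra.
Qed.

Lemma cder_scal c f u l : cder f u l -> cder (fun v => c * f v)%C u (c * l)%C.
Proof.
  intros H. replace (c * l)%C with (0 * f u + c * l)%C by ring.
  apply cder_mult; [apply cder_const|exact H].
Qed.

Lemma cder_opp f u l : cder f u l -> cder (fun v => - f v)%C u (- l)%C.
Proof.
  intros H. apply (cder_scal (-(1))) in H. replace (- l)%C with (-(1) * l)%C by ring.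
  revert H. apply cder_ext. intros; ring.
Qed.

Lemma cder_minus f g u l m :
  cder f u l -> cder g u m -> cder (fun v => f v - g v)%C u (l - m)%C.
Proof. intros Hf Hg. apply cder_plus; [exact Hf|now apply cder_opp]. Qed.

Lemma cder_affine f al be u l :
  cder f (al * u + be)%C l -> cder (fun v => f (al * v + be)%C) u (al * l)%C.
Proof.
  intros Hf e He. pose proof (Cmod_ge_0 al) as Pa.
  assert (E : forall v, (al * v + be - (al * u + be))%C = (al * (v - u))%C) by (intros; ring).
  destruct (Hf (e / (1 + Cmod al)) ltac:(apply Rdiv_lt_0_compat; lra)) as [d [Hd H]].
  exists (d / (1 + Cmod al)). split; [apply Rdiv_lt_0_compat; lra|]. intros v Hv.
  pose proof (Cmod_ge_0 (v - u)) as Pv.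
  apply (Rmult_lt_compat_l (1 + Cmod al)) in Hv; [|lra].
  replace ((1 + Cmod al) * (d / (1 + Cmod al))) with d in Hv by (field; lra).
  specialize (H (al * v + be)%C). rewrite E, Cmod_mult in H. specialize (H ltac:(nra)).
  replace ((v - u) * (al * l))%C with (al * (v - u) * l)%C by ring.
  eapply Rle_trans; [exact H|].
  replace (e * Cmod (v - u)) with (e / (1 + Cmod al) * ((1 + Cmod al) * Cmod (v - u))) by (field; lra).
  apply Rmult_le_compat_l; [left; apply Rdiv_lt_0_compat; lra|nra].
Qed.

Lemma cder_shift f w u l : cder f (u + w)%C l -> cder (fun v => f (v + w)%C) u l.
Proof.
  intros H. replace l with (1 * l)%C by ring.
  apply cder_ext with (f := fun v => f (1 * v + w)%C); [intros; f_equal; ring|].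
  apply cder_affine. now replace (1 * u + w)%C with (u + w)%C by ring.
Qed.

Lemma cder_unique f u l m : cder f u l -> cder f u m -> l = m.
Proof.
  intros Hl Hm. apply Ceq_minus, Cmod_eq_0. apply Rle_antisym; [|apply Cmod_ge_0].
  apply le_epsilon. intros e He. rewrite Rplus_0_l.
  destruct (Hl (e / 2) ltac:(lra)) as [d1 [Hd1 H1]]. destruct (Hm (e / 2) ltac:(lra)) as [d2 [Hd2 H2]].
  set (d := Rmin d1 d2 / 2).
  assert (Hd : 0 < Rmin d1 d2) by now apply Rmin_pos.
  assert (E : Cmod (u + RtoC d - u) = d).
  { replace (u + d - u)%C with (RtoC d) by ring. rewrite Cmod_R. apply Rabs_pos_eq. unfold d; lra. }
  specialize (H1 (u + d)%C). specialize (H2 (u + d)%C). rewrite E in H1, H2.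
  pose proof (Rmin_l d1 d2). pose proof (Rmin_r d1 d2).
  specialize (H1 ltac:(unfold d; lra)). specialize (H2 ltac:(unfold d; lra)).
  set (A := (f (u + d) - f u - (u + d - u) * l)%C) in *.
  set (B := (f (u + d) - f u - (u + d - u) * m)%C) in *.
  pose proof (Cmod_triangle B (- A)) as T. rewrite Cmod_opp in T.
  replace (B + - A)%C with ((u + d - u) * (l - m))%C in T by (unfold A, B; ring).
  rewrite Cmod_mult, E in T. assert (0 < d) by (unfold d; lra).
  apply Rmult_le_reg_l with d; [assumption|]. lra.
Qed.

(** * Termwise differentiation of lattice sums *)

Lemma cder_quad f u l d M :
  0 < d ->
  (forall v, Cmod (v - u) < d -> Cmod (f v - f u - (v - u) * l) <= M * Cmod (v - u) ^ 2) ->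
  cder f u l.
Proof.
  intros Hd H e He. set (M' := Rabs M + 1).
  assert (HM : 0 < M') by (unfold M'; pose proof (Rabs_pos M); lra).
  assert (M <= M') by (unfold M'; pose proof (RRle_abs M); lra).
  exists (Rmin d (e / M')). split; [apply Rmin_pos; [lra|now apply Rdiv_lt_0_compat]|].
  intros v Hv. eapply Rle_trans; [apply H; eapply Rlt_le_trans; [apply Hv|apply Rmin_l]|].
  pose proof (Rlt_le_trans _ _ _ Hv (Rmin_r _ _)) as Hv2. pose proof (Cmod_ge_0 (v - u)).
  apply (Rmult_lt_compat_l M') in Hv2; [|lra]. replace (M' * (e / M')) with e in Hv2 by (field; lra).
  apply Rle_trans with (M' * Cmod (v - u) ^ 2); [apply Rmult_le_compat_r; [nra|lra]|].
  simpl. nra.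
Qed.

(** Instead of uniform convergence, a summable majorant [c] of the second-order Taylor coefficients
    is required; summing the remainders gives a quadratic remainder for the sum. *)
Lemma cder_lattice_sum (F : Z * Z -> C -> C) (F' : Z * Z -> C) (S : C -> C) (S' u : C)
    (c : Z * Z -> R) (B d : R) :
  0 < d ->
  (forall v, Cmod (v - u) < d -> is_lattice_sum (fun p => F p v) (S v)) ->
  is_lattice_sum F' S' ->
  (forall p v, Cmod (v - u) < d ->
     Cmod (F p v - F p u - (v - u) * F' p) <= c p * Cmod (v - u) ^ 2) ->
  (forall s, NoDup s -> rsum c s <= B) ->
  cder S u S'.
Proof.
  intros Hd HS HS' HF HB. apply cder_quad with (d := d) (M := B); [exact Hd|].
  intros v Hv.
  assert (Hu : Cmod (u - u) < d) by (replace (u - u)%C with (RtoC 0) by ring; now rewrite Cmod_0).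
  pose proof (is_lattice_sum_minus _ _ _ _
    (is_lattice_sum_minus _ _ _ _ (HS v Hv) (HS u Hu)) (is_lattice_sum_scal (v - u)%C _ _ HS')) as H.
  apply (is_lattice_sum_le _ _ _ H). intros s Hs.
  apply Rle_trans with (rsum (fun p => Cmod (v - u) ^ 2 * c p) s).
  - apply rsum_le. intros p _. rewrite Rmult_comm. now apply HF.
  - rewrite rsum_scal, Rmult_comm. apply Rmult_le_compat_r; [apply pow2_ge_0|auto].
Qed.

Lemma inv_pow_one_taylor n :
  exists M, 0 <= M /\ forall x, Cmod x <= 1 / 2 ->
    Cmod (/ (1 + x) ^ n - 1 + INR n * x) <= M * Cmod x ^ 2.
Proof.
  assert (Hnz : forall x, Cmod x <= 1 / 2 -> 1 / 2 <= Cmod (1 + x)).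
  { intros x Hx. pose proof (Cmod_triangle (1 + x) (- x)) as T. rewrite Cmod_opp in T.
    replace (1 + x + - x)%C with (RtoC 1) in T by ring. rewrite Cmod_1 in T. lra. }
  induction n as [|n [M [HM IH]]].
  - exists 0. split; [lra|]. intros x Hx. cbn [Cpow INR].
    replace (/ 1 - 1 + 0 * x)%C with (RtoC 0) by field. rewrite Cmod_0. lra.
  - exists (INR n + 2 * M + 2 * (1 + INR n / 2)).
    assert (Hn : 0 <= INR n) by apply pos_INR. split; [lra|]. intros x Hx.
    specialize (IH x Hx). specialize (Hnz x Hx).
    assert (Hx0 : (1 + x)%C <> 0) by (intro E; rewrite E, Cmod_0 in Hnz; lra).
    set (r := (/ (1 + x) ^ n - 1 + INR n * x)%C) in *.
    (* The induction hypothesis is multiplied by [/ (1 + x) = 1 - x + x * x / (1 + x)]; what remains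
       beyond the linear term is quadratic in [x] or contains [r]. *)
    replace (/ (1 + x) ^ S n - 1 + INR (S n) * x)%C
      with (INR n * (x * x) + r * / (1 + x) + (1 - INR n * x) * ((x * x) * / (1 + x)))%C.
    2:{ unfold r. rewrite S_INR, RtoC_plus. cbn [Cpow].
        pose proof (Cpow_nz _ n Hx0). field. now split. }
    assert (Hi : Cmod (/ (1 + x)) <= 2).
    { rewrite Cmod_inv by exact Hx0. replace 2 with (/ (1 / 2)) by field.
      apply Rinv_le_contravar; lra. }
    assert (H1 : Cmod (1 - INR n * x) <= 1 + INR n / 2).
    { unfold Cminus. eapply Rle_trans; [apply Cmod_triangle|]. rewrite Cmod_opp, Cmod_mult, Cmod_1, Cmod_R.
      rewrite Rabs_pos_eq by exact Hn. nra. }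
    eapply Rle_trans; [apply Cmod_triangle|].
    eapply Rle_trans; [apply Rplus_le_compat_r, Cmod_triangle|].
    rewrite !Cmod_mult, Cmod_R, (Rabs_pos_eq (INR n)) by exact Hn.
    pose proof (Cmod_ge_0 x). pose proof (Cmod_ge_0 (/ (1 + x))).
    pose proof (Cmod_ge_0 (1 - INR n * x)). pose proof (Cmod_ge_0 r).
    set (X := Cmod x) in *. set (I := Cmod (/ (1 + x))) in *.
    assert (Cmod r * I <= M * X ^ 2 * 2) by (apply Rmult_le_compat; lra).
    assert (Cmod (1 - INR n * x) * (X * X * I) <= (1 + INR n / 2) * (X * X * 2)).
    { apply Rmult_le_compat; [lra|nra|lra|]. apply Rmult_le_compat_l; nra. }
    nra.
Qed.

(** Homogeneity reduces this to the expansion at [1] with increment [h / z]; the constant does not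
    depend on [z], so one majorant serves all lattice points. *)
Lemma inv_pow_taylor n :
  exists M, 0 <= M /\ forall z h, z <> RtoC 0 -> Cmod h <= Cmod z / 2 ->
    Cmod (/ (z + h) ^ n - / z ^ n - h * (- INR n * / z ^ S n))
      <= M * / Cmod z ^ S (S n) * Cmod h ^ 2.
Proof.
  destruct (inv_pow_one_taylor n) as [M [HM H]]. exists M. split; [exact HM|].
  intros z h Hz Hh. assert (Hz0 : 0 < Cmod z) by now apply Cmod_gt_0.
  specialize (H (h / z)%C). rewrite Cmod_div in H by exact Hz.
  specialize (H ltac:(apply Rmult_le_reg_r with (Cmod z); [lra|]; unfold Rdiv; rewrite Rmult_assoc, Rinv_l; lra)).
  assert (Hzh : (z + h)%C <> 0).
  { intro E. pose proof (Cmod_triangle (z + h) (- h)) as T. rewrite Cmod_opp in T.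
    replace (z + h + - h)%C with z in T by ring. rewrite E, Cmod_0 in T. lra. }
  pose proof (Cpow_nz _ n Hz). pose proof (Cpow_nz _ n Hzh).
  replace (/ (z + h) ^ n - / z ^ n - h * (- INR n * / z ^ S n))%C
    with (/ z ^ n * (/ (1 + h / z) ^ n - 1 + INR n * (h / z)))%C.
  2:{ replace (1 + h / z)%C with ((z + h) * / z)%C by (field; exact Hz).
      rewrite Cpow_mult_l, Cpow_inv by exact Hz. cbn [Cpow]. field. repeat split; assumption. }
  rewrite Cmod_mult, Cmod_inv, Cmod_pow by assumption.
  assert (Hp : 0 < / Cmod z ^ n) by (apply Rinv_0_lt_compat, pow_lt; lra).
  eapply Rle_trans; [apply Rmult_le_compat_l; [left; exact Hp|exact H]|].
  right. simpl. field. split; [apply pow_nonzero|]; lra.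
Qed.

Lemma away_nz a b u d p : away a b u d -> p <> (0%Z, 0%Z) -> (u - rect a b p)%C <> 0.
Proof. intros [Hd H] Hp E. specialize (H p Hp). rewrite E, Cmod_0 in H. lra. Qed.

(** Up to constants, these are the regular parts at the origin of the derivatives of the Weierstrass
    function. The exponent starts at [3], the first power for which the lattice sum converges
    absolutely. The value [zsum a b 1 0] is the Eisenstein series of weight 4, called G4 below. *)
Definition zsum (a b : R) (n : nat) (u : C) : C :=
  lattice_sum (offO (RtoC 0) (fun p => / (u - rect a b p) ^ (3 + n))%C).

Lemma is_zsum a b u d n :
  0 < a -> 0 < b -> away a b u d ->
  is_lattice_sum (offO (RtoC 0) (fun p => / (u - rect a b p) ^ (3 + n))%C) (zsum a b n u).
Proof.
  intros Ha Hb H. destruct (inv_pow_summable a b u d n Ha Hb H) as [B HB].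
  apply is_lattice_sum_lattice_sum with B. intros s Hs. eapply Rle_trans; [|apply HB, Hs].
  apply rsum_le. intros p _. unfold offO. destruct (ZZ_eq_dec p (0%Z, 0%Z)) as [_|Hp].
  - rewrite Cmod_0. lra.
  - pose proof (away_nz _ _ _ _ _ H Hp). rewrite Cmod_inv, Cmod_pow by now apply Cpow_nz. lra.
Qed.

(** The summand [r] drops out of the increment. It is zero for [zsum] and the subtracted [1 / w ^ 2]
    for [wp0], so one estimate covers both. *)
Lemma offO_taylor a b u d n (r : Z * Z -> C) :
  0 < a -> 0 < b -> away a b u d ->
  exists c B, (forall s, NoDup s -> rsum c s <= B) /\
    forall p v, Cmod (v - u) < d / 2 ->
     Cmod (offO (RtoC 0) (fun p => / (v - rect a b p) ^ (2 + n) - r p)%C p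
           - offO (RtoC 0) (fun p => / (u - rect a b p) ^ (2 + n) - r p)%C p
           - (v - u) * (- INR (2 + n) * offO (RtoC 0) (fun p => / (u - rect a b p) ^ (3 + n))%C p))
       <= c p * Cmod (v - u) ^ 2.
Proof.
  intros Ha Hb H. destruct (inv_pow_taylor (2 + n)) as [M [HM HT]].
  destruct (inv_pow_summable a b u d (S n) Ha Hb H) as [B HB].
  exists (fun p => M * offO 0 (fun p => / Cmod (u - rect a b p) ^ (3 + S n)) p), (M * B).
  split.
  - intros s Hs. rewrite rsum_scal. apply Rmult_le_compat_l; auto.
  - intros p v Hv. unfold offO. destruct (ZZ_eq_dec p (0%Z, 0%Z)) as [_|Hp].
    + replace (0 - 0 - (v - u) * (- INR (2 + n) * 0))%C with (RtoC 0) by ring.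
      rewrite Cmod_0, Rmult_0_r, Rmult_0_l. lra.
    + pose proof (away_nz _ _ _ _ _ H Hp) as Hz. destruct H as [Hd H]. specialize (H p Hp).
      specialize (HT (u - rect a b p)%C (v - u)%C Hz ltac:(lra)).
      replace (u - rect a b p + (v - u))%C with (v - rect a b p)%C in HT by ring.
      replace (3 + S n)%nat with (S (S (2 + n))) by lia.
      replace (3 + n)%nat with (S (2 + n)) by lia.
      eapply Rle_trans; [|exact HT]. right. f_equal. ring.
Qed.

Lemma cder_zsum a b u d n :
  0 < a -> 0 < b -> away a b u d ->
  cder (zsum a b n) u (- INR (3 + n) * zsum a b (S n) u)%C.
Proof.
  intros Ha Hb H. destruct (offO_taylor a b u d (S n) (fun _ => RtoC 0) Ha Hb H) as [c [B [HB HT]]].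
  apply cder_lattice_sum with (d := d / 2) (B := B) (c := c)
    (F := fun p v => offO (RtoC 0) (fun p => / (v - rect a b p) ^ (3 + n))%C p)
    (F' := fun p => (- INR (3 + n) * offO (RtoC 0) (fun p => / (u - rect a b p) ^ (3 + S n))%C p)%C).
  - destruct H; lra.
  - intros v Hv. apply is_zsum with (d / 2); auto. apply away_near with u; [exact H|lra].
  - apply is_lattice_sum_scal. apply is_zsum with d; auto.
  - intros p v Hv. eapply Rle_trans; [|apply (HT p v Hv)]. right. f_equal.
    unfold offO. destruct (ZZ_eq_dec p (0%Z, 0%Z)); replace (2 + S n)%nat with (3 + n)%nat by lia; ring.
  - exact HB.
Qed.

Definition wp0 (a b : R) (u : C) : C :=
  lattice_sum (offO (RtoC 0) (fun p => 1 / (u - rect a b p) ^ 2 - 1 / rect a b p ^ 2)%C).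

Lemma rect_nz a b p : 0 < a -> 0 < b -> p <> (0%Z, 0%Z) -> rect a b p <> RtoC 0.
Proof.
  intros Ha Hb Hp E. pose proof (rect_Cmod_ge a b p Ha Hb) as H. rewrite E, Cmod_0 in H.
  pose proof (max_abs_ge_1 p Hp). pose proof (Rmin_pos a b Ha Hb). nra.
Qed.

Lemma away_0 a b : 0 < a -> 0 < b -> away a b 0 (Rmin a b).
Proof.
  intros Ha Hb. pose proof (Rmin_pos a b Ha Hb). split; [assumption|]. intros p Hp.
  rewrite Cmod_minus_sym. replace (rect a b p - 0)%C with (rect a b p) by ring.
  pose proof (rect_Cmod_ge a b p Ha Hb). pose proof (max_abs_ge_1 p Hp). nra.
Qed.

Lemma is_wp0 a b u d :
  0 < a -> 0 < b -> away a b u d ->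
  is_lattice_sum (offO (RtoC 0) (fun p => 1 / (u - rect a b p) ^ 2 - 1 / rect a b p ^ 2)%C)
    (wp0 a b u).
Proof.
  intros Ha Hb H. destruct (inv_pow_summable a b u d 0 Ha Hb H) as [B HB].
  pose proof (away_0 a b Ha Hb) as H0.
  destruct (inv_pow_summable a b 0 _ 0 Ha Hb H0) as [B0 HB0].
  apply is_lattice_sum_lattice_sum with (2 * Cmod u * B + 2 * Cmod u * B0). intros s Hs.
  apply Rle_trans with
    (rsum (fun p => 2 * Cmod u * offO 0 (fun p => / Cmod (u - rect a b p) ^ (3 + 0)) p) s
     + rsum (fun p => 2 * Cmod u * offO 0 (fun p => / Cmod (0 - rect a b p) ^ (3 + 0)) p) s).
  2:{ rewrite !rsum_scal. pose proof (Cmod_ge_0 u).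
      apply Rplus_le_compat; apply Rmult_le_compat_l; auto; lra. }
  clear Hs. unfold rsum. induction s as [|p s IH]; cbn [map fold_right]; [lra|].
  enough (E : Cmod (offO (RtoC 0) (fun p0 => 1 / (u - rect a b p0) ^ 2 - 1 / rect a b p0 ^ 2)%C p)
    <= 2 * Cmod u * offO 0 (fun p => / Cmod (u - rect a b p) ^ (3 + 0)) p
       + 2 * Cmod u * offO 0 (fun p => / Cmod (0 - rect a b p) ^ (3 + 0)) p) by lra.
  unfold offO. destruct (ZZ_eq_dec p (0%Z, 0%Z)) as [_|Hp]; [rewrite Cmod_0; lra|].
  pose proof (away_nz _ _ _ _ _ H Hp) as N1. pose proof (rect_nz a b p Ha Hb Hp) as N2.
  replace (0 - rect a b p)%C with (- rect a b p)%C by ring. rewrite Cmod_opp.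
  set (z := (u - rect a b p)%C) in *. set (w := rect a b p) in *.
  (* Here [z + w = u], so the difference of squares contains the factor [u] and each term decays
     like an inverse cube. *)
  replace (1 / z ^ 2 - 1 / w ^ 2)%C with (- u * (z - w) * / z ^ 2 * / w ^ 2)%C
    by (unfold z; cbn [Cpow]; field; split; assumption).
  assert (P1 : 0 < Cmod z) by now apply Cmod_gt_0.
  assert (P2 : 0 < Cmod w) by now apply Cmod_gt_0.
  rewrite !Cmod_mult, !Cmod_inv, !Cmod_pow, Cmod_opp by (now apply Cpow_nz).
  assert (T : Cmod (z - w) <= Cmod z + Cmod w).
  { unfold Cminus. eapply Rle_trans; [apply Cmod_triangle|]. rewrite Cmod_opp. lra. }
  pose proof (Cmod_ge_0 u) as Pu. set (U := Cmod u) in *. set (x := Cmod z) in *. set (y := Cmod w) in *.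
  assert (Q1 : 0 < / x) by now apply Rinv_0_lt_compat. assert (Q2 : 0 < / y) by now apply Rinv_0_lt_compat.
  rewrite <- !pow_inv.
  apply Rle_trans with (U * (x + y) * (/ x) ^ 2 * (/ y) ^ 2).
  { do 2 (apply Rmult_le_compat_r; [apply pow2_ge_0|]). now apply Rmult_le_compat_l. }
  replace (U * (x + y) * (/ x) ^ 2 * (/ y) ^ 2) with (U * (/ x * (/ y) ^ 2 + (/ x) ^ 2 * / y))
    by (field; lra).
  replace (2 * U * (/ x) ^ (3 + 0) + 2 * U * (/ y) ^ (3 + 0)) with (U * (2 * ((/ x) ^ 3 + (/ y) ^ 3)))
    by (simpl; ring).
  apply Rmult_le_compat_l; [lra|]. set (X := / x) in *. set (Y := / y) in *.
  (* This is [X * Y ^ 2 + X ^ 2 * Y <= X ^ 3 + Y ^ 3], which separates the mixed terms into two sums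
     that are known to be bounded. *)
  assert (0 <= (X + Y) * (X - Y) ^ 2) by (apply Rmult_le_pos; [lra|apply pow2_ge_0]).
  assert (0 <= X ^ 3) by (apply pow_le; lra). assert (0 <= Y ^ 3) by (apply pow_le; lra).
  simpl in *. nra.
Qed.

Lemma cder_wp0 a b u d :
  0 < a -> 0 < b -> away a b u d -> cder (wp0 a b) u (- 2 * zsum a b 0 u)%C.
Proof.
  intros Ha Hb H.
  destruct (offO_taylor a b u d 0 (fun p => 1 / rect a b p ^ 2)%C Ha Hb H) as [c [B [HB HT]]].
  apply cder_lattice_sum with (d := d / 2) (B := B) (c := c)
    (F := fun p v => offO (RtoC 0) (fun p => 1 / (v - rect a b p) ^ 2 - 1 / rect a b p ^ 2)%C p)
    (F' := fun p => (- 2 * offO (RtoC 0) (fun p => / (u - rect a b p) ^ (3 + 0))%C p)%C).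
  - destruct H; lra.
  - intros v Hv. apply is_wp0 with (d / 2); auto. apply away_near with u; [exact H|lra].
  - apply is_lattice_sum_scal. apply is_zsum with d; auto.
  - intros p v Hv. eapply Rle_trans; [|apply (HT p v Hv)]. right. f_equal.
    replace (INR (2 + 0)) with 2 by (simpl; ring).
    unfold offO, Cdiv. destruct (ZZ_eq_dec p (0%Z, 0%Z)); cbn [Nat.add]; rewrite ?RtoC_opp; ring.
  - exact HB.
Qed.

(** * Derivatives along curves and mean value estimates *)

Lemma Cmod_le_abs (z : C) : Cmod z <= Rabs (Re z) + Rabs (Im z).
Proof.
  replace z with (RtoC (Re z) + Ci * RtoC (Im z))%C at 1 by (apply C_ext; cbn; ring).
  eapply Rle_trans; [apply Cmod_triangle|]. rewrite Cmod_mult, Cmod_Ci, !Cmod_R. lra.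
Qed.

(** Stated for the real part because the integrals and mean value theorems below are real; the
    imaginary part is reached by applying it to [- Ci * f]. *)
Lemma cder_curve f (g : R -> C) t g' l :
  is_derive (fun s => Re (g s)) t (Re g') -> is_derive (fun s => Im (g s)) t (Im g') ->
  cder f (g t) l -> is_derive (fun s => Re (f (g s))) t (Re (l * g')%C).
Proof.
  rewrite !is_derive_Reals. intros H1 H2 Hf e He.
  set (k := Cmod g' + Cmod l + 1).
  assert (Pg : 0 <= Cmod g') by apply Cmod_ge_0. assert (Pl : 0 <= Cmod l) by apply Cmod_ge_0.
  assert (Hk : 0 < k) by (unfold k; lra).
  set (e1 := Rmin 1 (e / (2 * k))).
  assert (He1 : 0 < e1) by (apply Rmin_pos; [lra|apply Rdiv_lt_0_compat; lra]).
  assert (E1 : e1 <= 1) by apply Rmin_l. assert (E2 : e1 <= e / (2 * k)) by apply Rmin_r.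
  assert (E3 : e1 * k <= e / 2).
  { apply Rle_trans with (e / (2 * k) * k); [nra|]. right; field; lra. }
  destruct (H1 (e1 / 2) ltac:(lra)) as [d1 D1]. destruct (H2 (e1 / 2) ltac:(lra)) as [d2 D2].
  destruct (Hf e1 He1) as [d3 [Hd3 D3]].
  assert (Hd : 0 < Rmin (Rmin d1 d2) (d3 / k)).
  { repeat apply Rmin_pos; try apply cond_pos. now apply Rdiv_lt_0_compat. }
  exists (mkposreal _ Hd). cbn [pos]. intros h Hh0 Hh.
  pose proof (Rmin_l (Rmin d1 d2) (d3 / k)). pose proof (Rmin_r (Rmin d1 d2) (d3 / k)).
  pose proof (Rmin_l d1 d2). pose proof (Rmin_r d1 d2).
  specialize (D1 h Hh0 ltac:(lra)). specialize (D2 h Hh0 ltac:(lra)).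
  set (q := ((g (t + h)%R - g t) / RtoC h - g')%C).
  assert (Hhc : RtoC h <> 0) by (intro E; apply RtoC_inj in E; lra).
  assert (Hq : Cmod q < e1).
  { eapply Rle_lt_trans; [apply Cmod_le_abs|].
    assert (Rq : Re q = (Re (g (t + h)) - Re (g t)) / h - Re g') by (unfold q, Cdiv, Cminus; rewrite <- RtoC_inv by lra; now rewrite re_plus, re_opp, re_scal_r, re_plus, re_opp).
    assert (Iq : Im q = (Im (g (t + h)) - Im (g t)) / h - Im g') by (unfold q, Cdiv, Cminus; rewrite <- RtoC_inv by lra; now rewrite im_plus, im_opp, im_scal_r, im_plus, im_opp).
    rewrite Rq, Iq. lra. }
  assert (Eg : (g (t + h)%R - g t)%C = (h * (g' + q))%C) by (unfold q; field; exact Hhc).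
  assert (Pq : Cmod (g' + q) <= k).
  { eapply Rle_trans; [apply Cmod_triangle|]. unfold k; lra. }
  assert (Hah : 0 < Rabs h) by now apply Rabs_pos_lt.
  assert (Hgm : Cmod (g (t + h)%R - g t) <= Rabs h * k).
  { rewrite Eg, Cmod_mult, Cmod_R. apply Rmult_le_compat_l; lra. }
  specialize (D3 (g (t + h)%R)). 
  assert (Hlt : Rabs h * k < d3).
  { apply Rlt_le_trans with (d3 / k * k); [apply Rmult_lt_compat_r; lra|right; field; lra]. }
  specialize (D3 ltac:(lra)).
  set (A := (f (g (t + h)%R) - f (g t) - (g (t + h)%R - g t) * l)%C) in *.
  replace ((Re (f (g (t + h))) - Re (f (g t))) / h - Re (l * g')) with (Re ((A / h + q * l)%C)).
  2:{ unfold A. rewrite Eg. replace ((f (g (t + h)%R) - f (g t) - h * (g' + q) * l) / h + q * l)%C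
        with ((f (g (t + h)%R) - f (g t)) * / h - l * g')%C by (field; exact Hhc).
      rewrite <- RtoC_inv by lra. unfold Cminus. rewrite re_plus, re_opp, re_scal_r, re_plus, re_opp. field; lra. }
  eapply Rle_lt_trans; [apply re_le_Cmod|].
  eapply Rle_lt_trans; [apply Cmod_triangle|].
  rewrite Cmod_div, Cmod_mult, Cmod_R by exact Hhc.
  assert (Cmod A / Rabs h <= e1 * k).
  { apply Rmult_le_reg_r with (Rabs h); [lra|]. unfold Rdiv. rewrite Rmult_assoc, Rinv_l by lra.
    rewrite Rmult_1_r. nra. }
  assert (Cmod q * Cmod l <= e1 * Cmod l) by (apply Rmult_le_compat_r; lra).
  assert (e1 * Cmod l < e1 * k) by (apply Rmult_lt_compat_l; [lra|unfold k; lra]).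
  lra.
Qed.

Lemma is_derive_segment f z d t l :
  cder f (z + RtoC t * d)%C l ->
  is_derive (fun s : R => Re (f (z + RtoC s * d)%C)) t (Re (l * d)%C).
Proof.
  intros H. apply (cder_curve f (fun s => (z + RtoC s * d)%C)); [| |exact H].
  - apply is_derive_ext with (fun s : R => Re z + s * Re d); [intros s; rewrite re_plus, re_scal_l; reflexivity|].
    auto_derive; [easy|ring].
  - apply is_derive_ext with (fun s : R => Im z + s * Im d); [intros s; rewrite im_plus, im_scal_l; reflexivity|].
    auto_derive; [easy|ring].
Qed.

(** The real mean value theorem is applied to [Re (c * f)] along the segment, with [c] the conjugate
    of [f v - f u]: its total increment is [|f v - f u| ^ 2]. *)
Lemma mean_value_inequality f f' u v M :
  (forall t, 0 <= t <= 1 -> cder f (u + RtoC t * (v - u))%C (f' (u + RtoC t * (v - u))%C)) ->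
  (forall t, 0 <= t <= 1 -> Cmod (f' (u + RtoC t * (v - u))%C) <= M) ->
  Cmod (f v - f u) <= M * Cmod (v - u).
Proof.
  intros Hd HM. set (c := Cconj (f v - f u)).
  destruct (MVT_gen (fun t : R => Re (c * f (u + RtoC t * (v - u))%C)%C) 0 1
    (fun t : R => Re (c * f' (u + RtoC t * (v - u))%C * (v - u))%C)) as [t [Ht E]].
  - intros t Ht. rewrite Rmin_left, Rmax_right in Ht by lra.
    apply (is_derive_segment (fun w => c * f w)%C). apply cder_scal, Hd. lra.
  - intros t Ht. rewrite Rmin_left, Rmax_right in Ht by lra.
    apply continuity_pt_filterlim.
    apply (ex_derive_continuous (fun t : R => Re (c * f (u + RtoC t * (v - u))%C)%C) t).
    eexists. apply (is_derive_segment (fun w => c * f w)%C). apply cder_scal, Hd. lra.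
  - rewrite Rmin_left, Rmax_right in Ht by lra. specialize (HM t Ht).
    replace (u + 1 * (v - u))%C with v in E by ring. replace (u + 0 * (v - u))%C with u in E by ring.
    assert (E2 : Re (c * f v) - Re (c * f u) = Cmod (f v - f u) ^ 2).
    { apply RtoC_inj. rewrite Cmod2_conj. 
      replace (Re (c * f v) - Re (c * f u)) with (Re (c * (f v - f u))%C).
      - unfold c. apply C_ext; cbn; ring.
      - unfold Cminus. rewrite Cmult_plus_distr_l, re_plus.
        replace (c * - f u)%C with (- (c * f u))%C by ring. rewrite re_opp. ring. }
    rewrite E2 in E. pose proof (re_le_Cmod (c * f' (u + RtoC t * (v - u)) * (v - u))%C) as Hr.
    rewrite !Cmod_mult in Hr. unfold c at 2 in Hr. rewrite Cmod_conj in Hr.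
    pose proof (RRle_abs (Re (c * f' (u + RtoC t * (v - u)) * (v - u))%C)) as Hr2.
    pose proof (Cmod_ge_0 (f v - f u)) as P1. pose proof (Cmod_ge_0 (v - u)) as P2.
    set (X := Cmod (f v - f u)) in *. set (Y := Cmod (v - u)) in *.
    assert (X * Cmod (f' (u + t * (v - u))%C) * Y <= X * M * Y).
    { apply Rmult_le_compat_r; [lra|]. apply Rmult_le_compat_l; lra. }
    destruct (Rle_lt_or_eq_dec _ _ P1) as [Hp|<-].
    + apply Rmult_le_reg_l with X; [exact Hp|]. replace (X ^ 2) with (X * X) in E by ring. lra.
    + pose proof (Cmod_ge_0 (f' (u + t * (v - u))%C)). apply Rmult_le_pos; lra.
Qed.

Lemma segment_dist (u v : C) t :
  0 <= t <= 1 -> Cmod (u + RtoC t * (v - u) - u) <= Cmod (v - u).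
Proof.
  intros Ht. replace (u + t * (v - u) - u)%C with (t * (v - u))%C by ring.
  rewrite Cmod_mult, Cmod_R, Rabs_pos_eq by lra. pose proof (Cmod_ge_0 (v - u)). nra.
Qed.

(** Subtracting [l / 2 * (v - u) ^ 2] leaves a function whose derivative is [o(v - u)], and the mean
    value inequality makes its increment [o((v - u) ^ 2)]. Differentiability of [g'] at the single
    point [u] is enough. *)
Lemma clim_taylor2 g g' u l d :
  0 < d -> (forall v, Cmod (v - u) < d -> cder g v (g' v)) ->
  g' u = RtoC 0 -> cder g' u l ->
  clim (fun v => (g v - g u) / (v - u) ^ 2)%C u (l / 2)%C.
Proof.
  intros Hd Hg H0 Hg' e He. destruct (Hg' (e / 2) ltac:(lra)) as [d1 [Hd1 H1]].
  exists (Rmin d d1). split; [now apply Rmin_pos|]. intros v Hn Hv.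
  pose proof (Rlt_le_trans _ _ _ Hv (Rmin_l _ _)) as Hva.
  pose proof (Rlt_le_trans _ _ _ Hv (Rmin_r _ _)) as Hvb.
  pose proof (Cmod_minus_pos u v Hn) as Hp.
  assert (Hm : Cmod ((g v - l / 2 * ((v - u) * (v - u))) - (g u - l / 2 * ((u - u) * (u - u))))
    <= e / 2 * Cmod (v - u) * Cmod (v - u)).
  { apply (mean_value_inequality (fun w => g w - l / 2 * ((w - u) * (w - u)))%C
      (fun w => g' w - l / 2 * ((1 - 0) * (w - u) + (w - u) * (1 - 0)))%C).
    - intros t Ht. pose proof (segment_dist u v t Ht).
      apply cder_minus; [apply Hg; lra|]. apply cder_scal.
      apply (cder_mult (fun w => w - u)%C (fun w => w - u)%C); exact (cder_minus (fun w => w) (fun _ => u) _ _ _ (cder_id _) (cder_const _ _)).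
    - intros t Ht. pose proof (segment_dist u v t Ht) as Hs. set (w := (u + t * (v - u))%C) in *.
      specialize (H1 w ltac:(lra)). rewrite H0 in H1.
      replace (g' w - l / 2 * ((1 - 0) * (w - u) + (w - u) * (1 - 0)))%C
        with (g' w - 0 - (w - u) * l)%C by field.
      eapply Rle_trans; [exact H1|]. apply Rmult_le_compat_l; lra. }
  replace ((g v - g u) / (v - u) ^ 2 - l / 2)%C
    with (((g v - l / 2 * ((v - u) * (v - u))) - (g u - l / 2 * ((u - u) * (u - u)))) / (v - u) ^ 2)%C.
  2:{ cbn [Cpow]. field. intro E. apply Hn, Ceq_minus, E. }
  rewrite Cmod_div, Cmod_pow by (apply Cpow_nz; intro E; apply Hn, Ceq_minus, E).
  apply Rle_lt_trans with (e / 2); [|lra].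
  apply Rmult_le_reg_r with (Cmod (v - u) ^ 2); [now apply pow_lt|].
  unfold Rdiv at 1. rewrite Rmult_assoc, Rinv_l; [|apply pow_nonzero; lra]. simpl. lra.
Qed.

(** * The mean value property *)

Definition cis (t : R) : C := (cos t, sin t).

Lemma Cmod_cis t : Cmod (cis t) = 1.
Proof.
  unfold Cmod, cis. cbn [fst snd]. rewrite <- sqrt_1. f_equal.
  pose proof (sin2_cos2 t). unfold Rsqr in *. lra.
Qed.

Lemma circle_pt z r t : (z + RtoC r * cis t)%C = (Re z + r * cos t, Im z + r * sin t).
Proof. destruct z. apply injective_projections; cbn; ring. Qed.

Lemma continuity_2d_pt_ccont (f : C -> C) (X Y : R -> R -> R) x y :
  continuity_2d_pt X x y -> continuity_2d_pt Y x y -> ccont f (X x y, Y x y) ->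
  continuity_2d_pt (fun u v => Re (f (X u v, Y u v))) x y.
Proof.
  intros HX HY Hf e. destruct (ccont_ball _ _ Hf e (cond_pos e)) as [d [Hd H]].
  assert (Hd2 : 0 < d / 2) by lra.
  destruct (HX (mkposreal _ Hd2)) as [d1 D1]. destruct (HY (mkposreal _ Hd2)) as [d2 D2].
  exists (mkposreal _ (Rmin_pos _ _ (cond_pos d1) (cond_pos d2))). cbn [pos] in *. intros u v Hu Hv.
  pose proof (Rmin_l d1 d2). pose proof (Rmin_r d1 d2).
  specialize (D1 u v ltac:(lra) ltac:(lra)). specialize (D2 u v ltac:(lra) ltac:(lra)).
  replace (Re (f (X u v, Y u v)) - Re (f (X x y, Y x y)))
    with (Re (f (X u v, Y u v) - f (X x y, Y x y))%C) by (unfold Cminus; now rewrite re_plus, re_opp).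
  eapply Rle_lt_trans; [apply re_le_Cmod|]. apply H.
  eapply Rle_lt_trans; [apply Cmod_le_abs|]. cbn. unfold Rminus in *. lra.
Qed.

Lemma ccont_continuous_circle (f : C -> C) z r t :
  ccont f (z + RtoC r * cis t)%C -> continuous (fun s => Re (f (z + RtoC r * cis s)%C)) t.
Proof.
  intros Hf.
  assert (H : continuity_2d_pt (fun u v => Re (f (Re z + r * cos v, Im z + r * sin v))) 0 t).
  { apply (continuity_2d_pt_ccont f (fun u v => Re z + r * cos v) (fun u v => Im z + r * sin v)).
    - apply continuity_2d_pt_plus; [apply continuity_2d_pt_const|].
      apply continuity_2d_pt_mult; [apply continuity_2d_pt_const|].
      apply continuity_1d_2d_pt_comp; [apply continuity_cos|apply continuity_2d_pt_id2].
    - apply continuity_2d_pt_plus; [apply continuity_2d_pt_const|].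
      apply continuity_2d_pt_mult; [apply continuity_2d_pt_const|].
      apply continuity_1d_2d_pt_comp; [apply continuity_sin|apply continuity_2d_pt_id2].
    - replace (Re z + r * cos t, Im z + r * sin t) with (z + r * cis t)%C; [exact Hf|].
      apply circle_pt. }
  intros P [e He]. destruct (H e) as [d Hd]. exists d. intros s Hs. apply He.
  replace (z + r * cis s)%C with (Re z + r * cos s, Im z + r * sin s) by (symmetry; apply circle_pt).
  replace (z + r * cis t)%C with (Re z + r * cos t, Im z + r * sin t) by (symmetry; apply circle_pt).
  apply (Hd 0 s); [rewrite Rminus_0_r, Rabs_R0; apply cond_pos|exact Hs].
Qed.

(** The integral over the circle of radius [s] has as derivative in [s] the integral of
    [Re (f' * cis t)]. Now [s] times this integrand is the [t]-derivative of [Im f] along the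
    circle, so it integrates to zero over a full turn, and the circle integral keeps its value at
    [s = 0]. Continuity of [f'] justifies differentiation under the integral. *)
Lemma mean_value_circle f f' z R0 r :
  (forall v, Cmod (v - z) < R0 -> cder f v (f' v) /\ ccont f' v) -> 0 < r < R0 ->
  RInt (fun t => Re (f (z + RtoC r * cis t)%C)) 0 (2 * PI) = 2 * PI * Re (f z).
Proof.
  intros H Hr.
  assert (Hin : forall s t, Rabs s < R0 -> Cmod (z + RtoC s * cis t - z) < R0).
  { intros s t Hs. replace (z + s * cis t - z)%C with (s * cis t)%C by ring.
    rewrite Cmod_mult, Cmod_R, Cmod_cis. lra. }
  assert (Dr : forall s t, Rabs s < R0 ->
    is_derive (fun s : R => Re (f (z + RtoC s * cis t)%C)) s (Re (f' (z + RtoC s * cis t) * cis t)%C)).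
  { intros s t Hs. apply is_derive_segment. now apply H, Hin. }
  assert (Dt : forall s t, Rabs s < R0 ->
    is_derive (fun t : R => Re (-Ci * f (z + RtoC s * cis t))%C) t
      (s * Re (f' (z + RtoC s * cis t) * cis t)%C)).
  { intros s t Hs.
    replace (s * Re (f' (z + RtoC s * cis t) * cis t)%C)
      with (Re (-Ci * f' (z + RtoC s * cis t) * (RtoC s * (Ci * cis t)))%C) by (cbn; ring).
    apply (cder_curve (fun w => -Ci * f w)%C (fun t => (z + RtoC s * cis t)%C)).
    - apply is_derive_ext with (fun t => Re z + s * cos t); [intros; now rewrite circle_pt|].
      auto_derive; [easy|cbn; ring].
    - apply is_derive_ext with (fun t => Im z + s * sin t); [intros; now rewrite circle_pt|].
      auto_derive; [easy|cbn; ring].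
    - apply cder_scal. now apply H, Hin. }
  assert (Hc : forall s t, Rabs s < R0 -> continuous (fun t => Re (f (z + RtoC s * cis t)%C)) t).
  { intros s t Hs. apply ccont_continuous_circle. apply cder_ccont with (f' (z + RtoC s * cis t)%C).
    now apply H, Hin. }
  assert (Hopen : forall s, Rabs s < R0 -> locally s (fun x => Rabs x < R0)).
  { intros s Hs. assert (P : 0 < R0 - Rabs s) by lra. exists (mkposreal _ P). intros x Hx.
    change (Rabs (x - s) < R0 - Rabs s) in Hx. pose proof (Rabs_triang (x - s) s) as T.
    replace (x - s + s) with x in T by (change (x = x - s + s); lra). lra. }
  assert (C2 : forall s t, Rabs s < R0 -> continuity_2d_pt
     (fun u v => Re (f' (z + RtoC u * cis v) * cis v)%C) s t).
  { intros s t Hs.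
    assert (CX : forall g, continuity g -> continuity_2d_pt (fun u v => g v) s t).
    { intros g Hg. apply continuity_1d_2d_pt_comp; [apply Hg|apply continuity_2d_pt_id2]. }
    assert (CG : forall c, continuity_2d_pt (fun u v => Re (c * f' ((Re z + u * cos v)%R, (Im z + u * sin v)%R))%C) s t).
    { intros c. apply (continuity_2d_pt_ccont (fun w => c * f' w)%C (fun u v => Re z + u * cos v) (fun u v => Im z + u * sin v)).
      - apply continuity_2d_pt_plus; [apply continuity_2d_pt_const|].
        apply continuity_2d_pt_mult; [apply continuity_2d_pt_id1|apply CX, continuity_cos].
      - apply continuity_2d_pt_plus; [apply continuity_2d_pt_const|].
        apply continuity_2d_pt_mult; [apply continuity_2d_pt_id1|apply CX, continuity_sin].
      - replace (Re z + s * cos t, Im z + s * sin t) with (z + s * cis t)%C by apply circle_pt.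
        apply clim_mult; [apply clim_const|]. now apply H, Hin. }
    apply continuity_2d_pt_ext with
      (fun u v => Re (1 * f' ((Re z + u * cos v)%R, (Im z + u * sin v)%R))%C * cos v
                + Re (Ci * f' ((Re z + u * cos v)%R, (Im z + u * sin v)%R))%C * sin v).
    { intros u v. replace (z + u * cis v)%C with (Re z + u * cos v, Im z + u * sin v) by (symmetry; apply circle_pt).
      cbn. ring. }
    apply continuity_2d_pt_plus; apply continuity_2d_pt_mult; auto using CX, continuity_cos, continuity_sin. }
  assert (Drv : forall s, Rabs s < R0 ->
    is_derive (fun s : R => RInt (fun t => Re (f (z + RtoC s * cis t)%C)) 0 (2 * PI)) s
      (RInt (fun t => Re (f' (z + RtoC s * cis t) * cis t)%C) 0 (2 * PI))).
  { intros s Hs.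
    rewrite (RInt_ext (fun t => Re (f' (z + RtoC s * cis t) * cis t)%C)
      (fun t => Derive (fun u : R => Re (f (z + RtoC u * cis t)%C)) s)).
    2:{ intros t _. symmetry. apply is_derive_unique. now apply Dr. }
    apply (is_derive_RInt_param (fun s t => Re (f (z + RtoC s * cis t)%C))).
    - generalize (Hopen s Hs). apply filter_imp. intros x Hx t _. eexists. now apply Dr.
    - intros t _. apply continuity_2d_pt_ext_loc with (fun u v => Re (f' (z + RtoC u * cis v) * cis v)%C).
      + destruct (Hopen s Hs) as [d Hd]. exists d. intros u v Hu _. symmetry. apply is_derive_unique, Dr, Hd, Hu.
      + now apply C2.
    - generalize (Hopen s Hs). apply filter_imp. intros x Hx. apply (ex_RInt_continuous (V := R_CompleteNormedModule)).
      intros t _. now apply Hc. }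
  assert (Zero : forall s, 0 < s < R0 -> RInt (fun t => Re (f' (z + RtoC s * cis t) * cis t)%C) 0 (2 * PI) = 0).
  { intros s Hs. assert (Hs' : Rabs s < R0) by (rewrite Rabs_pos_eq; lra).
    assert (I : is_RInt (fun t => s * Re (f' (z + RtoC s * cis t) * cis t)%C) 0 (2 * PI)
      (minus (Re (-Ci * f (z + RtoC s * cis (2 * PI)))%C) (Re (-Ci * f (z + RtoC s * cis 0))%C))).
    { apply (is_RInt_derive (V := R_CompleteNormedModule) (fun t => Re (-Ci * f (z + RtoC s * cis t))%C)).
      - intros t _. now apply Dt.
      - intros t _. apply (continuous_scal_r (V := R_NormedModule) s).
        intros P [e He]. destruct (C2 s t Hs' e) as [d Hd]. exists d. intros x Hx. apply He.
        apply (Hd s x); [rewrite Rminus_diag, Rabs_R0; apply cond_pos|exact Hx]. }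
    replace (cis (2 * PI)) with (cis 0) in I by (unfold cis; now rewrite cos_2PI, sin_2PI, cos_0, sin_0).
    rewrite minus_eq_zero in I.
    apply (is_RInt_scal _ _ _ (/ s)) in I. apply (is_RInt_unique (V := R_CompleteNormedModule)) in I.
    rewrite <- (RInt_ext (fun t => scal (/ s) (s * Re (f' (z + RtoC s * cis t) * cis t)%C))).
    - etransitivity; [exact I|]. apply (scal_zero_r (V := R_NormedModule)).
    - intros t _. change (/ s * (s * Re (f' (z + RtoC s * cis t) * cis t)%C) = Re (f' (z + RtoC s * cis t) * cis t)%C).
      field. lra. }
  (* Vanishing of the derivative is known for [s > 0] only, since a division by [s] was made; at
     [s = 0] the mean value theorem asks for continuity alone. *)
  destruct (MVT_gen (fun s : R => RInt (fun t => Re (f (z + RtoC s * cis t)%C)) 0 (2 * PI)) 0 r (fun _ => 0)) as [c [_ E]].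
  - intros s Hs. rewrite Rmin_left, Rmax_right in Hs by lra.
    assert (D := Drv s ltac:(rewrite Rabs_pos_eq; lra)). rewrite Zero in D by lra. exact D.
  - intros s Hs. rewrite Rmin_left, Rmax_right in Hs by lra. apply continuity_pt_filterlim.
    apply (ex_derive_continuous (fun s : R => RInt (fun t => Re (f (z + RtoC s * cis t)%C)) 0 (2 * PI)) s).
    eexists. apply Drv. rewrite Rabs_pos_eq; lra.
  - rewrite Rmult_0_l in E. apply Rminus_diag_uniq in E. rewrite E.
    rewrite (RInt_ext _ (fun _ => Re (f z))).
    + rewrite RInt_const. change ((2 * PI - 0) * Re (f z) = 2 * PI * Re (f z)). ring.
    + intros t _. do 2 f_equal. ring.
Qed.

(** * Liouville's theorem for doubly periodic functions *)

(** Compactness of a segment in the form of a supremum argument. [P t N] reads as a bound by [N] at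
    [t]; keeping it abstract lets the same lemma serve for both coordinates of a box. *)
Lemma locally_bounded_segment (P : R -> R -> Prop) a b :
  (forall t N N', N <= N' -> P t N -> P t N') ->
  (forall t, a <= t <= b -> exists d N, 0 < d /\
     forall s, a <= s <= b -> Rabs (s - t) < d -> P s N) ->
  exists N, forall s, a <= s <= b -> P s N.
Proof.
  intros Hmono Hloc. destruct (Rlt_le_dec b a) as [Hba|Hab].
  { exists 0. intros; lra. }
  set (E := fun x => a <= x <= b /\ exists N, forall s, a <= s <= x -> P s N).
  assert (Ea : E a).
  { split; [lra|]. destruct (Hloc a ltac:(lra)) as [d [N [Hd H]]]. exists N. intros s Hs.
    apply H; [lra|]. replace (s - a) with 0 by lra. now rewrite Rabs_R0. }
  destruct (completeness E) as [x [Hub Hlub]].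
  { exists b. intros y [Hy _]. lra. }
  { now exists a. }
  assert (Hx : a <= x <= b).
  { split; [now apply Hub|]. apply Hlub. intros y [Hy _]. lra. }
  destruct (Hloc x Hx) as [d [N [Hd H]]].
  assert (exists y, E y /\ x - d < y) as [y [[Hy [N1 H1]] Hyx]].
  { apply NNPP. intro Hno. assert (x <= x - d); [|lra].
    apply Hlub. intros y Ey. apply Rnot_lt_le. intro. apply Hno. eauto. }
  assert (Hz : forall s, a <= s <= Rmin b (x + d / 2) -> P s (Rmax N N1)).
  { intros s Hs. pose proof (Rmin_l b (x + d / 2)). pose proof (Rmin_r b (x + d / 2)).
    destruct (Rle_lt_dec s y).
    - apply Hmono with N1; [apply Rmax_r|]. apply H1. lra.
    - apply Hmono with N; [apply Rmax_l|]. apply H; [lra|]. apply Rabs_def1; lra. }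
  assert (Ez : E (Rmin b (x + d / 2))).
  { split; [split; [apply Rmin_glb; lra|apply Rmin_l]|]. eauto. }
  pose proof (Hub _ Ez) as Hle. exists (Rmax N N1). intros s Hs. apply Hz. split; [lra|].
  revert Hle. unfold Rmin. destruct (Rle_dec b (x + d / 2)); lra.
Qed.

Definition in_box (A B : R) (u : C) : Prop := - A <= Re u <= A /\ - B <= Im u <= B.

Lemma locally_bounded_box (F : C -> R) A B :
  0 <= B ->
  (forall u, in_box A B u -> exists d N, 0 < d /\
     forall v, in_box A B v -> Cmod (v - u) < d -> F v <= N) ->
  exists N, forall u, in_box A B u -> F u <= N.
Proof.
  intros HB H.
  destruct (locally_bounded_segment (fun x N => forall y, - B <= y <= B -> F (x, y) <= N) (- A) A) as [N HN].
  - intros x N N' HNN HP y Hy. specialize (HP y Hy). lra.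
  - intros x Hx.
    (* Here [N] is at once a bound for [F] and the inverse width of the strip around [x] on which
       the bound holds; a single number that may grow keeps the predicate monotone. *)
    destruct (locally_bounded_segment
      (fun y N => 0 < N /\ forall x', - A <= x' <= A -> Rabs (x' - x) < / N -> F (x', y) <= N) (- B) B) as [N HN].
    + intros y N N' HNN [HN HP]. split; [lra|]. intros x' Hx' Hxx.
      eapply Rle_trans; [apply HP; auto|exact HNN].
      eapply Rlt_le_trans; [exact Hxx|]. now apply Rinv_le_contravar.
    + intros y Hy. destruct (H (x, y) (conj Hx Hy)) as [d [N [Hd HF]]].
      exists (d / 2), (Rmax 1 (Rmax N (2 / d))). split; [lra|]. intros s Hs Hsy.
      pose proof (Rmax_l 1 (Rmax N (2 / d))). pose proof (Rmax_r 1 (Rmax N (2 / d))).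
      pose proof (Rmax_l N (2 / d)). pose proof (Rmax_r N (2 / d)).
      split; [lra|]. intros x' Hx' Hxx. apply Rle_trans with N; [|lra].
      apply HF; [now split|]. eapply Rle_lt_trans; [apply Cmod_le_abs|]. cbn.
      assert (/ Rmax 1 (Rmax N (2 / d)) <= d / 2); [|unfold Rminus in *; lra].
      replace (d / 2) with (/ (2 / d)) by (field; lra).
      apply Rinv_le_contravar; [apply Rdiv_lt_0_compat; lra|lra].
    + exists (/ N), N. split; [apply Rinv_0_lt_compat, (HN 0); lra|].
      intros s Hs Hsx y Hy. now apply (HN y Hy).
  - exists N. intros u [Hx Hy]. rewrite (surjective_pairing u). now apply HN.
Qed.

(** If the supremum [M] were not attained, [/ (M - F u)] would be locally bounded, hence bounded on
    the box by some [L], and [M - / L] would be a smaller upper bound. *)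
Lemma max_on_box (F : C -> R) A B :
  0 <= A -> 0 <= B ->
  (forall u, in_box A B u -> forall eps, 0 < eps -> exists d, 0 < d /\
     forall v, in_box A B v -> Cmod (v - u) < d -> Rabs (F v - F u) < eps) ->
  exists m, in_box A B m /\ forall u, in_box A B u -> F u <= F m.
Proof.
  intros HA HB HF.
  destruct (locally_bounded_box F A B HB) as [N HN].
  { intros u Hu. destruct (HF u Hu 1 ltac:(lra)) as [d [Hd H]]. exists d, (F u + 1). split; [exact Hd|].
    intros v Hv Hvu. pose proof (Rabs_def2 _ _ (H v Hv Hvu)). lra. }
  destruct (completeness (fun y => exists u, in_box A B u /\ y = F u)) as [M [Hub Hlub]].
  { exists N. intros y [u [Hu ->]]. auto. }
  { exists (F 0), 0. split; [|reflexivity]. split; cbn; lra. }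
  assert (HM : forall u, in_box A B u -> F u <= M) by (intros u Hu; apply Hub; eauto).
  apply NNPP. intro Hno.
  assert (Hlt : forall u, in_box A B u -> F u < M).
  { intros u Hu. destruct (Rle_lt_or_eq_dec _ _ (HM u Hu)) as [?|E]; [assumption|].
    exfalso. apply Hno. exists u. split; [exact Hu|]. rewrite E. exact HM. }
  destruct (locally_bounded_box (fun u => / (M - F u)) A B HB) as [L HL].
  { intros u Hu. specialize (Hlt u Hu) as Hl. destruct (HF u Hu ((M - F u) / 2) ltac:(lra)) as [d [Hd H]].
    exists d, (/ ((M - F u) / 2)). split; [exact Hd|]. intros v Hv Hvu.
    pose proof (Rabs_def2 _ _ (H v Hv Hvu)). apply Rinv_le_contravar; lra. }
  assert (H0 : in_box A B 0) by (split; cbn; lra).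
  assert (PL : 0 < L).
  { eapply Rlt_le_trans; [|apply (HL _ H0)]. apply Rinv_0_lt_compat. specialize (Hlt _ H0). lra. }
  assert (M <= M - / L); [|pose proof (Rinv_0_lt_compat _ PL); lra].
  apply Hlub. intros y [u [Hu ->]]. specialize (HL u Hu). specialize (Hlt u Hu).
  assert (/ L <= M - F u); [|lra]. rewrite <- (Rinv_inv (M - F u)).
  apply Rinv_le_contravar; [apply Rinv_0_lt_compat; lra|exact HL].
Qed.

(** * Geometry of the rectangular lattice and periodicity *)

Definition in_lattice (a b : R) (u : C) : Prop := exists p, u = rect a b p.

Lemma not_multiple_dist a x :
  0 < a -> (forall m, x <> IZR m * a) -> exists d, 0 < d /\ forall m, d <= Rabs (x - IZR m * a).
Proof.
  intros Ha Hx. destruct (archimed (x / a)) as [H1 H2]. set (k := up (x / a)) in *.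
  assert (E : x / a * a = x) by (field; lra).
  assert (Hk1 : x < IZR k * a) by nra.
  assert (Hk2 : IZR (k - 1) * a < x).
  { rewrite minus_IZR. assert ((IZR k - 1) * a <= x) by nra.
    specialize (Hx (k - 1)%Z). rewrite minus_IZR in Hx. lra. }
  exists (Rmin (IZR k * a - x) (x - IZR (k - 1) * a)). split; [apply Rmin_pos; lra|].
  intros m. destruct (Z_le_gt_dec k m) as [Hm|Hm].
  - apply IZR_le in Hm. eapply Rle_trans; [apply Rmin_l|]. rewrite Rabs_minus_sym.
    eapply Rle_trans; [|apply RRle_abs]. nra.
  - assert (Hm' : (m <= k - 1)%Z) by lia. apply IZR_le in Hm'.
    eapply Rle_trans; [apply Rmin_r|]. eapply Rle_trans; [|apply RRle_abs]. nra.
Qed.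

Lemma nearest_multiple a x : 0 < a -> exists m, Rabs (x - IZR m * a) <= a / 2.
Proof.
  intros Ha. destruct (archimed (x / a - 1 / 2)) as [H1 H2]. exists (up (x / a - 1 / 2)).
  assert (E : x / a * a = x) by (field; lra). apply Rabs_le. split; nra.
Qed.

Lemma re_minus z w : Re (z - w) = Re z - Re w.
Proof. unfold Cminus. rewrite re_plus, re_opp. reflexivity. Qed.

Lemma im_minus z w : Im (z - w) = Im z - Im w.
Proof. unfold Cminus. rewrite im_plus, im_opp. reflexivity. Qed.

Lemma not_in_lattice_coord a b u :
  ~ in_lattice a b u -> (forall m, Re u <> IZR m * a) \/ (forall n, Im u <> IZR n * b).
Proof.
  intros H. destruct (classic (exists m, Re u = IZR m * a)) as [[m Em]|Hm].
  - right. intros n En. apply H. exists (m, n). apply C_ext; [rewrite re_rect|rewrite im_rect]; assumption.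
  - left. intros m E. apply Hm. eauto.
Qed.

(** One coordinate suffices: if it is no multiple of its period, its distance to these multiples
    bounds the distance to every lattice point. *)
Lemma not_in_lattice_dist a b u :
  0 < a -> 0 < b -> ~ in_lattice a b u ->
  exists d, 0 < d /\ forall p, d <= Cmod (u - rect a b p).
Proof.
  intros Ha Hb H. destruct (not_in_lattice_coord a b u H) as [Hm|Hn].
  - destruct (not_multiple_dist a _ Ha Hm) as [d [Hd Hdm]]. exists d. split; [exact Hd|].
    intros p. eapply Rle_trans; [apply (Hdm (fst p))|].
    rewrite <- re_rect with (b := b), <- re_minus. apply re_le_Cmod.
  - destruct (not_multiple_dist b _ Hb Hn) as [d [Hd Hdm]]. exists d. split; [exact Hd|].
    intros p. eapply Rle_trans; [apply (Hdm (snd p))|].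
    rewrite <- im_rect with (a := a), <- im_minus. apply im_le_Cmod.
Qed.

Lemma not_in_lattice_near a b u :
  0 < a -> 0 < b -> ~ in_lattice a b u ->
  exists d, 0 < d /\ forall v, Cmod (v - u) < d -> ~ in_lattice a b v.
Proof.
  intros Ha Hb H. destruct (not_in_lattice_dist a b u Ha Hb H) as [d [Hd Hu]]. exists d. split; [exact Hd|].
  intros v Hv [p ->]. specialize (Hu p). rewrite Cmod_minus_sym in Hu. lra.
Qed.

Lemma rect_plus a b p q : (rect a b p + rect a b q)%C = rect a b (fst p + fst q, snd p + snd q)%Z.
Proof. apply C_ext; rewrite ?re_plus, ?im_plus, ?re_rect, ?im_rect; cbn [fst snd]; rewrite plus_IZR; ring. Qed.

Lemma rect_opp a b p : (- rect a b p)%C = rect a b (- fst p, - snd p)%Z.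
Proof. apply C_ext; rewrite ?re_opp, ?im_opp, ?re_rect, ?im_rect; cbn [fst snd]; rewrite opp_IZR; ring. Qed.

Lemma in_lattice_shift a b u p : in_lattice a b (u + rect a b p)%C <-> in_lattice a b u.
Proof.
  split; intros [q E].
  - exists (fst q + - fst p, snd q + - snd p)%Z.
    pose proof (rect_plus a b q (- fst p, - snd p)%Z) as E2. cbn [fst snd] in E2.
    rewrite <- E2, <- rect_opp, <- E. ring.
  - exists (fst q + fst p, snd q + snd p)%Z. now rewrite <- rect_plus, E.
Qed.

(** Restricted to points off the lattice, as the functions concerned have junk values on it. *)
Definition periodic (a b : R) (h : C -> C) : Prop :=
  forall u, ~ in_lattice a b u -> forall p, h (u + rect a b p)%C = h u.

Lemma rect_10 a b : rect a b (1, 0)%Z = RtoC a.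
Proof. apply C_ext; rewrite ?re_rect, ?im_rect; cbn; ring. Qed.

Lemma rect_01 a b : rect a b (0, 1)%Z = (Ci * RtoC b)%C.
Proof. apply C_ext; rewrite ?re_rect, ?im_rect; cbn; ring. Qed.

Lemma rect_00 a b : rect a b (0, 0)%Z = RtoC 0.
Proof. apply C_ext; rewrite ?re_rect, ?im_rect; cbn; ring. Qed.

Lemma periodic_one a b (h : C -> C) p :
  (forall u, ~ in_lattice a b u -> h (u + rect a b p)%C = h u) ->
  forall n u, ~ in_lattice a b u -> h (u + rect a b (n * fst p, n * snd p)%Z)%C = h u.
Proof.
  intros H.
  assert (Hpos : forall n u, (0 <= n)%Z -> ~ in_lattice a b u ->
    h (u + rect a b (n * fst p, n * snd p)%Z)%C = h u).
  { intros n u Hn. revert n Hn u. apply (natlike_ind (fun n => forall u, _ -> _)).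
    - intros u Hu. rewrite !Z.mul_0_l, rect_00. f_equal. ring.
    - intros n Hn IH u Hu. rewrite <- (IH u Hu), <- (H (u + rect a b (n * fst p, n * snd p)%Z)%C).
      + f_equal. rewrite <- Cplus_assoc, rect_plus. cbn [fst snd]. do 3 f_equal; lia.
      + now rewrite in_lattice_shift. }
  intros n u Hu. destruct (Z_le_gt_dec 0 n) as [Hn|Hn]; [now apply Hpos|].
  rewrite <- (Hpos (- n)%Z (u + rect a b (n * fst p, n * snd p)%Z)%C); [|lia|now rewrite in_lattice_shift].
  f_equal. rewrite <- Cplus_assoc, rect_plus. cbn [fst snd].
  replace (n * fst p + - n * fst p)%Z with 0%Z by ring.
  replace (n * snd p + - n * snd p)%Z with 0%Z by ring. rewrite rect_00. ring.
Qed.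

Lemma periodic_intro a b (h : C -> C) :
  (forall u, ~ in_lattice a b u -> h (u + RtoC a)%C = h u) ->
  (forall u, ~ in_lattice a b u -> h (u + Ci * RtoC b)%C = h u) -> periodic a b h.
Proof.
  intros H1 H2 u Hu [m n].
  replace (rect a b (m, n)) with (rect a b (m * 1, m * 0)%Z + rect a b (n * 0, n * 1)%Z)%C
    by (rewrite rect_plus; cbn [fst snd]; f_equal; f_equal; ring).
  rewrite Cplus_assoc, (periodic_one a b h (0, 1)%Z), (periodic_one a b h (1, 0)%Z); auto.
  - intros v Hv. rewrite rect_10. auto.
  - intros v Hv. rewrite rect_01. auto.
  - now rewrite in_lattice_shift.
Qed.

Lemma in_box_lattice a b u :
  0 < a -> 0 < b -> in_box (a / 2) (b / 2) u -> in_lattice a b u -> u = RtoC 0.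
Proof.
  intros Ha Hb [H1 H2] [[m n] ->]. rewrite re_rect in H1. rewrite im_rect in H2. cbn [fst snd] in *.
  assert (m = 0%Z) as ->.
  { destruct (Z_lt_le_dec m 1); destruct (Z_lt_le_dec (-1) m); [lia| | |lia].
    - assert (IZR m <= -1) by (apply IZR_le; lia). nra.
    - assert (1 <= IZR m) by (apply IZR_le; lia). nra. }
  assert (n = 0%Z) as ->.
  { destruct (Z_lt_le_dec n 1); destruct (Z_lt_le_dec (-1) n); [lia| | |lia].
    - assert (IZR n <= -1) by (apply IZR_le; lia). nra.
    - assert (1 <= IZR n) by (apply IZR_le; lia). nra. }
  apply rect_00.
Qed.

Lemma box_nearest a x m : 0 < a -> - (a / 2) <= x <= a / 2 -> Rabs x <= Rabs (x - IZR m * a).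
Proof.
  intros Ha Hx.
  destruct (Z_lt_le_dec m 1); destruct (Z_lt_le_dec (-1) m).
  - assert (m = 0%Z) as -> by lia. right. f_equal. ring.
  - assert (IZR m <= -1) by (apply IZR_le; lia).
    eapply Rle_trans; [|apply RRle_abs]. apply Rabs_le. nra.
  - assert (1 <= IZR m) by (apply IZR_le; lia). rewrite (Rabs_minus_sym x).
    eapply Rle_trans; [|apply RRle_abs]. apply Rabs_le. nra.
  - lia.
Qed.

Lemma box_reduce a b u :
  0 < a -> 0 < b -> exists p, in_box (a / 2) (b / 2) (u + rect a b p)%C.
Proof.
  intros Ha Hb. destruct (nearest_multiple a (Re u) Ha) as [m Hm].
  destruct (nearest_multiple b (Im u) Hb) as [n Hn].
  exists (- m, - n)%Z. unfold in_box. rewrite re_plus, im_plus, re_rect, im_rect. cbn [fst snd].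
  rewrite !opp_IZR. apply Rabs_le_between in Hm, Hn. lra.
Qed.

Lemma Cmod_le_coord (z w : C) :
  Rabs (Re z) <= Rabs (Re w) -> Rabs (Im z) <= Rabs (Im w) -> Cmod z <= Cmod w.
Proof.
  intros H1 H2. apply Rsqr_le_abs_1 in H1, H2. unfold Rsqr, Re, Im in *.
  unfold Cmod. apply sqrt_le_1_alt. simpl. lra.
Qed.

(** For a point of the box centred at [0], the origin is a nearest lattice point, coordinate by
    coordinate. So the open disc around it that reaches to the origin is free of poles. *)
Lemma box_disc_off_lattice a b z v :
  0 < a -> 0 < b -> in_box (a / 2) (b / 2) z -> Cmod (v - z) < Cmod z -> ~ in_lattice a b v.
Proof.
  intros Ha Hb [H1 H2] Hv [p ->]. apply (Rlt_not_le _ _ Hv). rewrite Cmod_minus_sym.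
  apply Cmod_le_coord; rewrite ?re_minus, ?im_minus, ?re_rect, ?im_rect; now apply box_nearest.
Qed.

Lemma nonneg_integral_zero (f : R -> R) a b :
  a < b -> (forall t, continuous f t) -> (forall t, 0 <= f t) -> RInt f a b = 0 ->
  forall t, a < t < b -> f t = 0.
Proof.
  intros Hab Hc Hf HI t Ht. apply NNPP. intro Hne.
  assert (Hp : 0 < f t) by (specialize (Hf t); lra).
  assert (HL : locally (f t) (fun y => f t / 2 < y)).
  { apply (open_gt (f t / 2)). lra. }
  destruct (Hc t _ HL) as [d Hd].
  set (e := Rmin (d / 2) (Rmin ((t - a) / 2) ((b - t) / 2))).
  assert (Hd0 := cond_pos d).
  assert (He : 0 < e) by (repeat apply Rmin_pos; lra).
  assert (E1 : e <= d / 2) by apply Rmin_l.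
  assert (E2 : e <= (t - a) / 2) by (eapply Rle_trans; [apply Rmin_r|apply Rmin_l]).
  assert (E3 : e <= (b - t) / 2) by (eapply Rle_trans; [apply Rmin_r|apply Rmin_r]).
  assert (Hex : forall x y, ex_RInt f x y).
  { intros x y. apply (ex_RInt_continuous (V := R_CompleteNormedModule)). auto. }
  assert (Hge : forall x y, x <= y -> 0 <= RInt f x y).
  { intros x y Hxy. apply RInt_ge_0; auto. }
  assert (Hmid : (t + e - (t - e)) * (f t / 2) <= RInt f (t - e) (t + e)).
  { replace ((t + e - (t - e)) * (f t / 2)) with (RInt (fun _ => f t / 2) (t - e) (t + e))
      by (rewrite RInt_const; reflexivity).
    apply RInt_le; [lra|apply ex_RInt_const|auto|]. intros x Hx. left. apply Hd.
    change (Rabs (x - t) < d). apply Rabs_def1; lra. }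
  rewrite <- (RInt_Chasles f a (t - e) b), <- (RInt_Chasles f (t - e) (t + e) b) in HI by auto.
  change (RInt f a (t - e) + (RInt f (t - e) (t + e) + RInt f (t + e) b) = 0) in HI.
  pose proof (Hge a (t - e) ltac:(lra)). pose proof (Hge (t + e) b ltac:(lra)). nra.
Qed.

(* At a maximum [z] of [Re f] the mean value property makes [Re f] constant on
   circles around [z]. *)
Lemma max_circle f f' z R0 r t :
  (forall v, Cmod (v - z) < R0 -> cder f v (f' v) /\ ccont f' v) ->
  (forall v, Cmod (v - z) < R0 -> Re (f v) <= Re (f z)) ->
  0 < r < R0 -> 0 < t < 2 * PI -> Re (f (z + RtoC r * cis t)%C) = Re (f z).
Proof.
  intros H Hmax Hr Ht.
  assert (Hin : forall t, Cmod (z + r * cis t - z) < R0).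
  { intros s. replace (z + r * cis s - z)%C with (r * cis s)%C by ring.
    rewrite Cmod_mult, Cmod_R, Cmod_cis, Rabs_pos_eq; lra. }
  assert (Hc : forall t, continuous (fun t => Re (f (z + RtoC r * cis t)%C)) t).
  { intros s. apply ccont_continuous_circle. apply cder_ccont with (f' (z + r * cis s)%C). now apply H. }
  assert (Hex : ex_RInt (fun t => Re (f (z + RtoC r * cis t)%C)) 0 (2 * PI)).
  { apply (ex_RInt_continuous (V := R_CompleteNormedModule)). auto. }
  enough (Re (f z) - Re (f (z + RtoC r * cis t)%C) = 0) by lra.
  apply (nonneg_integral_zero (fun t => Re (f z) - Re (f (z + RtoC r * cis t)%C)) 0 (2 * PI)).
  - lra.
  - intros s. apply (continuous_minus (V := R_NormedModule)); [apply continuous_const|apply Hc].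
  - intros s. specialize (Hmax _ (Hin s)). lra.
  - pose proof (mean_value_circle f f' z R0 r H Hr) as HM.
    assert (E : RInt (fun t => minus (Re (f z)) (Re (f (z + RtoC r * cis t)%C))) 0 (2 * PI)
      = minus (RInt (fun _ => Re (f z)) 0 (2 * PI)) (RInt (fun t => Re (f (z + RtoC r * cis t)%C)) 0 (2 * PI))).
    { apply (RInt_minus (V := R_CompleteNormedModule)); [apply ex_RInt_const|exact Hex]. }
    etransitivity; [exact E|]. rewrite RInt_const.
    etransitivity; [apply (f_equal2 minus eq_refl HM)|].
    change ((2 * PI - 0) * Re (f z) - 2 * PI * Re (f z) = 0). ring.
  - exact Ht.
Qed.

Lemma liouville_re a b h h' c :
  0 < a -> 0 < b -> periodic a b h ->
  (forall u, ~ in_lattice a b u -> cder h u (h' u) /\ ccont h' u) ->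
  clim h 0 c -> forall u, ~ in_lattice a b u -> Re (h u) <= Re c.
Proof.
  intros Ha Hb Hper Hd Hc.
  (* The real part extended by its limit at the origin: it is continuous on the whole closed box, so
     it has a maximum there. *)
  set (F := fun u => if Ceq_dec u 0 then Re c else Re (h u)).
  assert (F0 : F 0 = Re c) by (unfold F; destruct (Ceq_dec 0 0); [reflexivity|easy]).
  assert (Fn : forall u, u <> RtoC 0 -> F u = Re (h u)).
  { intros u Hu. unfold F. destruct (Ceq_dec u 0); [easy|reflexivity]. }
  destruct (max_on_box F (a / 2) (b / 2)) as [z [Hz Hmax]]; [lra|lra| |].
  { intros u Hu e He. destruct (Ceq_dec u 0) as [->|Hn].
    - destruct (Hc e He) as [d [Hd0 Hcd]]. exists d. split; [exact Hd0|]. intros v _ Hv. rewrite F0.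
      destruct (Ceq_dec v 0) as [->|Hvn].
      + rewrite F0, Rminus_diag, Rabs_R0. exact He.
      + rewrite (Fn v Hvn), <- re_minus. eapply Rle_lt_trans; [apply re_le_Cmod|]. auto.
    - assert (Hu' : ~ in_lattice a b u) by (intros Hl; apply Hn; exact (in_box_lattice a b u Ha Hb Hu Hl)).
      destruct (ccont_ball _ _ (cder_ccont _ _ _ (proj1 (Hd u Hu'))) e He) as [d [Hd0 H]].
      exists (Rmin d (Cmod u)). split; [apply Rmin_pos; [exact Hd0|now apply Cmod_gt_0]|].
      intros v _ Hv. rewrite (Fn u Hn), Fn, <- re_minus.
      + eapply Rle_lt_trans; [apply re_le_Cmod|]. apply H.
        eapply Rlt_le_trans; [apply Hv|apply Rmin_l].
      + intros ->. pose proof (Rlt_le_trans _ _ _ Hv (Rmin_r _ _)) as Hbad.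
        replace (0 - u)%C with (- u)%C in Hbad by ring. rewrite Cmod_opp in Hbad. lra. }
  assert (Hall : forall u, ~ in_lattice a b u -> Re (h u) <= F z).
  { intros u Hu. destruct (box_reduce a b u Ha Hb) as [p Hp]. rewrite <- (Hper u Hu p).
    rewrite <- Fn; [now apply Hmax|]. intro E. apply Hu. apply (in_lattice_shift a b u p).
    exists (0, 0)%Z. now rewrite rect_00. }
  intros u Hu. apply Rle_trans with (F z); [now apply Hall|].
  destruct (Ceq_dec z 0) as [->|Hz0]; [rewrite F0; lra|].
  assert (Pz : 0 < Cmod z) by now apply Cmod_gt_0.
  rewrite (Fn z Hz0) in *. apply le_epsilon. intros e He.
  destruct (Hc e He) as [d [Hd0 Hcd]].
  (* the disc of radius [Cmod z] around [z] meets the lattice only on its boundary, at [0] *)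
  set (r := Rmin (d / 2) (Cmod z / 2)).
  assert (Hr : 0 < r) by (apply Rmin_pos; lra).
  assert (R1 : r <= d / 2) by apply Rmin_l. assert (R2 : r <= Cmod z / 2) by apply Rmin_r.
  (* A rotation that puts the origin at angle [PI] as seen from [z], inside the open interval
     [(0, 2 * PI)] to which [max_circle] applies. The circle of radius [Cmod z - r] then passes
     through [kap * r], where [h] is within [e] of [c]. *)
  set (kap := (z / RtoC (Cmod z))%C).
  assert (Hcz : RtoC (Cmod z) <> 0) by (intro E; apply RtoC_inj in E; lra).
  assert (Hkap : Cmod kap = 1).
  { unfold kap. rewrite Cmod_div, Cmod_R, Rabs_pos_eq by (auto; lra). field. lra. }
  assert (Hkz : z = (kap * Cmod z)%C) by (unfold kap; field; exact Hcz).
  assert (Hdisc : forall v, Cmod (v - 0) < Cmod z -> ~ in_lattice a b (kap * v + z)%C).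
  { intros v Hv. apply box_disc_off_lattice with z; auto.
    replace (kap * v + z - z)%C with (kap * (v - 0))%C by ring. rewrite Cmod_mult, Hkap. lra. }
  pose proof (max_circle (fun v => h (kap * v + z)%C) (fun v => kap * h' (kap * v + z))%C 0 (Cmod z)
    (Cmod z - r) PI) as HM.
  cbv beta in HM. replace (kap * 0 + z)%C with z in HM by ring.
  rewrite <- HM.
  - replace (0 + (Cmod z - r)%R * cis PI)%C with (- (Cmod z - r)%R)%C
      by (unfold cis; rewrite cos_PI, sin_PI; apply C_ext; cbn; ring).
    set (w := (kap * - (Cmod z - r)%R + z)%C).
    assert (Ew : w = (kap * r)%C) by (unfold w; rewrite Hkz at 2; rewrite RtoC_minus; ring).
    assert (Cw : Cmod w = r) by (rewrite Ew, Cmod_mult, Hkap, Cmod_R, Rabs_pos_eq; lra).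
    assert (Hw : Cmod (h w - c) < e).
    { apply Hcd.
      - intro E. rewrite E, Cmod_0 in Cw. lra.
      - replace (w - 0)%C with w by ring. lra. }
    pose proof (re_le_Cmod (h w - c)) as Hre. rewrite re_minus in Hre.
    pose proof (RRle_abs (Re (h w) - Re c)). lra.
  - intros v Hv. specialize (Hdisc v Hv). destruct (Hd _ Hdisc) as [D1 D2]. split.
    + now apply cder_affine.
    + apply clim_mult; [apply clim_const|]. apply clim_affine; [|exact D2].
      intro E. rewrite E, Cmod_0 in Hkap. lra.
  - intros v Hv. apply Hall. now apply Hdisc.
  - lra.
  - pose proof PI_RGT_0. lra.
Qed.

(** The one-sided bound for the real part is applied to [h] multiplied by [1], [-1], [Ci] and
    [- Ci], which bounds both coordinates from both sides. *)
Lemma liouville a b h h' c :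
  0 < a -> 0 < b -> periodic a b h ->
  (forall u, ~ in_lattice a b u -> cder h u (h' u) /\ ccont h' u) ->
  clim h 0 c -> forall u, ~ in_lattice a b u -> h u = c.
Proof.
  intros Ha Hb Hper Hd Hc u Hu.
  assert (Hk : forall k, Re (k * h u)%C <= Re (k * c)%C).
  { intros k. apply (liouville_re a b (fun v => k * h v)%C (fun v => k * h' v)%C (k * c)%C); auto.
    - intros v Hv p. now rewrite Hper.
    - intros v Hv. destruct (Hd v Hv). split; [now apply cder_scal|].
      apply clim_mult; [apply clim_const|assumption].
    - apply clim_mult; [apply clim_const|exact Hc]. }
  pose proof (Hk (RtoC 1)) as H1. pose proof (Hk (RtoC (-1))) as H2.
  pose proof (Hk Ci) as H3. pose proof (Hk (- Ci)%C) as H4.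
  apply C_ext; cbn in *; unfold Re, Im in *; lra.
Qed.

Lemma strip_constant a (h : C -> C) :
  (forall u, 0 < Re u < a -> cder h u 0) ->
  forall u v, 0 < Re u < a -> 0 < Re v < a -> h u = h v.
Proof.
  intros H u v Hu Hv. apply Ceq_minus, Cmod_eq_0, Rle_antisym; [|apply Cmod_ge_0].
  rewrite <- (Rmult_0_l (Cmod (u - v))). apply mean_value_inequality with (fun _ => RtoC 0).
  - intros t Ht. apply H. rewrite re_plus, re_scal_l, re_minus. destruct (Rle_dec (Re u) (Re v)); nra.
  - intros t Ht. rewrite Cmod_0. lra.
Qed.

(** * The Weierstrass function *)

Lemma cder_inv_pow n u : u <> RtoC 0 -> cder (fun v => / v ^ n)%C u (- INR n * / u ^ S n)%C.
Proof.
  intros Hu. destruct (inv_pow_taylor n) as [M [HM H]].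
  assert (Hp : 0 < Cmod u) by now apply Cmod_gt_0.
  apply cder_quad with (d := Cmod u / 2) (M := M * / Cmod u ^ S (S n)); [lra|].
  intros v Hv. specialize (H u (v - u)%C Hu ltac:(lra)).
  replace (u + (v - u))%C with v in H by ring. exact H.
Qed.

Definition wpr (a b : R) : C -> C := wp (RtoC a) (Ci * RtoC b)%C.

Lemma wpr_eq a b u : wpr a b u = (/ u ^ 2 + wp0 a b u)%C.
Proof. transitivity (1 / u ^ 2 + wp0 a b u)%C; [reflexivity|]. unfold Cdiv. now rewrite Cmult_1_l. Qed.

(** Derivatives obtained term by term, with the polar part kept apart. The third one is present
    because the Liouville argument for [wp2 - 6 * wpr ^ 2] asks for a continuous derivative. *)
Definition wp1 (a b : R) (u : C) : C := (- 2 * / u ^ 3 - 2 * zsum a b 0 u)%C.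
Definition wp2 (a b : R) (u : C) : C := (6 * / u ^ 4 + 6 * zsum a b 1 u)%C.
Definition wp3 (a b : R) (u : C) : C := (- 24 * / u ^ 5 - 24 * zsum a b 2 u)%C.

Lemma in_lattice_0 a b : in_lattice a b 0.
Proof. exists (0, 0)%Z. now rewrite rect_00. Qed.

Lemma off_lattice_nz a b u : ~ in_lattice a b u -> u <> RtoC 0.
Proof. intros H ->. apply H, in_lattice_0. Qed.

Lemma off_lattice_away a b u :
  0 < a -> 0 < b -> ~ in_lattice a b u -> exists d, away a b u d.
Proof.
  intros Ha Hb H. destruct (not_in_lattice_dist a b u Ha Hb H) as [d [Hd Hu]].
  exists d. split; auto.
Qed.

Section Rectangular.
Context (a b : R) (Ha : 0 < a) (Hb : 0 < b).

Lemma cder_wpr u : ~ in_lattice a b u -> cder (wpr a b) u (wp1 a b u).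
Proof.
  intros Hu. destruct (off_lattice_away a b u Ha Hb Hu) as [d Hd].
  pose proof (off_lattice_nz _ _ _ Hu) as Hn.
  apply cder_ext with (fun v => / v ^ 2 + wp0 a b v)%C; [intros; symmetry; apply wpr_eq|].
  replace (wp1 a b u) with (- INR 2 * / u ^ 3 + - 2 * zsum a b 0 u)%C
    by (unfold wp1; replace (INR 2) with 2 by (simpl; ring); ring).
  apply cder_plus; [now apply cder_inv_pow|]. now apply cder_wp0 with d.
Qed.

Lemma cder_wp1 u : ~ in_lattice a b u -> cder (wp1 a b) u (wp2 a b u).
Proof.
  intros Hu. destruct (off_lattice_away a b u Ha Hb Hu) as [d Hd].
  pose proof (off_lattice_nz _ _ _ Hu) as Hn.
  replace (wp2 a b u) with (- 2 * (- INR 3 * / u ^ 4) - 2 * (- INR (3 + 0) * zsum a b 1 u))%C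
    by (unfold wp2; replace (INR (3 + 0)) with 3 by (simpl; ring);
        replace (INR 3) with 3 by (simpl; ring); ring).
  apply cder_minus; apply cder_scal; [now apply cder_inv_pow|]. now apply cder_zsum with d.
Qed.

Lemma cder_wp2 u : ~ in_lattice a b u -> cder (wp2 a b) u (wp3 a b u).
Proof.
  intros Hu. destruct (off_lattice_away a b u Ha Hb Hu) as [d Hd].
  pose proof (off_lattice_nz _ _ _ Hu) as Hn.
  replace (wp3 a b u) with (6 * (- INR 4 * / u ^ 5) + 6 * (- INR (3 + 1) * zsum a b 2 u))%C
    by (unfold wp3; replace (INR (3 + 1)) with 4 by (simpl; ring);
        replace (INR 4) with 4 by (simpl; ring); ring).
  apply cder_plus; apply cder_scal; [now apply cder_inv_pow|]. now apply cder_zsum with d.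
Qed.

Lemma ccont_wp3 u : ~ in_lattice a b u -> ccont (wp3 a b) u.
Proof.
  intros Hu. destruct (off_lattice_away a b u Ha Hb Hu) as [d Hd].
  pose proof (off_lattice_nz _ _ _ Hu) as Hn.
  apply clim_minus; apply clim_mult; try apply clim_const.
  - exact (cder_ccont _ _ _ (cder_inv_pow 5 u Hn)).
  - exact (cder_ccont _ _ _ (cder_zsum a b u d 2 Ha Hb Hd)).
Qed.

(** The polar term becomes the term of index [(0, 0)], so that symmetries of the lattice act on the
    whole series by reindexing. *)
Definition wterm (u : C) (p : Z * Z) : C :=
  (/ (u - rect a b p) ^ 2 - offO (RtoC 0) (fun p => / rect a b p ^ 2) p)%C.

Lemma is_wpr u : ~ in_lattice a b u -> is_lattice_sum (wterm u) (wpr a b u).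
Proof.
  intros Hu. destruct (off_lattice_away a b u Ha Hb Hu) as [d Hd].
  rewrite wpr_eq.
  eapply is_lattice_sum_ext; [|apply is_lattice_sum_plus;
    [apply (is_lattice_sum_single (0, 0)%Z (/ u ^ 2)%C)|apply (is_wp0 a b u d Ha Hb Hd)]].
  intros p. unfold wterm, offO. cbv beta. destruct (ZZ_eq_dec p (0%Z, 0%Z)) as [->|_].
  - rewrite rect_00. replace (u - 0)%C with u by ring. ring.
  - unfold Cdiv. ring.
Qed.

Lemma wterm_sym (u v k : C) (sigma : Z * Z -> Z * Z) :
  (forall p, sigma p = (0, 0)%Z <-> p = (0, 0)%Z) -> k <> RtoC 0 ->
  (forall p, k * rect a b p = rect a b (sigma p))%C -> v = (k * u)%C ->
  ~ in_lattice a b u -> ~ in_lattice a b v ->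
  forall p, wterm v (sigma p) = (/ k ^ 2 * wterm u p)%C.
Proof.
  intros H0 Hk Hsg -> Hu Hv p. unfold wterm, offO.
  assert (N1 : (u - rect a b p)%C <> 0).
  { intro E. apply Hu. exists p. now apply Ceq_minus. }
  rewrite <- Hsg. replace (k * u - k * rect a b p)%C with (k * (u - rect a b p))%C by ring.
  rewrite !Cpow_mult_l.
  destruct (ZZ_eq_dec (sigma p) (0%Z, 0%Z)) as [E|E]; destruct (ZZ_eq_dec p (0%Z, 0%Z)) as [E'|E'].
  - field. now split.
  - exfalso. apply E', H0, E.
  - exfalso. apply E, H0, E'.
  - pose proof (rect_nz a b p Ha Hb E'). field. repeat split; assumption.
Qed.

Lemma off_lattice_opp u : ~ in_lattice a b u -> ~ in_lattice a b (- u)%C.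
Proof.
  intros H [p E]. apply H. exists (- fst p, - snd p)%Z. rewrite <- rect_opp, <- E. ring.
Qed.

Lemma rect_conj p : Cconj (rect a b p) = rect a b (fst p, - snd p)%Z.
Proof.
  apply C_ext; rewrite ?re_conj, ?im_conj, ?re_rect, ?im_rect; cbn [fst snd]; [reflexivity|].
  rewrite opp_IZR; ring.
Qed.

Lemma off_lattice_conj u : ~ in_lattice a b u -> ~ in_lattice a b (Cconj u).
Proof.
  intros H [p E]. apply H. exists (fst p, - snd p)%Z. now rewrite <- rect_conj, <- E, Cconj_conj.
Qed.

Lemma wpr_even u : ~ in_lattice a b u -> wpr a b (- u)%C = wpr a b u.
Proof.
  intros Hu. pose proof (off_lattice_opp _ Hu) as Hv.
  set (sigma := fun p : Z * Z => (- fst p, - snd p)%Z).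
  assert (Hinv : forall p, sigma (sigma p) = p) by (intros [m n]; unfold sigma; cbn; f_equal; lia).
  pose proof (is_lattice_sum_reindex sigma sigma _ _ Hinv Hinv (is_wpr _ Hv)) as H1.
  rewrite <- (is_lattice_sum_unique _ _ H1), <- (is_lattice_sum_unique _ _ (is_wpr _ Hu)).
  symmetry. apply is_lattice_sum_unique. eapply is_lattice_sum_ext; [|rewrite (is_lattice_sum_unique _ _ H1); exact H1].
  intros p. cbv beta. rewrite (wterm_sym u (- u)%C (-(1))%C sigma); auto.
  - replace ((-(1)) ^ 2)%C with (RtoC 1) by (cbn [Cpow]; ring). field.
  - intros [m n]. unfold sigma. cbn [fst snd]. split; intros E; inversion E; f_equal; lia.
  - intro E. apply C1_nz. rewrite <- (Copp_0). rewrite <- E. ring.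
  - intros q. unfold sigma. rewrite <- rect_opp. ring.
  - ring.
Qed.

(** A rectangular lattice is stable under conjugation, which acts on the indices by
    [(m, n) => (m, - n)]. *)
Lemma wpr_conj u : ~ in_lattice a b u -> wpr a b (Cconj u) = Cconj (wpr a b u).
Proof.
  intros Hu. pose proof (off_lattice_conj _ Hu) as Hv.
  set (sigma := fun p : Z * Z => (fst p, - snd p)%Z).
  assert (Hinv : forall p, sigma (sigma p) = p) by (intros [m n]; unfold sigma; cbn; f_equal; lia).
  pose proof (is_lattice_sum_reindex sigma sigma _ _ Hinv Hinv (is_wpr _ Hv)) as H1.
  pose proof (is_lattice_sum_conj _ _ (is_wpr _ Hu)) as H2.
  rewrite <- (is_lattice_sum_unique _ _ H1). apply is_lattice_sum_unique.
  eapply is_lattice_sum_ext; [|exact H2]. intros p. cbv beta. unfold wterm, offO.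
  assert (N1 : (u - rect a b p)%C <> 0).
  { intro E. apply Hu. exists p. now apply Ceq_minus. }
  rewrite Cminus_conj, Cinv_conj, Cpow_conj, Cminus_conj, rect_conj by now apply Cpow_nz.
  fold (sigma p). f_equal.
  destruct (ZZ_eq_dec (sigma p) (0%Z, 0%Z)) as [E|E]; destruct (ZZ_eq_dec p (0%Z, 0%Z)) as [E'|E'].
  - apply C_ext; cbn; ring.
  - exfalso. apply E'. rewrite <- (Hinv p), E. reflexivity.
  - subst p. now exfalso.
  - pose proof (rect_nz a b p Ha Hb E'). rewrite Cinv_conj, Cpow_conj, rect_conj by now apply Cpow_nz.
    reflexivity.
Qed.

(* The increment [wpr (u + w) - wpr u] is a lattice sum independent of [u]
   whose terms are antisymmetric under [p => - p - q]. *)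
Lemma wpr_periodic : periodic a b (wpr a b).
Proof.
  intros u Hu q.
  assert (Hv : ~ in_lattice a b (u + rect a b q)%C) by now rewrite in_lattice_shift.
  set (sigma := fun p : Z * Z => (fst p + fst q, snd p + snd q)%Z).
  set (tau := fun p : Z * Z => (fst p - fst q, snd p - snd q)%Z).
  assert (I1 : forall p, sigma (tau p) = p) by (intros [m n]; unfold sigma, tau; cbn; f_equal; lia).
  assert (I2 : forall p, tau (sigma p) = p) by (intros [m n]; unfold sigma, tau; cbn; f_equal; lia).
  set (r := offO (RtoC 0) (fun p => / rect a b p ^ 2)%C).
  assert (Hr : forall p, r (- fst p, - snd p)%Z = r p).
  { intros p. unfold r, offO.
    destruct (ZZ_eq_dec (- fst p, - snd p)%Z (0%Z, 0%Z)) as [E|E]; destruct (ZZ_eq_dec p (0%Z, 0%Z)) as [E'|E'].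
    - reflexivity.
    - exfalso. apply E'. destruct p; cbn in *; inversion E; f_equal; lia.
    - subst p. now exfalso.
    - rewrite <- rect_opp. f_equal. cbn [Cpow]. ring. }
  pose proof (is_lattice_sum_minus _ _ _ _
    (is_lattice_sum_reindex sigma tau _ _ I1 I2 (is_wpr _ Hv)) (is_wpr _ Hu)) as HD.
  set (c := (wpr a b (u + rect a b q) - wpr a b u)%C) in *.
  assert (HD' : is_lattice_sum (fun p => r p - r (sigma p))%C c).
  { eapply is_lattice_sum_ext; [|exact HD]. intros p. cbv beta. unfold wterm. fold r.
    unfold sigma at 1. rewrite <- rect_plus.
    replace (u + rect a b q - (rect a b p + rect a b q))%C with (u - rect a b p)%C by ring. ring. }
  set (rho := fun p : Z * Z => (- (fst p + fst q), - (snd p + snd q))%Z).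
  assert (I3 : forall p, rho (rho p) = p) by (intros [m n]; unfold rho; cbn; f_equal; lia).
  pose proof (is_lattice_sum_reindex rho rho _ _ I3 I3 HD') as HR.
  pose proof (is_lattice_sum_plus _ _ _ _ HD' HR) as HS.
  assert (E0 : (c + c)%C = 0).
  { rewrite <- (is_lattice_sum_unique _ _ HS). apply is_lattice_sum_unique.
    pose proof (is_lattice_sum_scal 0 _ _ HS) as H0S.
    replace (0 * (c + c))%C with (RtoC 0) in H0S by ring.
    eapply is_lattice_sum_ext; [|exact H0S]. intros p. cbv beta.
    assert (R1 : r (rho p) = r (sigma p)) by apply (Hr (sigma p)).
    assert (R2 : r (sigma (rho p)) = r p).
    { rewrite <- (Hr p). f_equal. unfold sigma, rho. cbn. f_equal; lia. }
    rewrite R1, R2. ring. }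
  apply Ceq_minus. fold c. 
  replace c with (/ 2 * (c + c))%C by (field; intro E; apply RtoC_inj in E; lra). rewrite E0. ring.
Qed.
End Rectangular.

Lemma rect_rot a b p : (Ci * rect b a p)%C = rect a b (- snd p, fst p)%Z.
Proof.
  apply C_ext; rewrite ?re_mult, ?im_mult, ?re_rect, ?im_rect; cbn [fst snd Re Im Ci];
    rewrite ?opp_IZR; ring.
Qed.

Lemma in_lattice_rot a b u : in_lattice a b (Ci * u)%C <-> in_lattice b a u.
Proof.
  assert (E : (Ci * Ci)%C = (- (1))%C) by (apply C_ext; cbn; ring).
  split; intros [p Ep].
  - exists (snd p, - fst p)%Z. 
    assert (H : (Ci * u)%C = (Ci * rect b a (snd p, - fst p)%Z)%C).
    { rewrite rect_rot. cbn [fst snd]. rewrite Z.opp_involutive. now destruct p. }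
    replace u with (- (Ci * (Ci * u)))%C by (rewrite Cmult_assoc, E; ring).
    rewrite H, Cmult_assoc, E. ring.
  - exists (- snd p, fst p)%Z. now rewrite <- rect_rot, Ep.
Qed.

(** Multiplication by [Ci] carries the lattice with periods [b], [a] to the one with periods [a],
    [b], and the series is homogeneous of degree [-2]. Through this, statements on the real axis and
    about [e1r] turn into statements on the imaginary axis and about [e2r]. *)
Lemma wpr_rot a b u :
  0 < a -> 0 < b -> ~ in_lattice b a u -> wpr a b (Ci * u)%C = (- wpr b a u)%C.
Proof.
  intros Ha Hb Hu. assert (Hv : ~ in_lattice a b (Ci * u)%C) by now rewrite in_lattice_rot.
  assert (E : forall z, ((Ci * z) ^ 2)%C = (- z ^ 2)%C).
  { intros z. cbn [Cpow]. replace (Ci * z * (Ci * z * 1))%C with (Ci * Ci * (z * z))%C by ring.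
    replace (Ci * Ci)%C with (- (1))%C by (apply C_ext; cbn; ring). ring. }
  set (sigma := fun p : Z * Z => (- snd p, fst p)%Z). set (tau := fun p : Z * Z => (snd p, - fst p)%Z).
  assert (I1 : forall p, sigma (tau p) = p) by (intros [m n]; unfold sigma, tau; cbn; f_equal; lia).
  assert (I2 : forall p, tau (sigma p) = p) by (intros [m n]; unfold sigma, tau; cbn; f_equal; lia).
  pose proof (is_lattice_sum_reindex sigma tau _ _ I1 I2 (is_wpr a b Ha Hb _ Hv)) as H1.
  pose proof (is_lattice_sum_scal (-(1)) _ _ (is_wpr b a Hb Ha _ Hu)) as H2.
  rewrite <- (is_lattice_sum_unique _ _ H1). replace (- wpr b a u)%C with (-(1) * wpr b a u)%C by ring.
  apply is_lattice_sum_unique. eapply is_lattice_sum_ext; [|exact H2].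
  intros p. cbv beta. unfold wterm, offO.
  assert (N1 : (u - rect b a p)%C <> 0).
  { intro E1. apply Hu. exists p. now apply Ceq_minus. }
  unfold sigma at 1. rewrite <- rect_rot.
  replace (Ci * u - Ci * rect b a p)%C with (Ci * (u - rect b a p))%C by ring. rewrite !E.
  destruct (ZZ_eq_dec (sigma p) (0%Z, 0%Z)) as [E1|E1]; destruct (ZZ_eq_dec p (0%Z, 0%Z)) as [E2|E2].
  - field. assumption.
  - exfalso. apply E2. rewrite <- (I2 p), E1. reflexivity.
  - subst p. now exfalso.
  - pose proof (rect_nz b a p Hb Ha E2). unfold sigma. rewrite <- rect_rot, E. field. split; assumption.
Qed.

Lemma periodic_cder a b h h' :
  0 < a -> 0 < b -> periodic a b h ->
  (forall u, ~ in_lattice a b u -> cder h u (h' u)) -> periodic a b h'.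
Proof.
  intros Ha Hb Hp Hd u Hu p. destruct (not_in_lattice_near a b u Ha Hb Hu) as [d [Hd0 Hn]].
  apply cder_unique with h u; [|now apply Hd].
  apply cder_ext_loc with (fun v => h (v + rect a b p)%C) d; [exact Hd0| |].
  - intros v Hv. apply Hp. auto.
  - apply cder_shift. apply Hd. now rewrite in_lattice_shift.
Qed.

Lemma off_lattice_re a b x y : (forall m, x <> IZR m * a) -> ~ in_lattice a b (x, y).
Proof.
  intros H [p E]. apply (H (fst p)). rewrite <- (re_rect a b), <- E. reflexivity.
Qed.

Lemma strictly_between_multiples a x k :
  0 < a -> IZR k * a < x < IZR (k + 1) * a -> forall m, x <> IZR m * a.
Proof.
  intros Ha H m ->. destruct (Z_le_gt_dec m k) as [Hm|Hm].
  - apply IZR_le in Hm. nra.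
  - assert (Hm' : (k + 1 <= m)%Z) by lia. apply IZR_le in Hm'. nra.
Qed.

Section Rectangular.
Context (a b : R) (Ha : 0 < a) (Hb : 0 < b).

Lemma off_lattice_strip u : 0 < Re u < a -> ~ in_lattice a b u.
Proof.
  intros H. destruct u as [x y]. cbn in H. apply off_lattice_re.
  apply strictly_between_multiples with 0%Z; [exact Ha|]. cbn. lra.
Qed.

Lemma off_lattice_half : ~ in_lattice a b (RtoC (a / 2)).
Proof. apply off_lattice_strip. cbn. lra. Qed.

Lemma wp1_periodic : periodic a b (wp1 a b).
Proof. apply periodic_cder with (wpr a b); auto using wpr_periodic, cder_wpr. Qed.

Lemma wp2_periodic : periodic a b (wp2 a b).
Proof. apply periodic_cder with (wp1 a b); auto using wp1_periodic, cder_wp1. Qed.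

Lemma wp1_odd u : ~ in_lattice a b u -> wp1 a b (- u)%C = (- wp1 a b u)%C.
Proof.
  intros Hu. pose proof (off_lattice_opp _ _ _ Hu) as Hv.
  destruct (not_in_lattice_near a b u Ha Hb Hu) as [d [Hd Hn]].
  assert (H : cder (wpr a b) u (- (1) * wp1 a b (- u))%C).
  { apply cder_ext_loc with (fun v => wpr a b (- (1) * v + 0)%C) d; [exact Hd| |].
    - intros v Hv'. replace (- (1) * v + 0)%C with (- v)%C by ring. apply wpr_even; auto.
    - apply cder_affine. replace (- (1) * u + 0)%C with (- u)%C by ring. apply cder_wpr; auto. }
  rewrite (cder_unique _ _ _ _ (cder_wpr a b Ha Hb u Hu) H). ring.
Qed.

(** Modulo the lattice [w] equals [- w], and [wp1] is odd. *)
Lemma wp1_half w p : ~ in_lattice a b w -> (w + w)%C = rect a b p -> wp1 a b w = RtoC 0.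
Proof.
  intros H Hw. pose proof (wp1_odd _ H) as E.
  pose proof (wp1_periodic _ (off_lattice_opp _ _ _ H) p) as E2.
  replace (- w + rect a b p)%C with w in E2 by (rewrite <- Hw; ring).
  rewrite E in E2. replace (wp1 a b w) with (/ 2 * (wp1 a b w + wp1 a b w))%C
    by (field; intro X; apply RtoC_inj in X; lra).
  rewrite E2 at 1. ring.
Qed.

Lemma half_double : (RtoC (a / 2) + RtoC (a / 2))%C = rect a b (1, 0)%Z.
Proof. rewrite rect_10. apply C_ext; cbn; field. Qed.

Lemma wp0_0 : wp0 a b 0 = RtoC 0.
Proof.
  pose proof (is_wp0 a b 0 _ Ha Hb (away_0 a b Ha Hb)) as H.
  rewrite <- (is_lattice_sum_unique _ _ H). apply is_lattice_sum_unique.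
  pose proof (is_lattice_sum_scal 0 _ _ H) as H0. rewrite Cmult_0_l in H0.
  eapply is_lattice_sum_ext; [|exact H0]. intros p. cbv beta. unfold offO.
  destruct (ZZ_eq_dec p (0%Z, 0%Z)) as [_|Hp]; [ring|].
  pose proof (rect_nz a b p Ha Hb Hp). replace (0 - rect a b p)%C with (- rect a b p)%C by ring.
  cbn [Cpow]. field. assumption.
Qed.

Lemma zsum0_0 : zsum a b 0 0 = RtoC 0.
Proof.
  pose proof (is_zsum a b 0 _ 0 Ha Hb (away_0 a b Ha Hb)) as H.
  set (sigma := fun p : Z * Z => (- fst p, - snd p)%Z).
  assert (Hinv : forall p, sigma (sigma p) = p) by (intros [m n]; unfold sigma; cbn; f_equal; lia).
  pose proof (is_lattice_sum_reindex sigma sigma _ _ Hinv Hinv H) as H1.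
  pose proof (is_lattice_sum_plus _ _ _ _ H H1) as H2.
  pose proof (is_lattice_sum_scal 0 _ _ H) as H0. rewrite Cmult_0_l in H0.
  assert (E : (zsum a b 0 0 + zsum a b 0 0)%C = 0).
  { rewrite <- (is_lattice_sum_unique _ _ H2). apply is_lattice_sum_unique.
    eapply is_lattice_sum_ext; [|exact H0]. intros p. cbv beta. unfold offO.
    destruct (ZZ_eq_dec p (0%Z, 0%Z)) as [->|Hp]; destruct (ZZ_eq_dec (sigma _) (0%Z, 0%Z)) as [E1|E1].
    - ring.
    - now exfalso.
    - exfalso. apply Hp. rewrite <- (Hinv p), E1. reflexivity.
    - pose proof (rect_nz a b p Ha Hb Hp) as Hr. unfold sigma. rewrite <- rect_opp.
      replace (0 - rect a b p)%C with (- rect a b p)%C by ring. 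
      replace (0 - - rect a b p)%C with (rect a b p)%C by ring.
      cbn [Nat.add Cpow]. field. assumption. }
  replace (zsum a b 0 0) with (/ 2 * (zsum a b 0 0 + zsum a b 0 0))%C by (field; intro X; apply RtoC_inj in X; lra).
  rewrite E. ring.
Qed.

Lemma ccont_wp0_0 : ccont (wp0 a b) 0.
Proof. exact (cder_ccont _ _ _ (cder_wp0 a b 0 _ Ha Hb (away_0 a b Ha Hb))). Qed.

(** The Laurent coefficient [3 G4] of [u ^ 2]: at the origin [wp0] vanishes, its derivative
    [- 2 * zsum a b 0] vanishes by oddness, and its second derivative is [6 G4]. *)
Lemma wp0_taylor : clim (fun u => wp0 a b u / u ^ 2)%C 0 (3 * zsum a b 1 0)%C.
Proof.
  pose proof (away_0 a b Ha Hb) as H0. pose proof (Rmin_pos a b Ha Hb) as Hm.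
  replace (3 * zsum a b 1 0)%C with ((- 2 * (- INR (3 + 0) * zsum a b 1 0)) / 2)%C
    by (replace (INR (3 + 0)) with 3 by (simpl; ring); field; intro X; apply RtoC_inj in X; lra).
  apply clim_ext_loc with (fun u => (wp0 a b u - wp0 a b 0) / (u - 0) ^ 2)%C 1; [lra| |].
  { intros v _ _. rewrite wp0_0. f_equal; [ring|]. do 2 f_equal. ring. }
  apply clim_taylor2 with (g' := fun u => (- 2 * zsum a b 0 u)%C) (d := Rmin a b / 2).
  - lra.
  - intros v Hv. apply cder_wp0 with (Rmin a b / 2); auto. apply away_near with (RtoC 0); [exact H0|lra].
  - rewrite zsum0_0. ring.
  - apply cder_scal. apply cder_zsum with (Rmin a b); auto.
Qed.

(** The factor [6] cancels the pole of order four in [wp2 - 6 * wpr ^ 2]. What is left tends to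
    [6 G4 - 12 * 3 G4 = - 30 G4] at the origin, and Liouville applies. *)
Lemma wp_second_order u :
  ~ in_lattice a b u -> wp2 a b u = (6 * (wpr a b u * wpr a b u) - 30 * zsum a b 1 0)%C.
Proof.
  intros Hu.
  enough (E : (wp2 a b u - 6 * (wpr a b u * wpr a b u))%C = (- 30 * zsum a b 1 0)%C).
  { replace (wp2 a b u) with (wp2 a b u - 6 * (wpr a b u * wpr a b u) + 6 * (wpr a b u * wpr a b u))%C by ring.
    rewrite E. ring. }
  revert u Hu.
  apply (liouville a b (fun u => wp2 a b u - 6 * (wpr a b u * wpr a b u))%C
    (fun u => wp3 a b u - 6 * (wp1 a b u * wpr a b u + wpr a b u * wp1 a b u))%C); auto.
  - intros u Hu p. now rewrite wp2_periodic, wpr_periodic.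
  - intros u Hu. pose proof (cder_wpr a b Ha Hb u Hu) as D0. pose proof (cder_wp1 a b Ha Hb u Hu) as D1.
    split.
    + apply cder_minus; [now apply cder_wp2|]. apply cder_scal. now apply cder_mult.
    + apply clim_minus; [now apply ccont_wp3|]. apply clim_mult; [apply clim_const|].
      apply cder_ccont in D0, D1. apply clim_plus; now apply clim_mult.
  - pose proof (away_0 a b Ha Hb) as H0.
    apply clim_ext_loc with (fun u => 6 * zsum a b 1 u - 12 * (wp0 a b u / u ^ 2)
       - 6 * (wp0 a b u * wp0 a b u))%C 1; [lra| |].
    + intros v Hv _. rewrite wpr_eq. unfold wp2. cbn [Cpow]. field. exact Hv.
    + replace (- 30 * zsum a b 1 0)%C
        with (6 * zsum a b 1 0 - 12 * (3 * zsum a b 1 0) - 6 * (0 * 0))%C by ring.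
      apply clim_minus; [apply clim_minus|]; apply clim_mult; try apply clim_const.
      * exact (cder_ccont _ _ _ (cder_zsum a b 0 _ 1 Ha Hb H0)).
      * apply wp0_taylor.
      * pose proof (clim_mult _ _ _ _ _ ccont_wp0_0 ccont_wp0_0) as L. rewrite wp0_0 in L. exact L.
Qed.

Lemma off_half_lattice u :
  ~ in_lattice (a / 2) b u -> ~ in_lattice a b u /\ ~ in_lattice a b (u + RtoC (a / 2))%C.
Proof.
  intros H. split; intros [p E]; apply H.
  - exists (2 * fst p, snd p)%Z. rewrite E. apply C_ext; rewrite ?re_rect, ?im_rect; cbn [fst snd].
    + rewrite mult_IZR. field. + ring.
  - exists (2 * fst p - 1, snd p)%Z.
    replace u with (rect a b p - RtoC (a / 2))%C by (rewrite <- E; ring).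
    apply C_ext; rewrite ?re_minus, ?im_minus, ?re_rect, ?im_rect; cbn [fst snd].
    + rewrite minus_IZR, mult_IZR. cbn. field. + cbn. ring.
Qed.

Lemma clim_sqr_wpr : clim (fun u => u ^ 2 * wpr a b u)%C 0 1.
Proof.
  apply clim_ext_loc with (fun u => 1 + u * u * wp0 a b u)%C 1; [lra| |].
  - intros v Hv _. rewrite wpr_eq. cbn [Cpow]. field. exact Hv.
  - pose proof (clim_plus _ _ _ _ _ (clim_const 1 0)
      (clim_mult _ _ _ _ _ (clim_mult _ _ _ _ _ (ccont_id 0) (ccont_id 0)) ccont_wp0_0)) as L.
    replace (1 + 0 * 0 * wp0 a b 0)%C with (RtoC 1) in L by ring. exact L.
Qed.

(** Translation by [a / 2] exchanges the two factors, so the product has period [a / 2], and modulo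
    the finer lattice [0] is its only singular point. There the double zero of the first factor, due
    to [wp1 (a / 2) = 0], meets the double pole of the second; the limit is half the second
    derivative. *)
Lemma wpr_half_translate u :
  ~ in_lattice (a / 2) b u ->
  ((wpr a b (u + RtoC (a / 2)) - wpr a b (RtoC (a / 2))) * (wpr a b u - wpr a b (RtoC (a / 2))))%C
  = (wp2 a b (RtoC (a / 2)) / 2)%C.
Proof.
  set (w := RtoC (a / 2)). set (e := wpr a b w). pose proof off_lattice_half as Hw. fold w in Hw.
  revert u. apply (liouville (a / 2) b (fun u => (wpr a b (u + w) - e) * (wpr a b u - e))%C
    (fun u => (wp1 a b (u + w) - 0) * (wpr a b u - e) + (wpr a b (u + w) - e) * (wp1 a b u - 0))%C).
  - lra.
  - exact Hb.
  - apply periodic_intro; intros u Hu; destruct (off_half_lattice u Hu) as [H1 H2]; fold w in H2; fold w.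
    + replace (u + w + w)%C with (u + rect a b (1, 0)%Z)%C
        by (rewrite rect_10; unfold w; apply C_ext; cbn; field).
      rewrite wpr_periodic; auto. ring.
    + rewrite <- (rect_01 a b).
      replace (u + rect a b (0, 1)%Z + w)%C with (u + w + rect a b (0, 1)%Z)%C by ring.
      rewrite !wpr_periodic; auto.
  - intros u Hu. destruct (off_half_lattice u Hu) as [H1 H2]. fold w in H2.
    assert (D1 := cder_shift _ w u _ (cder_wpr a b Ha Hb _ H2)).
    assert (D2 := cder_wpr a b Ha Hb _ H1).
    assert (D3 := cder_shift _ w u _ (cder_wp1 a b Ha Hb _ H2)).
    assert (D4 := cder_wp1 a b Ha Hb _ H1).
    split.
    + apply (cder_mult (fun u => wpr a b (u + w) - e)%C (fun u => wpr a b u - e)%C);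
        (apply cder_minus; [assumption|apply cder_const]).
    + apply cder_ccont in D1, D2, D3, D4.
      apply clim_plus; apply clim_mult; (apply clim_minus; [assumption|apply clim_const]).
  - destruct (not_in_lattice_near a b w Ha Hb Hw) as [d [Hd Hn]].
    assert (L1 : clim (fun v => (wpr a b (v + w) - wpr a b (0 + w)) / (v - 0) ^ 2)%C 0 (wp2 a b w / 2)%C).
    { apply clim_taylor2 with (g := fun v => wpr a b (v + w)%C) (g' := fun v => wp1 a b (v + w)%C) (d := d).
      - exact Hd.
      - intros v Hv. apply cder_shift, cder_wpr; auto. apply Hn.
        replace (v + w - w)%C with (v - 0)%C by ring. exact Hv.
      - rewrite Cplus_0_l. apply wp1_half with (1, 0)%Z; [exact Hw|apply half_double].
      - apply cder_shift. rewrite Cplus_0_l. apply cder_wp1; auto. }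
    apply clim_ext_loc with (fun v => (wpr a b (v + w) - wpr a b (0 + w)) / (v - 0) ^ 2
       * (v ^ 2 * wpr a b v - e * (v * v)))%C 1; [lra| |].
    + intros v Hv _. rewrite Cplus_0_l. fold e. replace (v - 0)%C with v by ring.
      cbn [Cpow]. field. exact Hv.
    + replace (wp2 a b w / 2)%C with (wp2 a b w / 2 * (1 - e * (0 * 0)))%C
        by (field; intro X; apply RtoC_inj in X; lra).
      apply clim_mult; [exact L1|]. apply clim_minus; [apply clim_sqr_wpr|].
      apply clim_mult; [apply clim_const|]. apply clim_mult; apply ccont_id.
Qed.
End Rectangular.

(** * Half-period values *)

Lemma conj_fixed z : Cconj z = z -> z = RtoC (Re z).
Proof.
  intros H. apply C_ext; [reflexivity|]. rewrite im_RtoC.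
  pose proof (im_conj z) as E. rewrite H in E. lra.
Qed.

Lemma RtoC_neq x y : x <> y -> RtoC x <> RtoC y.
Proof. intros H E. apply H, RtoC_inj, E. Qed.

(** Taken as real parts; that the values themselves are real is shown in [wpr_e1], [wpr_e2] and
    [wpr_e3]. *)
Definition e1r (a b : R) : R := Re (wpr a b (RtoC (a / 2))).
Definition e2r (a b : R) : R := Re (wpr a b (Ci * RtoC (b / 2))%C).
Definition e3r (a b : R) : R := Re (wpr a b (RtoC (a / 2) + Ci * RtoC (b / 2))%C).

Section Rectangular.
Context (a b : R) (Ha : 0 < a) (Hb : 0 < b).

Lemma off_lattice_half2 : ~ in_lattice a b (Ci * RtoC (b / 2))%C.
Proof. rewrite in_lattice_rot. apply off_lattice_half; assumption. Qed.

Lemma off_lattice_half3 : ~ in_lattice a b (RtoC (a / 2) + Ci * RtoC (b / 2))%C.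
Proof. apply off_lattice_strip; [assumption|]. cbn. lra. Qed.

Lemma wpr_real x : ~ in_lattice a b (RtoC x) -> wpr a b (RtoC x) = RtoC (Re (wpr a b (RtoC x))).
Proof.
  intros H. apply conj_fixed. rewrite <- wpr_conj by assumption. f_equal.
  apply C_ext; cbn; ring.
Qed.

Lemma wpr_e1 : wpr a b (RtoC (a / 2)) = RtoC (e1r a b).
Proof. apply wpr_real. apply off_lattice_half; assumption. Qed.

Lemma wpr_imag y : ~ in_lattice a b (Ci * RtoC y)%C ->
  wpr a b (Ci * RtoC y)%C = RtoC (Re (wpr a b (Ci * RtoC y)%C)).
Proof.
  intros H. apply conj_fixed. rewrite <- wpr_conj by assumption.
  replace (Cconj (Ci * RtoC y)) with (- (Ci * RtoC y))%C by (apply C_ext; cbn; ring).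
  now apply wpr_even.
Qed.

Lemma wpr_e2 : wpr a b (Ci * RtoC (b / 2))%C = RtoC (e2r a b).
Proof. apply wpr_imag, off_lattice_half2. Qed.

Lemma wpr_e3 : wpr a b (RtoC (a / 2) + Ci * RtoC (b / 2))%C = RtoC (e3r a b).
Proof.
  pose proof off_lattice_half3 as H. apply conj_fixed. rewrite <- wpr_conj by assumption.
  set (w := (RtoC (a / 2) + Ci * RtoC (b / 2))%C) in *.
  replace (Cconj w) with (w + rect a b (0, -1)%Z)%C; [now apply wpr_periodic|].
  unfold w. apply C_ext; rewrite ?re_plus, ?im_plus, ?re_rect, ?im_rect; cbn; field.
Qed.

Lemma e2r_rot : e2r a b = - e1r b a.
Proof.
  unfold e2r, e1r. rewrite wpr_rot; [apply re_opp|assumption..|].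
  apply off_lattice_half; assumption.
Qed.

Lemma e3r_rot : e3r a b = - e3r b a.
Proof.
  unfold e3r. rewrite <- re_opp, <- wpr_rot; [|assumption..|].
  - f_equal. pose proof off_lattice_half3 as H.
    set (w := (RtoC (a / 2) + Ci * RtoC (b / 2))%C) in *.
    rewrite <- (wpr_periodic a b Ha Hb w H (-1, 0)%Z). f_equal. unfold w.
    apply C_ext; rewrite ?re_plus, ?im_plus, ?re_rect, ?im_rect; cbn; field.
  - apply off_lattice_strip; [assumption|]. cbn. lra.
Qed.

Let g := zsum a b 1 0.

(** By the second-order equation [wp1 ^ 2 - 4 wpr ^ 3 + 60 G4 wpr] has derivative zero, hence is
    constant on the convex strip. Its value is taken at [a / 2], where [wp1] vanishes; this choice
    produces the factor [wpr u - e1r]. *)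
Lemma wp_first_integral u :
  0 < Re u < a ->
  (wp1 a b u * wp1 a b u)%C
  = ((wpr a b u - e1r a b) * (4 * (wpr a b u * wpr a b u + wpr a b u * e1r a b + e1r a b * e1r a b) - 60 * g))%C.
Proof.
  intros Hu.
  set (T := fun u => (wp1 a b u * wp1 a b u - 4 * (wpr a b u * (wpr a b u * wpr a b u)) + 60 * g * wpr a b u)%C).
  assert (Hd : forall v, 0 < Re v < a -> cder T v 0).
  { intros v Hv. pose proof (off_lattice_strip a b Ha v Hv) as Hn.
    pose proof (cder_wpr a b Ha Hb v Hn) as D0. pose proof (cder_wp1 a b Ha Hb v Hn) as D1.
    pose proof (cder_plus _ _ _ _ _ (cder_minus _ _ _ _ _ (cder_mult _ _ _ _ _ D1 D1)
      (cder_scal 4 _ _ _ (cder_mult _ _ _ _ _ D0 (cder_mult _ _ _ _ _ D0 D0))))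
      (cder_scal (60 * g)%C _ _ _ D0)) as D.
    rewrite (wp_second_order a b Ha Hb v Hn) in D. fold g in D.
    match type of D with cder _ _ ?l => replace l with (RtoC 0) in D by ring end. exact D. }
  assert (E : T u = T (RtoC (a / 2))) by (apply (strip_constant a); auto; cbn; lra).
  unfold T in E. rewrite (wp1_half a b Ha Hb (RtoC (a / 2)) (1, 0)%Z), wpr_e1 in E;
    [|apply off_lattice_half; assumption|apply half_double].
  set (A := (wp1 a b u * wp1 a b u)%C) in *. set (f := wpr a b u) in *.
  replace A with (A - 4 * (f * (f * f)) + 60 * g * f + (4 * (f * (f * f)) - 60 * g * f))%C by ring.
  rewrite E. ring.
Qed.

Lemma wp2_half_eq : (wp2 a b (RtoC (a / 2)) / 2)%C = (3 * (e1r a b * e1r a b) - 15 * g)%C.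
Proof.
  rewrite wp_second_order by (assumption || (apply off_lattice_half; assumption)).
  rewrite wpr_e1. fold g. field.
Qed.

Lemma re_wpr_derive x :
  0 < x < a -> is_derive (fun x : R => Re (wpr a b (RtoC x))) x (Re (wp1 a b (RtoC x))).
Proof.
  intros Hx. assert (Hn : ~ in_lattice a b (RtoC x)) by (apply off_lattice_strip; auto).
  pose proof (is_derive_segment (wpr a b) 0 1 x (wp1 a b (RtoC x))) as D.
  replace (0 + x * 1)%C with (RtoC x) in D by ring. specialize (D (cder_wpr a b Ha Hb _ Hn)).
  rewrite Cmult_1_r in D. eapply is_derive_ext; [|exact D]. intros t. cbv beta. now replace (0 + t * 1)%C with (RtoC t) by ring.
Qed.

(** The imaginary part of [wpr] vanishes along the real interval, and so does its derivative. *)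
Lemma wp1_real x : 0 < x < a -> wp1 a b (RtoC x) = RtoC (Re (wp1 a b (RtoC x))).
Proof.
  intros Hx. assert (Hn : ~ in_lattice a b (RtoC x)) by (apply off_lattice_strip; auto).
  apply C_ext; [reflexivity|]. rewrite im_RtoC.
  pose proof (is_derive_segment (fun u => - Ci * wpr a b u)%C 0 1 x (- Ci * wp1 a b (RtoC x))%C) as D.
  replace (0 + x * 1)%C with (RtoC x) in D by ring.
  specialize (D (cder_scal _ _ _ _ (cder_wpr a b Ha Hb _ Hn))).
  assert (D0 : is_derive (fun _ : R => 0) x 0) by apply (is_derive_const (V := R_NormedModule)).
  assert (Hloc : locally x (fun t : R => 0 < t < a)).
  { apply (locally_interval _ x (Finite 0) (Finite a)); cbn; [lra|lra|]. intros; lra. }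
  assert (D2 : is_derive (fun _ : R => 0) x (Re (- Ci * wp1 a b (RtoC x) * 1)%C)).
  { eapply is_derive_ext_loc; [|exact D]. generalize Hloc. apply filter_imp. intros t Ht. cbv beta.
    replace (0 + t * 1)%C with (RtoC t) by ring.
    rewrite wpr_real by (apply off_lattice_strip; auto). cbn. ring. }
  pose proof (is_derive_unique _ _ _ D0) as E1. pose proof (is_derive_unique _ _ _ D2) as E2.
  rewrite E1 in E2. replace (Re (- Ci * wp1 a b (RtoC x) * 1)%C) with (Im (wp1 a b (RtoC x))) in E2 by (cbn; unfold Im; ring). now symmetry.
Qed.

Lemma re_wpr_continuity x : 0 < x < a -> continuity_pt (fun x : R => Re (wpr a b (RtoC x))) x.
Proof.
  intros Hx. apply continuity_pt_filterlim.
  apply (ex_derive_continuous (fun x : R => Re (wpr a b (RtoC x))) x). eexists. now apply re_wpr_derive.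
Qed.

Lemma re_wpr_large M : exists d, 0 < d /\ forall x, 0 < x < d -> M < Re (wpr a b (RtoC x)).
Proof.
  destruct (clim_sqr_wpr a b Ha Hb (1 / 2) ltac:(lra)) as [d [Hd H]].
  pose proof (Rabs_pos M) as PM.
  exists (Rmin d (Rmin 1 (/ (2 * (Rabs M + 1))))). split.
  { repeat apply Rmin_pos; try lra. apply Rinv_0_lt_compat. lra. }
  intros x [Hx0 Hx].
  assert (X1 : x < d) by (eapply Rlt_le_trans; [exact Hx|apply Rmin_l]).
  assert (X2 : x < 1) by (eapply Rlt_le_trans; [exact Hx|]; eapply Rle_trans; [apply Rmin_r|apply Rmin_l]).
  assert (X3 : x < / (2 * (Rabs M + 1))) by (eapply Rlt_le_trans; [exact Hx|]; eapply Rle_trans; [apply Rmin_r|apply Rmin_r]).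
  specialize (H (RtoC x)). replace (RtoC x - 0)%C with (RtoC x) in H by ring.
  rewrite Cmod_R, Rabs_pos_eq in H by lra. specialize (H ltac:(apply RtoC_neq; lra) X1).
  pose proof (re_le_Cmod (RtoC x ^ 2 * wpr a b (RtoC x) - 1)) as Hre.
  rewrite <- RtoC_pow, re_minus, re_scal_l, re_RtoC in Hre. rewrite <- RtoC_pow in H.
  pose proof (Rabs_def2 _ _ (Rle_lt_trans _ _ _ Hre H)) as [_ Hlow].
  set (y := Re (wpr a b (RtoC x))) in *.
  apply Rnot_le_lt. intro Hy. pose proof (RRle_abs M).
  assert (X4 : x * (2 * (Rabs M + 1)) < 1).
  { apply (Rmult_lt_compat_r (2 * (Rabs M + 1))) in X3; [|lra]. rewrite Rinv_l in X3 by lra. exact X3. }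
  assert (x ^ 2 * y <= x * (Rabs M)) by (simpl; nra). nra.
Qed.

(* Otherwise [y = wpr - e1] satisfies [y'^2 = 4 y^2 (y + 3 e1)] and [y (a / 2) = 0],
  so [y] vanishes on [(0, a / 2]] by Gronwall's argument. *)
Lemma wp2_half_nonzero : (wp2 a b (RtoC (a / 2)) / 2)%C <> RtoC 0.
Proof.
  intros E0. rewrite wp2_half_eq in E0.
  set (phi := fun x : R => Re (wpr a b (RtoC x))). set (e := e1r a b) in *.
  assert (Hg : (60 * g)%C = (12 * (e * e))%C).
  { replace (60 * g)%C with (12 * (e * e) - 4 * (3 * (e * e) - 15 * g))%C by ring. rewrite E0. ring. }
  assert (Hode : forall x, 0 < x < a -> Re (wp1 a b (RtoC x)) ^ 2 = 4 * (phi x - e) ^ 2 * (phi x + 2 * e)).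
  { intros x Hx. apply RtoC_inj. pose proof (wp_first_integral (RtoC x) Hx) as F. fold e in F. rewrite Hg in F.
    rewrite wp1_real, (wpr_real x) in F by (auto; apply off_lattice_strip; auto). fold (phi x) in F.
    rewrite RtoC_pow. cbn [Cpow]. rewrite Cmult_1_r, F.
    rewrite !RtoC_mult, RtoC_pow, !RtoC_minus, RtoC_plus, RtoC_mult. cbn [Cpow]. ring. }
  destruct (re_wpr_large (Rabs e + 1)) as [d [Hd Hlarge]].
  set (x0 := Rmin (d / 2) (a / 4)).
  assert (Hx0 : 0 < x0) by (apply Rmin_pos; lra).
  assert (Hx1 : x0 <= d / 2) by apply Rmin_l. assert (Hx2 : x0 <= a / 4) by apply Rmin_r.
  specialize (Hlarge x0 ltac:(lra)). fold (phi x0) in Hlarge.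
  destruct (continuity_ab_maj phi x0 (a / 2) ltac:(lra)) as [m [Hm _]].
  { intros x Hx. apply re_wpr_continuity. lra. }
  set (k := Rabs (phi m) + 2 * Rabs e + 1).
  assert (Hk : 1 <= k) by (unfold k; pose proof (Rabs_pos (phi m)); pose proof (Rabs_pos e); lra).
  assert (Hder : forall x, x0 <= x <= a / 2 -> Rabs (Re (wp1 a b (RtoC x))) <= 2 * k * Rabs (phi x - e)).
  { intros x Hx. specialize (Hode x ltac:(lra)). specialize (Hm x Hx).
    apply Rsqr_incr_0_var; [|pose proof (Rabs_pos (phi x - e)); nra].
    unfold Rsqr. replace (2 * k * Rabs (phi x - e) * (2 * k * Rabs (phi x - e)))
      with (4 * k ^ 2 * Rabs (phi x - e) ^ 2) by ring.
    replace (Rabs (Re (wp1 a b x)) * Rabs (Re (wp1 a b x))) with (Rabs (Re (wp1 a b x)) ^ 2) by ring.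
    rewrite !pow2_abs, Hode.
    assert (phi x + 2 * e <= k).
    { unfold k. pose proof (RRle_abs (phi m)). pose proof (RRle_abs e). lra. }
    pose proof (pow2_ge_0 (phi x - e)). 
    apply Rle_trans with (4 * (phi x - e) ^ 2 * k ^ 2); [|lra].
    apply Rmult_le_compat_l; [lra|]. nra. }
  (* The bound [|phi'| <= 2 k |phi - e|] makes the weighted square nondecreasing. It is positive at
     [x0], where [phi] exceeds [e], and zero at [a / 2], a contradiction. *)
  destruct (MVT_gen (fun x => (phi x - e) ^ 2 * exp (4 * k * x)) x0 (a / 2)
    (fun x => (2 * (phi x - e) * Re (wp1 a b (RtoC x)) + 4 * k * (phi x - e) ^ 2) * exp (4 * k * x)))
    as [t [Ht Et]].
  - intros x Hx. rewrite Rmin_left, Rmax_right in Hx by lra.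
    pose proof (re_wpr_derive x ltac:(lra)) as D. fold phi in D.
    auto_derive; [exists (Re (wp1 a b (RtoC x))); exact D|].
    change (Derive (fun x1 : R => phi x1) x) with (Derive phi x). rewrite (is_derive_unique _ _ _ D). ring.
  - intros x Hx. rewrite Rmin_left, Rmax_right in Hx by lra.
    pose proof (re_wpr_derive x ltac:(lra)) as D. fold phi in D.
    apply continuity_pt_filterlim. apply (ex_derive_continuous (fun x => (phi x - e) ^ 2 * exp (4 * k * x)) x).
    auto_derive. exists (Re (wp1 a b (RtoC x))). exact D.
  - rewrite Rmin_left, Rmax_right in Ht by lra.
    assert (Eh : phi (a / 2) = e) by reflexivity. rewrite Eh in Et.
    assert (0 <= (2 * (phi t - e) * Re (wp1 a b (RtoC t)) + 4 * k * (phi t - e) ^ 2) * exp (4 * k * t) * (a / 2 - x0)).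
    { apply Rmult_le_pos; [|lra]. apply Rmult_le_pos; [|left; apply exp_pos].
      specialize (Hder t Ht). rewrite <- (pow2_abs (phi t - e)).
      assert (Rabs ((phi t - e) * Re (wp1 a b (RtoC t))) <= Rabs (phi t - e) * (2 * k * Rabs (phi t - e))).
      { rewrite Rabs_mult. apply Rmult_le_compat_l; [apply Rabs_pos|exact Hder]. }
      pose proof (Rabs_le_between ((phi t - e) * Re (wp1 a b (RtoC t))) (Rabs (phi t - e) * (2 * k * Rabs (phi t - e)))) as [Hb1 _].
      specialize (Hb1 H). nra. }
    assert (0 < (phi x0 - e) ^ 2).
    { pose proof (RRle_abs e). apply pow_lt. lra. }
    pose proof (exp_pos (4 * k * x0)). nra.
Qed.
End Rectangular.

(** * Relations and inequalities between the half-period values *)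

Section Rectangular.
Context (a b : R) (Ha : 0 < a) (Hb : 0 < b).

Lemma off_half_of_strip u : 0 < Re u < a / 2 -> ~ in_lattice (a / 2) b u.
Proof. intros H. apply off_lattice_strip; [lra|exact H]. Qed.

(** The translation identity evaluated at the half period [Ci * (b / 2)], which is moved to the
    third half period. This is where [e2r] enters the algebra. *)
Lemma wp2_half_factor :
  ((e3r a b - e1r a b) * (e2r a b - e1r a b))%C = (wp2 a b (RtoC (a / 2)) / 2)%C.
Proof.
  assert (H : ~ in_lattice (a / 2) b (Ci * RtoC (b / 2))%C) by (apply off_lattice_half2; lra).
  pose proof (wpr_half_translate a b Ha Hb _ H) as E.
  replace (Ci * RtoC (b / 2) + RtoC (a / 2))%C with (RtoC (a / 2) + Ci * RtoC (b / 2))%C in E by ring.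
  rewrite wpr_e1, wpr_e2, wpr_e3 in E by assumption. exact E.
Qed.

Lemma e_distinct_1 : e3r a b <> e1r a b /\ e2r a b <> e1r a b.
Proof.
  pose proof (wp2_half_nonzero a b Ha Hb) as H. rewrite <- wp2_half_factor in H.
  split; intros E; apply H; rewrite E; ring.
Qed.

Lemma wpr_translate u :
  ~ in_lattice (a / 2) b u ->
  ((wpr a b (u + RtoC (a / 2)) - e1r a b) * (wpr a b u - e1r a b))%C
  = RtoC ((e1r a b - e2r a b) * (e1r a b - e3r a b)).
Proof.
  intros Hu. rewrite <- (wpr_e1 a b Ha Hb), wpr_half_translate by assumption.
  rewrite <- wp2_half_factor. rewrite RtoC_mult, !RtoC_minus. ring.
Qed.

Lemma wpr_ne_e1 u : ~ in_lattice (a / 2) b u -> (wpr a b u - e1r a b)%C <> 0.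
Proof.
  intros Hu E. pose proof (wpr_translate u Hu) as H. rewrite E, Cmult_0_r in H.
  apply RtoC_inj in H. destruct e_distinct_1. symmetry in H. apply Rmult_integral in H. lra.
Qed.

(** At the third half period [wp1] vanishes too, and [e3r] differs from [e1r]; hence the quadratic
    factor of the first integral vanishes at [e3r]. *)
Lemma eisenstein4_eq :
  (15 * zsum a b 1 0)%C
  = RtoC (e1r a b * e1r a b + e1r a b * e3r a b + e3r a b * e3r a b).
Proof.
  pose proof (wp_first_integral a b Ha Hb (RtoC (a / 2) + Ci * RtoC (b / 2))%C) as F.
  specialize (F ltac:(cbn; lra)).
  rewrite (wp1_half a b Ha Hb _ (1, 1)%Z) in F; [|now apply off_lattice_half3|].
  2:{ apply C_ext; rewrite ?re_plus, ?im_plus, ?re_rect, ?im_rect; cbn; field. }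
  rewrite wpr_e3, Cmult_0_r in F by assumption.
  set (G := zsum a b 1 0) in *.
  assert (N : (RtoC (e3r a b) - RtoC (e1r a b))%C <> 0).
  { rewrite <- RtoC_minus. apply RtoC_neq. destruct e_distinct_1. lra. }
  rewrite !RtoC_plus, !RtoC_mult.
  set (x := RtoC (e1r a b)) in *. set (z := RtoC (e3r a b)) in *.
  assert (F2 : (4 * (z * z + z * x + x * x) - 60 * G)%C = 0).
  { destruct (Ceq_dec (4 * (z * z + z * x + x * x) - 60 * G) 0) as [E|E]; [exact E|].
    exfalso. exact (Cmult_neq_0 _ _ N E (eq_sym F)). }
  apply Ceq_minus in F2. replace (15 * G)%C with (/ 4 * (60 * G))%C by field.
  rewrite <- F2. field.
Qed.

(** Two expressions for half the second derivative at [a / 2] are compared: [(e1 - e3) (e1 - e2)]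
    and [3 e1 ^ 2 - 15 G4 = (e1 - e3) (2 e1 + e3)]. Cancelling [e1 - e3] leaves the claim. *)
Lemma e_sum : e1r a b + e2r a b + e3r a b = 0.
Proof.
  pose proof (wp2_half_eq a b Ha Hb) as C1.
  rewrite <- wp2_half_factor, eisenstein4_eq in C1.
  rewrite <- !RtoC_minus, <- !RtoC_mult, <- RtoC_minus in C1. apply RtoC_inj in C1.
  destruct e_distinct_1 as [N _].
  apply Rmult_eq_reg_l with (e1r a b - e3r a b); nra.
Qed.

Lemma wp_ode u :
  0 < Re u < a ->
  (wp1 a b u * wp1 a b u)%C
  = (4 * ((wpr a b u - e1r a b) * (wpr a b u - e2r a b) * (wpr a b u - e3r a b)))%C.
Proof.
  intros Hu. rewrite wp_first_integral by assumption.
  pose proof eisenstein4_eq as G. pose proof e_sum as S.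
  replace (60 * zsum a b 1 0)%C with (4 * (15 * zsum a b 1 0))%C by ring. rewrite G.
  replace (e2r a b) with (- e1r a b - e3r a b) by lra.
  rewrite !RtoC_plus, !RtoC_mult, RtoC_minus, RtoC_opp. ring.
Qed.

Lemma half_symm x : 0 < x < a -> wpr a b (RtoC (a - x)) = wpr a b (RtoC x).
Proof.
  intros Hx. assert (Hn : ~ in_lattice a b (RtoC x)) by (apply off_lattice_strip; auto).
  rewrite <- (wpr_even a b Ha Hb (RtoC x) Hn).
  rewrite <- (wpr_periodic a b Ha Hb (- RtoC x)%C (off_lattice_opp _ _ _ Hn) (1, 0)%Z).
  f_equal. rewrite rect_10. apply C_ext; cbn; ring.
Qed.

(** Near the pole [wpr] is large, and by the translation identity it never takes the value [e1r] on
    this interval; the intermediate value theorem concludes. *)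
Lemma wpr_gt_e1 x : 0 < x < a / 2 -> e1r a b < Re (wpr a b (RtoC x)).
Proof.
  intros Hx. apply Rnot_le_lt. intro Hle.
  assert (Hne : forall y, 0 < y < a / 2 -> Re (wpr a b (RtoC y)) - e1r a b <> 0).
  { intros y Hy E. apply (wpr_ne_e1 (RtoC y)); [apply off_half_of_strip; exact Hy|].
    rewrite wpr_real by (auto; apply off_lattice_strip; auto; cbn; lra).
    rewrite <- RtoC_minus. now rewrite E. }
  destruct (re_wpr_large a b Ha Hb (e1r a b)) as [d [Hd H]].
  set (y := Rmin (d / 2) (x / 2)).
  assert (Hy : 0 < y) by (apply Rmin_pos; lra).
  assert (Hy1 : y <= d / 2) by apply Rmin_l. assert (Hy2 : y <= x / 2) by apply Rmin_r.
  specialize (H y ltac:(lra)).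
  destruct (Rle_lt_or_eq_dec _ _ Hle) as [Hlt|E]; [|now apply (Hne x Hx); lra].
  destruct (Ranalysis5.IVT_interv (fun t => e1r a b - Re (wpr a b (RtoC t))) y x) as [z [Hz Ez]].
  - intros t Ht. apply continuity_pt_minus; [apply continuity_pt_const; now intros ? ?|].
    apply re_wpr_continuity; auto; lra.
  - lra.
  - lra.
  - lra.
  - apply (Hne z); lra.
Qed.

(** At [x = a / 4] the translate [x + a / 2] equals [a - x], where [wpr] takes the same value. The
    product in the translation identity is then a square. *)
Lemma e1_positive : 0 < (e1r a b - e2r a b) * (e1r a b - e3r a b).
Proof.
  set (x := a / 4). assert (Hx : 0 < x < a / 2) by (unfold x; lra).
  pose proof (wpr_translate (RtoC x) (off_half_of_strip (RtoC x) Hx)) as E.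
  replace (RtoC x + RtoC (a / 2))%C with (RtoC (a - x)) in E
    by (unfold x; apply C_ext; cbn; field).
  rewrite half_symm in E by lra.
  rewrite wpr_real in E by (auto; apply off_lattice_strip; auto; cbn; lra).
  rewrite <- !RtoC_minus, <- RtoC_mult in E. apply RtoC_inj in E. rewrite <- E.
  pose proof (wpr_gt_e1 x Hx). nra.
Qed.

Lemma wpr_ge_e1 x : ~ in_lattice a b (RtoC x) -> e1r a b <= Re (wpr a b (RtoC x)).
Proof.
  intros Hn. destruct (nearest_multiple a x Ha) as [m Hm].
  set (y := x - IZR m * a).
  assert (Ey : RtoC y = (RtoC x + rect a b (- m, 0)%Z)%C).
  { unfold y. apply C_ext; rewrite ?re_plus, ?im_plus, ?re_rect, ?im_rect; cbn [fst snd].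
    - rewrite opp_IZR, !re_RtoC. ring.
    - rewrite !im_RtoC. ring. }
  assert (Hny : ~ in_lattice a b (RtoC y)) by (now rewrite Ey, in_lattice_shift).
  rewrite <- (wpr_periodic a b Ha Hb _ Hn (- m, 0)%Z), <- Ey.
  fold y in Hm.
  assert (Hy0 : y <> 0) by (intros E; apply Hny; rewrite E; apply in_lattice_0).
  assert (Eabs : Re (wpr a b (RtoC y)) = Re (wpr a b (RtoC (Rabs y)))).
  { unfold Rabs. destruct (Rcase_abs y); [|reflexivity]. now rewrite RtoC_opp, wpr_even. }
  rewrite Eabs. assert (Hp : 0 < Rabs y) by now apply Rabs_pos_lt.
  destruct (Rle_lt_or_eq_dec _ _ Hm) as [Hlt|Heq].
  - left. apply wpr_gt_e1. lra.
  - rewrite Heq. unfold e1r. lra.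
Qed.
End Rectangular.

Section Order.
Context (a b : R) (Ha : 0 < a) (Hb : 0 < b).

Lemma wpr_imag_le_e2 y :
  ~ in_lattice a b (Ci * RtoC y)%C -> Re (wpr a b (Ci * RtoC y)%C) <= e2r a b.
Proof.
  intros H. assert (H' : ~ in_lattice b a (RtoC y)) by (now rewrite <- in_lattice_rot).
  rewrite wpr_rot, re_opp, e2r_rot by assumption.
  pose proof (wpr_ge_e1 b a Hb Ha y H'). lra.
Qed.

(** The inequality [e1_positive] and its version for the exchanged periods together say that [e3r]
    lies between [e1r] and [e2r]; only the direction of the chain remains to be decided. *)
Lemma e_order : e2r a b < e3r a b < e1r a b.
Proof.
  pose proof (e1_positive a b Ha Hb) as H1. pose proof (e1_positive b a Hb Ha) as H2.
  assert (R1 : e1r b a = - e2r a b) by (rewrite (e2r_rot a b); auto; lra).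
  assert (R2 : e2r b a = - e1r a b) by (rewrite (e2r_rot b a); auto).
  assert (R3 : e3r b a = - e3r a b) by (rewrite (e3r_rot a b); auto; lra).
  rewrite R1, R2, R3 in H2.
  destruct (Rtotal_order (e1r a b) (e2r a b)) as [Hlt|[E|Hgt]]; [exfalso|exfalso; rewrite E in H1; lra|split; nra].
  (* [wpr] would take a value in [(e3, e2)] on the real axis, where [wp1 ^ 2 >= 0] *)
  assert (H13 : e1r a b < e3r a b) by nra. assert (H32 : e3r a b < e2r a b) by nra.
  set (c := (e3r a b + e2r a b) / 2).
  destruct (re_wpr_large a b Ha Hb c) as [d [Hd H]].
  set (y := Rmin (d / 2) (a / 4)).
  assert (Hy : 0 < y) by (apply Rmin_pos; lra).
  assert (Hy1 : y <= d / 2) by apply Rmin_l. assert (Hy2 : y <= a / 4) by apply Rmin_r.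
  specialize (H y ltac:(lra)).
  destruct (Ranalysis5.IVT_interv (fun t => c - Re (wpr a b (RtoC t))) y (a / 2)) as [z [Hz Ez]].
  - intros t Ht. apply continuity_pt_minus; [apply continuity_pt_const; now intros ? ?|].
    apply re_wpr_continuity; auto; lra.
  - lra.
  - lra.
  - fold (e1r a b). unfold c. lra.
  - pose proof (wp_ode a b Ha Hb (RtoC z) ltac:(cbn; lra)) as O.
    rewrite wp1_real, wpr_real in O by (auto; try (apply off_lattice_strip; auto); cbn; lra).
    replace (Re (wpr a b (RtoC z))) with c in O by lra.
    rewrite <- !RtoC_minus, <- !RtoC_mult in O. apply RtoC_inj in O.
    assert (0 < (c - e1r a b) * ((e2r a b - c) * (c - e3r a b))).
    { apply Rmult_lt_0_compat; [unfold c; lra|]. apply Rmult_lt_0_compat; unfold c; lra. }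
    pose proof (Rle_0_sqr (Re (wp1 a b (RtoC z)))) as Q. unfold Rsqr in Q. nra.
Qed.

Lemma wpr_translate_2 u :
  ~ in_lattice a (b / 2) u ->
  ((wpr a b (u + Ci * RtoC (b / 2)) - e2r a b) * (wpr a b u - e2r a b))%C
  = RtoC ((e2r a b - e1r a b) * (e2r a b - e3r a b)).
Proof.
  intros Hu.
  assert (E : (Ci * Ci)%C = (- (1))%C) by (apply C_ext; cbn; ring).
  set (v := (- (Ci * u))%C).
  assert (Ev : (Ci * v)%C = u) by (unfold v; replace (Ci * - (Ci * u))%C with (- (Ci * Ci * u))%C by ring; rewrite E; ring).
  assert (Hv : ~ in_lattice (b / 2) a v) by (rewrite <- in_lattice_rot, Ev; exact Hu).
  destruct (off_half_lattice b a v Hv) as [V1 V2].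
  pose proof (wpr_translate b a Hb Ha v Hv) as T.
  replace (wpr b a (v + RtoC (b / 2))) with (- wpr a b (u + Ci * RtoC (b / 2)))%C in T.
  2:{ rewrite <- Ev, <- Cmult_plus_distr_l, wpr_rot by assumption. ring. }
  replace (wpr b a v) with (- wpr a b u)%C in T by (rewrite <- Ev at 1; rewrite wpr_rot by assumption; ring).
  assert (R1 : e1r b a = - e2r a b) by (rewrite (e2r_rot a b); auto; lra).
  assert (R2 : e2r b a = - e1r a b) by (rewrite (e2r_rot b a); auto).
  assert (R3 : e3r b a = - e3r a b) by (rewrite (e3r_rot a b); auto; lra).
  rewrite R1, R2, R3 in T.
  replace ((e2r a b - e1r a b) * (e2r a b - e3r a b))
    with ((- e2r a b - - e1r a b) * (- e2r a b - - e3r a b)) by ring.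
  rewrite <- T, RtoC_opp. ring.
Qed.

Lemma off_quarter_lattice u :
  ~ in_lattice (a / 2) (b / 2) u ->
  ~ in_lattice (a / 2) b u /\ ~ in_lattice a (b / 2) u /\ ~ in_lattice a b u /\
  ~ in_lattice a b (2 * u)%C /\
  ~ in_lattice a (b / 2) (u + RtoC (a / 2))%C /\ ~ in_lattice (a / 2) b (u + Ci * RtoC (b / 2))%C.
Proof.
  intros H. repeat split; intros [p E]; apply H.
  - exists (fst p, 2 * snd p)%Z. rewrite E. apply C_ext; rewrite ?re_rect, ?im_rect; cbn [fst snd];
      rewrite ?mult_IZR; field.
  - exists (2 * fst p, snd p)%Z. rewrite E. apply C_ext; rewrite ?re_rect, ?im_rect; cbn [fst snd];
      rewrite ?mult_IZR; field.
  - exists (2 * fst p, 2 * snd p)%Z. rewrite E. apply C_ext; rewrite ?re_rect, ?im_rect; cbn [fst snd];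
      rewrite ?mult_IZR; field.
  - exists p. replace u with (/ 2 * (2 * u))%C by (field; apply RtoC_neq; lra). rewrite E.
    rewrite <- RtoC_inv by lra. apply C_ext; rewrite ?re_scal_l, ?im_scal_l, ?re_rect, ?im_rect; field.
  - exists (2 * fst p - 1, snd p)%Z.
    replace u with (rect a (b / 2) p - RtoC (a / 2))%C by (rewrite <- E; ring).
    apply C_ext; rewrite ?re_minus, ?im_minus, ?re_rect, ?im_rect; cbn [fst snd];
      rewrite ?minus_IZR, ?mult_IZR; cbn; field.
  - exists (fst p, 2 * snd p - 1)%Z.
    replace u with (rect (a / 2) b p - Ci * RtoC (b / 2))%C by (rewrite <- E; ring).
    apply C_ext; rewrite ?re_minus, ?im_minus, ?re_rect, ?im_rect; cbn [fst snd];
      rewrite ?minus_IZR, ?mult_IZR; cbn; field.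
Qed.
End Order.

(** * The duplication formula *)

Section Rectangular.
Context (a b : R) (Ha : 0 < a) (Hb : 0 < b).

Lemma off_quarter_lattice_translate u :
  ~ in_lattice (a / 2) (b / 2) u ->
  ~ in_lattice a b (u + RtoC (a / 2))%C /\ ~ in_lattice a b (u + Ci * RtoC (b / 2))%C /\
  ~ in_lattice a b (u + RtoC (a / 2) + Ci * RtoC (b / 2))%C.
Proof.
  intros H. repeat split; intros [p E]; apply H.
  - exists (2 * fst p - 1, 2 * snd p)%Z.
    replace u with (rect a b p - RtoC (a / 2))%C by (rewrite <- E; ring).
    apply C_ext; rewrite ?re_minus, ?im_minus, ?re_rect, ?im_rect; cbn [fst snd];
      rewrite ?minus_IZR, ?mult_IZR; cbn; field.
  - exists (2 * fst p, 2 * snd p - 1)%Z.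
    replace u with (rect a b p - Ci * RtoC (b / 2))%C by (rewrite <- E; ring).
    apply C_ext; rewrite ?re_minus, ?im_minus, ?re_rect, ?im_rect; cbn [fst snd];
      rewrite ?minus_IZR, ?mult_IZR; cbn; field.
  - exists (2 * fst p - 1, 2 * snd p - 1)%Z.
    replace u with (rect a b p - RtoC (a / 2) - Ci * RtoC (b / 2))%C by (rewrite <- E; ring).
    apply C_ext; rewrite ?re_minus, ?im_minus, ?re_rect, ?im_rect; cbn [fst snd];
      rewrite ?minus_IZR, ?mult_IZR; cbn; field.
Qed.

Lemma clim_wpr_shift w : ~ in_lattice a b w -> clim (fun u => wpr a b (u + w)%C) 0 (wpr a b w).
Proof.
  intros Hw. pose proof (cder_shift (wpr a b) w 0 (wp1 a b w)) as D.
  rewrite Cplus_0_l in D. pose proof (cder_ccont _ _ _ (D (cder_wpr a b Ha Hb w Hw))) as L.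
  unfold ccont in L. now rewrite Cplus_0_l in L.
Qed.

(** The sum over the four half-period translates has both half periods, as has [wpr (2 * u)]. Modulo
    these the only singularity is at [0], where [1 / u ^ 2] cancels against [4 / (2 u) ^ 2]; the
    limit is the sum of the half-period values, which is zero. *)
Lemma wpr_double_sum u :
  ~ in_lattice (a / 2) (b / 2) u ->
  (wpr a b u + wpr a b (u + RtoC (a / 2)) + wpr a b (u + Ci * RtoC (b / 2))
   + wpr a b (u + RtoC (a / 2) + Ci * RtoC (b / 2)) - 4 * wpr a b (2 * u))%C = 0.
Proof.
  set (w1 := RtoC (a / 2)). set (w2 := (Ci * RtoC (b / 2))%C).
  assert (W1 : forall v, (v + w1 + w1)%C = (v + rect a b (1, 0)%Z)%C).
  { intros v. rewrite <- half_double. fold w1. ring. }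
  assert (W2 : forall v, (v + w2 + w2)%C = (v + rect a b (0, 1)%Z)%C).
  { intros v. rewrite rect_01. unfold w2. replace (RtoC b) with (RtoC (b / 2) + RtoC (b / 2))%C; [ring|].
    rewrite <- RtoC_plus. f_equal. field. }
  revert u. apply (liouville (a / 2) (b / 2)
    (fun u => wpr a b u + wpr a b (u + w1) + wpr a b (u + w2) + wpr a b (u + w1 + w2) - 4 * wpr a b (2 * u))%C
    (fun u => wp1 a b u + wp1 a b (u + w1) + wp1 a b (u + w2) + wp1 a b (u + (w1 + w2)) - 4 * (2 * wp1 a b (2 * u + 0)))%C);
    [lra|lra| | |].
  - apply periodic_intro; intros u Hu; fold w1 w2;
      destruct (off_quarter_lattice a b u Hu) as [_ [_ [Q0 [Q2 _]]]];
      destruct (off_quarter_lattice_translate u Hu) as [Q3 [Q4 Q5]]; fold w1 w2 in Q3, Q4, Q5.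
    + rewrite !W1, (wpr_periodic a b Ha Hb u Q0).
      replace (u + w1 + w2)%C with (u + w2 + w1)%C by ring.
      replace (2 * (u + w1))%C with (2 * u + rect a b (1, 0)%Z)%C
        by (replace (2 * (u + w1))%C with (2 * u + w1 + w1)%C by ring; symmetry; apply W1).
      rewrite (wpr_periodic a b Ha Hb _ Q2).
      replace (u + rect a b (1, 0)%Z + w2)%C with (u + w2 + rect a b (1, 0)%Z)%C by ring.
      rewrite (wpr_periodic a b Ha Hb _ Q4). ring.
    + replace (u + w2 + w1 + w2)%C with (u + w1 + w2 + w2)%C by ring.
      rewrite !W2, (wpr_periodic a b Ha Hb u Q0), (wpr_periodic a b Ha Hb _ Q3).
      replace (2 * (u + w2))%C with (2 * u + rect a b (0, 1)%Z)%C
        by (replace (2 * (u + w2))%C with (2 * u + w2 + w2)%C by ring; symmetry; apply W2).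
      rewrite (wpr_periodic a b Ha Hb _ Q2).
      replace (u + w2 + w1)%C with (u + w1 + w2)%C by ring. ring.
  - intros u Hu.
    destruct (off_quarter_lattice a b u Hu) as [_ [_ [Q0 [Q2 _]]]].
    destruct (off_quarter_lattice_translate u Hu) as [Q3 [Q4 Q5]]. fold w1 w2 in Q3, Q4, Q5.
    rewrite <- Cplus_assoc in Q5. replace (2 * u)%C with (2 * u + 0)%C in Q2 by ring.
    pose proof (cder_wpr a b Ha Hb _ Q0) as D0.
    pose proof (cder_shift (wpr a b) w1 u _ (cder_wpr a b Ha Hb _ Q3)) as D1.
    pose proof (cder_shift (wpr a b) w2 u _ (cder_wpr a b Ha Hb _ Q4)) as D2.
    pose proof (cder_shift (wpr a b) (w1 + w2)%C u _ (cder_wpr a b Ha Hb _ Q5)) as D3.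
    pose proof (cder_affine (wpr a b) 2 0 u _ (cder_wpr a b Ha Hb _ Q2)) as D4.
    split.
    + apply cder_ext with (fun u => wpr a b u + wpr a b (u + w1) + wpr a b (u + w2) + wpr a b (u + (w1 + w2)) - 4 * wpr a b (2 * u + 0))%C.
      { intros v. now rewrite Cplus_assoc, Cplus_0_r. }
      apply cder_minus; [exact (cder_plus _ _ _ _ _ (cder_plus _ _ _ _ _ (cder_plus _ _ _ _ _ D0 D1) D2) D3)|]. apply cder_scal. exact D4.
    + apply clim_minus; [apply clim_plus; [apply clim_plus; [apply clim_plus|]|]|].
      * exact (cder_ccont _ _ _ (cder_wp1 a b Ha Hb _ Q0)).
      * exact (cder_ccont _ _ _ (cder_shift (wp1 a b) w1 u _ (cder_wp1 a b Ha Hb _ Q3))).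
      * exact (cder_ccont _ _ _ (cder_shift (wp1 a b) w2 u _ (cder_wp1 a b Ha Hb _ Q4))).
      * exact (cder_ccont _ _ _ (cder_shift (wp1 a b) (w1 + w2)%C u _ (cder_wp1 a b Ha Hb _ Q5))).
      * do 2 (apply clim_mult; [apply clim_const|]).
        exact (cder_ccont _ _ _ (cder_affine (wp1 a b) 2 0 u _ (cder_wp1 a b Ha Hb _ Q2))).
  - pose proof (clim_wpr_shift _ (off_lattice_half a b Ha)) as L1.
    pose proof (clim_wpr_shift _ (off_lattice_half2 a b Hb)) as L2.
    pose proof (clim_wpr_shift _ (off_lattice_half3 a b Ha)) as L3.
    rewrite wpr_e1 in L1 by assumption. rewrite wpr_e2 in L2 by assumption. rewrite wpr_e3 in L3 by assumption.
    fold w1 in L1, L3. fold w2 in L2, L3.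
    pose proof (ccont_wp0_0 a b Ha Hb) as C0. unfold ccont in C0. rewrite wp0_0 in C0 by assumption.
    assert (C2 : clim (fun u => wp0 a b (2 * u + 0)%C) 0 0).
    { apply clim_affine; [apply RtoC_neq; lra|]. now replace (2 * 0 + 0)%C with (RtoC 0) by ring. }
    pose proof (clim_plus _ _ _ _ _ (clim_plus _ _ _ _ _ (clim_plus _ _ _ _ _ L1 L2) L3)
      (clim_minus _ _ _ _ _ C0 (clim_mult _ _ _ _ _ (clim_const 4 0) C2))) as L.
    replace (e1r a b + e2r a b + e3r a b + (0 - 4 * 0))%C with (RtoC 0) in L.
    2:{ rewrite <- !RtoC_plus, e_sum by assumption. ring. }
    revert L. apply clim_ext_loc with 1; [lra|]. intros v Hv _.
    rewrite (wpr_eq a b v), (wpr_eq a b (2 * v)), Cplus_0_r, Cplus_assoc. cbn [Cpow]. field.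
    exact Hv.
Qed.

(** For [e1r] and [e2r] the product in the translation identity is a nonzero constant. If the value
    were [e3r], translation by [a / 2] would send it to [e2r], which was just excluded. *)
Lemma wpr_ne_e u :
  ~ in_lattice (a / 2) (b / 2) u ->
  (wpr a b u - e1r a b)%C <> 0 /\ (wpr a b u - e2r a b)%C <> 0 /\ (wpr a b u - e3r a b)%C <> 0.
Proof.
  intros Hu. destruct (off_quarter_lattice a b u Hu) as [Q1 [Q2 [Q0 [Q4 [Q5 Q6]]]]].
  pose proof (e_order a b Ha Hb) as Ho.
  assert (N2 : RtoC ((e2r a b - e1r a b) * (e2r a b - e3r a b)) <> 0).
  { apply RtoC_neq. nra. }
  assert (H2 : forall v, ~ in_lattice a (b / 2) v -> (wpr a b v - e2r a b)%C <> 0).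
  { intros v Hv E. apply N2. rewrite <- (wpr_translate_2 a b Ha Hb v Hv), E. ring. }
  split; [now apply wpr_ne_e1|]. split; [now apply H2|]. intros E3.
  apply (H2 _ Q5). pose proof (wpr_translate a b Ha Hb u Q1) as T.
  pose proof (wpr_ne_e1 a b Ha Hb u Q1) as N1.
  apply Ceq_minus in E3. rewrite E3 in T, N1.
  replace (wpr a b (u + RtoC (a / 2)) - e2r a b)%C
    with ((((wpr a b (u + RtoC (a / 2)) - e1r a b) * (e3r a b - e1r a b))
       + (e1r a b - e2r a b) * (e3r a b - e1r a b)) / (e3r a b - e1r a b))%C by (field; exact N1).
  rewrite T, RtoC_mult, !RtoC_minus. field. exact N1.
Qed.

(** The translation identities make each translate of [f] by a half period a Moebius function of
    [f]; for the third half period two of them are composed. Then [wpr_double_sum] expresses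
    [wpr (2 * u)] rationally in [f], and [e3 = - e1 - e2] reduces the claim to an identity of
    rational functions. *)
Lemma wpr_duplication u :
  ~ in_lattice (a / 2) (b / 2) u ->
  let f := wpr a b u in
  (4 * (wpr a b (2 * u) - e2r a b))%C
  = (((f - e2r a b) ^ 2 - (e2r a b - e1r a b) * (e2r a b - e3r a b)) ^ 2
     / ((f - e1r a b) * (f - e2r a b) * (f - e3r a b)))%C.
Proof.
  intros Hu f. destruct (off_quarter_lattice a b u Hu) as [Q1 [Q2 [Q0 [Q4 [Q5 Q6]]]]].
  destruct (wpr_ne_e u Hu) as [N1 [N2 N3]]. fold f in N1, N2, N3.
  pose proof (wpr_double_sum u Hu) as D. fold f in D.
  pose proof (wpr_translate a b Ha Hb u Q1) as T1.
  pose proof (wpr_translate_2 a b Ha Hb u Q2) as T2.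
  pose proof (wpr_translate_2 a b Ha Hb _ Q5) as T3. fold f in T1, T2.
  pose proof (e_sum a b Ha Hb) as S. pose proof (e_order a b Ha Hb) as Ho.
  assert (N12 : (RtoC (e1r a b) - RtoC (e2r a b))%C <> 0) by (rewrite <- RtoC_minus; apply RtoC_neq; lra).
  rewrite !RtoC_mult, !RtoC_minus in T1, T2, T3.
  assert (S3 : RtoC (e3r a b) = (- e1r a b - e2r a b)%C)
    by (rewrite <- RtoC_opp, <- RtoC_minus; f_equal; lra).
  set (x := RtoC (e1r a b)) in *. set (y := RtoC (e2r a b)) in *. set (z := RtoC (e3r a b)) in *.
  set (f1 := wpr a b (u + RtoC (a / 2))) in *. set (f2 := wpr a b (u + Ci * RtoC (b / 2))) in *.
  set (f3 := wpr a b (u + RtoC (a / 2) + Ci * RtoC (b / 2))) in *.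
  assert (F1 : f1 = (x + (x - y) * (x - z) / (f - x))%C).
  { rewrite <- T1. field. exact N1. }
  assert (F2 : f2 = (y + (y - x) * (y - z) / (f - y))%C).
  { rewrite <- T2. field. exact N2. }
  assert (F1y : (f1 - y)%C = ((x - y) * (f - z) / (f - x))%C) by (rewrite F1; field; exact N1).
  assert (F3 : f3 = (y + (z - y) * (f - x) / (f - z))%C).
  { rewrite F1y in T3.
    replace f3 with (y + ((f3 - y) * ((x - y) * (f - z) / (f - x))) * ((f - x) / ((x - y) * (f - z))))%C
      by (field; repeat split; assumption).
    rewrite T3. field. repeat split; assumption. }
  assert (D' : (4 * wpr a b (2 * u))%C = (f + f1 + f2 + f3)%C).
  { symmetry. apply Ceq_minus. exact D. }
  replace (4 * (wpr a b (2 * u) - y))%C with (4 * wpr a b (2 * u) - 4 * y)%C by ring.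
  rewrite D', F1, F2, F3. rewrite S3 in *. cbn [Cpow]. field. repeat split; assumption.
Qed.
End Rectangular.

(** * Half periods as elliptic integrals *)

(** The parameter [m] is the square of the modulus. *)
Definition ell_integrand (m x : R) : R := / sqrt (1 - m * sin x ^ 2).

Lemma ell_radicand_pos m x : 0 <= m < 1 -> 0 < 1 - m * sin x ^ 2.
Proof.
  intros Hm. pose proof (sin2_cos2 x) as H. unfold Rsqr in H.
  pose proof (Rle_0_sqr (cos x)) as H2. unfold Rsqr in H2. simpl. nra.
Qed.

Lemma ell_integrand_pos m x : 0 <= m < 1 -> 0 < ell_integrand m x.
Proof. intros Hm. apply Rinv_0_lt_compat, sqrt_lt_R0. now apply ell_radicand_pos. Qed.

Lemma continuous_ell_integrand m x : 0 <= m < 1 -> continuous (ell_integrand m) x.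
Proof.
  intros Hm. pose proof (ell_radicand_pos m x Hm) as Hp.
  apply (ex_derive_continuous (ell_integrand m) x). unfold ell_integrand.
  auto_derive. replace (1 + - (m * (sin x * (sin x * 1)))) with (1 - m * sin x ^ 2) by (simpl; ring).
  repeat split; [exact Hp|]. apply Rgt_not_eq, sqrt_lt_R0, Hp.
Qed.

Lemma ex_RInt_ell m x y : 0 <= m < 1 -> ex_RInt (ell_integrand m) x y.
Proof.
  intros Hm. apply (ex_RInt_continuous (V := R_CompleteNormedModule)).
  intros z _. now apply continuous_ell_integrand.
Qed.

Lemma ellK_eq k : ellK k = RInt (ell_integrand (k ^ 2)) 0 (PI / 2).
Proof. reflexivity. Qed.

Lemma ellK_pos k : 0 <= k < 1 -> 0 < ellK k.
Proof.
  intros Hk. assert (Hm : 0 <= k ^ 2 < 1) by (simpl; nra). rewrite ellK_eq. pose proof PI_RGT_0.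
  apply RInt_gt_0; [lra| |].
  - intros x _. now apply ell_integrand_pos.
  - intros x _. now apply continuous_ell_integrand.
Qed.

Lemma ellK_increasing k l : 0 <= k -> k < l < 1 -> ellK k < ellK l.
Proof.
  intros Hk Hl. assert (Hm : 0 <= k ^ 2 < 1) by (simpl; nra). assert (Hm' : 0 <= l ^ 2 < 1) by (simpl; nra).
  rewrite !ellK_eq. pose proof PI_RGT_0. apply RInt_lt; [lra| | |].
  - intros x _. now apply continuous_ell_integrand.
  - intros x _. now apply continuous_ell_integrand.
  - intros x Hx. pose proof (ell_radicand_pos _ x Hm). pose proof (ell_radicand_pos _ x Hm').
    assert (0 < sin x) by (apply sin_gt_0; lra).
    unfold ell_integrand. apply Rinv_lt_contravar.
    + apply Rmult_lt_0_compat; now apply sqrt_lt_R0.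
    + apply sqrt_lt_1; [lra|lra|]. assert (0 < sin x ^ 2) by now apply pow_lt.
      assert (k ^ 2 < l ^ 2) by (simpl; nra). nra.
Qed.

Definition ell_int (m x : R) : R := RInt (ell_integrand m) 0 x.

Lemma is_derive_ell_int m x : 0 <= m < 1 -> is_derive (ell_int m) x (ell_integrand m x).
Proof.
  intros Hm. apply (is_derive_RInt (V := R_NormedModule) _ _ 0 x).
  - apply filter_forall. intros y. apply (RInt_correct (V := R_CompleteNormedModule)). now apply ex_RInt_ell.
  - now apply continuous_ell_integrand.
Qed.

Lemma ell_int_le m x : 0 <= m < 1 -> 0 <= x -> ell_int m x <= / sqrt (1 - m) * x.
Proof.
  intros Hm Hx. unfold ell_int.
  replace (/ sqrt (1 - m) * x) with (RInt (fun _ => / sqrt (1 - m)) 0 x).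
  - apply RInt_le; [exact Hx|now apply ex_RInt_ell|apply ex_RInt_const|].
    intros y _. apply Rinv_le_contravar; [apply sqrt_lt_R0; lra|]. apply sqrt_le_1_alt.
    pose proof (sin2_cos2 y) as H. unfold Rsqr in H.
    pose proof (Rle_0_sqr (cos y)) as H2. unfold Rsqr in H2. simpl. nra.
  - rewrite RInt_const. change ((x - 0) * / sqrt (1 - m) = / sqrt (1 - m) * x). ring.
Qed.

Lemma ell_int_nonneg m x : 0 <= m < 1 -> 0 <= x -> 0 <= ell_int m x.
Proof.
  intros Hm Hx. apply RInt_ge_0; [exact Hx|now apply ex_RInt_ell|].
  intros y _. left. now apply ell_integrand_pos.
Qed.

Lemma atan_le x : 0 <= x -> atan x <= x.
Proof.
  intros Hx. destruct (MVT_gen (fun y => y - atan y) 0 x (fun y => 1 - / (1 + y²))) as [c [_ E]].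
  - intros y _. auto_derive; [easy|]. unfold Rsqr. field. nra.
  - intros y _. apply continuity_pt_filterlim. apply (ex_derive_continuous (fun y => y - atan y) y).
    auto_derive. easy.
  - rewrite atan_0 in E. assert (/ (1 + c²) <= 1).
    { rewrite <- Rinv_1. pose proof (Rle_0_sqr c). apply Rinv_le_contravar; lra. }
    nra.
Qed.

Section Rectangular.
Context (a b : R) (Ha : 0 < a) (Hb : 0 < b).

Let phi (x : R) : R := Re (wpr a b (RtoC x)).
Let dphi (x : R) : R := Re (wp1 a b (RtoC x)).

Lemma real_ode x :
  0 < x < a -> dphi x ^ 2 = 4 * ((phi x - e1r a b) * (phi x - e2r a b) * (phi x - e3r a b)).
Proof.
  intros Hx. apply RtoC_inj. pose proof (wp_ode a b Ha Hb (RtoC x) Hx) as O.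
  rewrite wp1_real, (wpr_real a b Ha Hb x) in O by (auto; apply off_lattice_strip; auto).
  fold (phi x) (dphi x) in O.
  rewrite RtoC_pow. cbn [Cpow]. rewrite Cmult_1_r, O.
  now rewrite !RtoC_mult, !RtoC_minus.
Qed.

Lemma dphi_continuity x : 0 < x < a -> continuity_pt dphi x.
Proof.
  intros Hx. assert (Hn : ~ in_lattice a b (RtoC x)) by (apply off_lattice_strip; auto).
  apply continuity_pt_filterlim. apply (ex_derive_continuous dphi x).
  pose proof (is_derive_segment (wp1 a b) 0 1 x (wp2 a b (RtoC x))) as D.
  replace (0 + x * 1)%C with (RtoC x) in D by ring. specialize (D (cder_wp1 a b Ha Hb _ Hn)).
  eexists. eapply is_derive_ext; [|exact D]. intros t. cbv beta.
  now replace (0 + t * 1)%C with (RtoC t) by ring.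
Qed.

(** The differential equation and [phi > e1] exclude zeros of [dphi]. Were it positive somewhere, a
    point closer to the pole with a larger value of [phi] would provide a negative derivative in
    between, and then a zero. *)
Lemma dphi_neg x : 0 < x < a / 2 -> dphi x < 0.
Proof.
  intros Hx.
  assert (Hne : forall y, 0 < y < a / 2 -> dphi y <> 0).
  { intros y Hy E. pose proof (real_ode y ltac:(lra)) as O. rewrite E in O.
    pose proof (wpr_gt_e1 a b Ha Hb y Hy) as G. fold (phi y) in G. pose proof (e_order a b Ha Hb).
    assert (0 < (phi y - e1r a b) * (phi y - e2r a b) * (phi y - e3r a b)) by (repeat apply Rmult_lt_0_compat; lra).
    simpl in O. lra. }
  apply Rnot_le_lt. intro Hle. pose proof (Hne x Hx) as Hx0.
  destruct (re_wpr_large a b Ha Hb (phi x)) as [d [Hd H]].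
  set (y := Rmin (d / 2) (x / 2)).
  assert (Hy : 0 < y) by (apply Rmin_pos; lra).
  assert (Hy1 : y <= d / 2) by apply Rmin_l. assert (Hy2 : y <= x / 2) by apply Rmin_r.
  specialize (H y ltac:(lra)). fold (phi y) in H.
  destruct (MVT_gen phi y x dphi) as [c [Hc E]].
  - intros t Ht. rewrite Rmin_left, Rmax_right in Ht by lra. apply re_wpr_derive; auto; lra.
  - intros t Ht. rewrite Rmin_left, Rmax_right in Ht by lra. apply re_wpr_continuity; auto; lra.
  - rewrite Rmin_left, Rmax_right in Hc by lra.
    assert (Hc0 : dphi c < 0) by nra.
    destruct (Rle_lt_or_eq_dec c x) as [Hcx|Ecx]; [lra| |rewrite Ecx in Hc0; lra].
    destruct (Ranalysis5.IVT_interv dphi c x) as [z [Hz Ez]]; [|lra|lra|lra|].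
    + intros t Ht. apply dphi_continuity. lra.
    + apply (Hne z); [lra|exact Ez].
Qed.

Let E := e1r a b - e2r a b.
Let m := (e3r a b - e2r a b) / E.

Lemma e1_minus_e2_pos : 0 < E.
Proof. pose proof (e_order a b Ha Hb). unfold E; lra. Qed.

Lemma modulus_range : 0 < m < 1.
Proof.
  pose proof (e_order a b Ha Hb). pose proof e1_minus_e2_pos. unfold m. split.
  - apply Rdiv_lt_0_compat; lra.
  - apply Rmult_lt_reg_r with E; [lra|]. replace ((e3r a b - e2r a b) / E * E) with (e3r a b - e2r a b) by (field; lra).
    unfold E; lra.
Qed.

(* The amplitude, [wpr - e2 = (e1 - e2) / sin^2 amp]. *)
Let amp (x : R) : R := PI / 2 - atan (sqrt ((phi x - e1r a b) / E)).

(** With [q = (phi - e1) / E] one has [sin (amp x) ^ 2 = / (1 + q)], and the factors on the right of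
    the differential equation are [E q], [E (1 + q)] and [E (1 + q - m)]. Its square root, with the
    sign given by [dphi < 0], makes the derivative of the elliptic integral constant. *)
Lemma is_derive_amp x :
  0 < x < a / 2 -> is_derive (fun x => ell_int m (amp x)) x (sqrt E).
Proof.
  intros Hx. pose proof e1_minus_e2_pos as HE. pose proof modulus_range as Hm.
  pose proof (wpr_gt_e1 a b Ha Hb x Hx) as G. fold (phi x) in G.
  pose proof (re_wpr_derive a b Ha Hb x ltac:(lra)) as D. fold phi in D. fold (dphi x) in D.
  pose proof (dphi_neg x Hx) as Hneg. pose proof (real_ode x ltac:(lra)) as O.
  set (q := (phi x - e1r a b) / E).
  assert (Hq : 0 < q) by (apply Rdiv_lt_0_compat; lra).
  set (s := sqrt q). assert (Hs : 0 < s) by now apply sqrt_lt_R0.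
  assert (Hss : s * s = q) by (apply sqrt_sqrt; lra).
  assert (Dq : is_derive (fun x => (phi x - e1r a b) / E) x (dphi x / E)).
  { auto_derive; [eexists; exact D|].
    change (Derive (fun x0 : R => phi x0) x) with (Derive phi x). rewrite (is_derive_unique _ _ _ D). field. lra. }
  assert (Damp : is_derive amp x (- (dphi x / E / (2 * s) / (1 + q)))).
  { unfold amp. auto_derive.
    - repeat split; [eexists; exact D|]. exact Hq.
    - change (Derive (fun x0 : R => phi x0) x) with (Derive phi x). rewrite (is_derive_unique _ _ _ D).
      fold (phi x - e1r a b). change ((phi x - e1r a b) * / E) with q. fold s.
      rewrite <- Hss. field. repeat split; try nra; lra. }
  pose proof (is_derive_comp (ell_int m) amp x _ _ (is_derive_ell_int m (amp x) ltac:(lra)) Damp) as DI.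
  replace (sqrt E) with (scal (- (dphi x / E / (2 * s) / (1 + q))) (ell_integrand m (amp x))); [exact DI|].
  change (- (dphi x / E / (2 * s) / (1 + q)) * ell_integrand m (amp x) = sqrt E).
  assert (Hsin : sin (amp x) ^ 2 = / (1 + q)).
  { unfold amp. rewrite sin_shift. fold q. fold s. rewrite cos_atan. unfold Rsqr. rewrite Hss.
    unfold Rdiv. rewrite Rmult_1_l, pow_inv. simpl. rewrite Rmult_1_r, sqrt_sqrt by lra. reflexivity. }
  unfold ell_integrand. rewrite Hsin.
  assert (Hr : 0 < 1 - m * / (1 + q)).
  { replace (1 - m * / (1 + q)) with ((1 + q - m) / (1 + q)) by (field; lra). apply Rdiv_lt_0_compat; lra. }
  set (t := sqrt (1 - m * / (1 + q))). assert (Ht : 0 < t) by now apply sqrt_lt_R0.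
  assert (Htt : t * t = 1 - m * / (1 + q)) by (apply sqrt_sqrt; lra).
  set (r := sqrt E). assert (Hr0 : 0 < r) by now apply sqrt_lt_R0.
  assert (Hrr : r * r = E) by (apply sqrt_sqrt; lra).
  assert (Ed : - dphi x = 2 * E * r * s * (1 + q) * t).
  { apply Rsqr_inj; [lra| |].
    - repeat apply Rmult_le_pos; lra.
    - unfold Rsqr.
      replace (2 * E * r * s * (1 + q) * t * (2 * E * r * s * (1 + q) * t))
        with (4 * E * E * (r * r) * (s * s) * (1 + q) * (1 + q) * (t * t)) by ring.
      rewrite Hrr, Hss, Htt.
      replace (- dphi x * - dphi x) with (dphi x ^ 2) by ring. rewrite O.
      assert (E1 : phi x - e1r a b = E * q) by (unfold q; field; lra).
      assert (E2 : phi x - e2r a b = E * (1 + q)).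
      { replace (phi x - e2r a b) with ((phi x - e1r a b) + E) by (unfold E; ring). rewrite E1. ring. }
      assert (E3 : phi x - e3r a b = E * (1 + q - m)).
      { replace (phi x - e3r a b) with ((phi x - e2r a b) - E * m) by (unfold m; field; lra). rewrite E2. ring. }
      rewrite E1, E2, E3. field. lra. }
  replace (dphi x) with (- (2 * E * r * s * (1 + q) * t)) by lra. field. repeat split; lra.
Qed.

(** The range includes [a / 2], where [phi = e1] and the square root inside [amp] is not
    differentiable; continuity there carries the mean value theorem up to the endpoint. *)
Lemma continuity_amp x : 0 < x < a -> continuity_pt (fun x => ell_int m (amp x) - sqrt E * x) x.
Proof.
  intros Hx. pose proof modulus_range as Hm.
  apply continuity_pt_minus; [|apply continuity_pt_mult; [now apply continuity_pt_const; intros ? ?|apply continuity_pt_id]].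
  apply continuity_pt_filterlim. apply (continuous_comp amp (ell_int m)).
  - apply (continuous_minus (V := R_NormedModule)); [apply continuous_const|].
    apply continuous_atan_comp, continuous_sqrt_comp. apply continuity_pt_filterlim.
    apply continuity_pt_mult; [|now apply continuity_pt_const; intros ? ?].
    apply continuity_pt_minus; [|now apply continuity_pt_const; intros ? ?].
    now apply re_wpr_continuity.
  - apply (ex_derive_continuous (ell_int m) (amp x)). eexists. apply is_derive_ell_int. lra.
Qed.

(** The function [ell_int m (amp x) - sqrt E * x] is constant on [(0, a / 2]]. At [a / 2] the
    amplitude is [PI / 2]; towards the pole the amplitude tends to zero, so the constant is zero,
    which is shown by an upper and a lower bound up to [e]. *)
Lemma half_period_integral : sqrt E * (a / 2) = ell_int m (PI / 2).
Proof.
  pose proof e1_minus_e2_pos as HE. pose proof modulus_range as Hm.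
  set (Phi := fun x => ell_int m (amp x) - sqrt E * x).
  assert (Hend : Phi (a / 2) = ell_int m (PI / 2) - sqrt E * (a / 2)).
  { unfold Phi, amp. replace (phi (a / 2) - e1r a b) with 0 by (unfold phi, e1r; ring).
    replace (0 / E) with 0 by (field; lra). rewrite sqrt_0, atan_0, Rminus_0_r. reflexivity. }
  assert (Hconst : forall x, 0 < x < a / 2 -> Phi x = Phi (a / 2)).
  { intros x Hx. destruct (MVT_gen Phi x (a / 2) (fun _ => 0)) as [c [_ Ec]].
    - intros y Hy. rewrite Rmin_left, Rmax_right in Hy by lra.
      pose proof (is_derive_amp y ltac:(lra)) as D. unfold Phi.
      replace 0 with (sqrt E - sqrt E * 1) by ring.
      apply (is_derive_minus (V := R_NormedModule)); [exact D|]. apply is_derive_scal. apply (is_derive_id (K := R_AbsRing)).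
    - intros y Hy. rewrite Rmin_left, Rmax_right in Hy by lra. apply continuity_amp. lra.
    - lra. }
  enough (H : Phi (a / 2) = 0) by lra.
  apply Rle_antisym; apply le_epsilon; intros e He.
  - set (k := / sqrt (1 - m)).
    assert (Hk : 0 < k) by (apply Rinv_0_lt_compat, sqrt_lt_R0; lra).
    (* The threshold is chosen so that the square root [s] in [amp] exceeds [k / e]; then
       [amp x <= / s] gives [ell_int m (amp x) <= k * / s <= e]. *)
    destruct (re_wpr_large a b Ha Hb (e1r a b + E * (k / e) ^ 2)) as [d [Hd H]].
    set (x := Rmin (d / 2) (a / 4)).
    assert (Hx0 : 0 < x) by (apply Rmin_pos; lra).
    assert (Hx1 : x <= d / 2) by apply Rmin_l. assert (Hx2 : x <= a / 4) by apply Rmin_r.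
    specialize (H x ltac:(lra)). fold (phi x) in H.
    rewrite <- (Hconst x) by lra. unfold Phi.
    assert (Hs : k / e < sqrt ((phi x - e1r a b) / E)).
    { rewrite <- (sqrt_pow2 (k / e)) by (left; now apply Rdiv_lt_0_compat).
      apply sqrt_lt_1_alt. split; [apply pow2_ge_0|].
      apply Rmult_lt_reg_r with E; [lra|]. 
      replace ((phi x - e1r a b) / E * E) with (phi x - e1r a b) by (field; lra). lra. }
    assert (Hke : 0 < k / e) by now apply Rdiv_lt_0_compat.
    set (s := sqrt ((phi x - e1r a b) / E)) in *.
    assert (Ha1 : amp x = atan (/ s)) by (unfold amp; fold s; rewrite atan_inv; [reflexivity|lra]).
    assert (Hsi : 0 < / s) by (apply Rinv_0_lt_compat; lra).
    assert (Ha2 : amp x <= / s) by (rewrite Ha1; apply atan_le; lra).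
    assert (Ha3 : 0 <= amp x) by (rewrite Ha1, <- atan_0; left; now apply atan_increasing).
    pose proof (ell_int_le m (amp x) ltac:(lra) Ha3) as Hi. fold k in Hi.
    assert (k * / s <= e).
    { apply Rmult_le_reg_r with s; [lra|]. rewrite Rmult_assoc, Rinv_l by lra.
      apply (Rmult_lt_compat_l e) in Hs; [|lra]. replace (e * (k / e)) with k in Hs by (field; lra). lra. }
    assert (0 < sqrt E * x) by (apply Rmult_lt_0_compat; [now apply sqrt_lt_R0|lra]). nra.
  - assert (Hr : 0 < sqrt E) by now apply sqrt_lt_R0.
    set (x := Rmin (e / sqrt E) (a / 4)).
    assert (Hx0 : 0 < x) by (apply Rmin_pos; [now apply Rdiv_lt_0_compat|lra]).
    assert (Hx1 : x <= e / sqrt E) by apply Rmin_l. assert (Hx2 : x <= a / 4) by apply Rmin_r.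
    rewrite <- (Hconst x) by lra. unfold Phi.
    assert (0 <= amp x).
    { unfold amp. pose proof (atan_bound (sqrt ((phi x - e1r a b) / E))). lra. }
    pose proof (ell_int_nonneg m (amp x) ltac:(lra) H).
    apply (Rmult_le_compat_l (sqrt E)) in Hx1; [|lra].
    replace (sqrt E * (e / sqrt E)) with e in Hx1 by (field; lra). lra.
Qed.
End Rectangular.

Lemma half_period_ellK a b :
  0 < a -> 0 < b ->
  ellK (sqrt ((e3r a b - e2r a b) / (e1r a b - e2r a b)))
  = sqrt (e1r a b - e2r a b) * (a / 2).
Proof.
  intros Ha Hb. rewrite half_period_integral by assumption. rewrite ellK_eq.
  pose proof (modulus_range a b Ha Hb). rewrite <- (Rsqr_pow2 (sqrt _)), Rsqr_sqrt by lra. reflexivity.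
Qed.

(** Exchanging the periods keeps [e1 - e2] and replaces [e3 - e2] by [e1 - e3], that is, it passes
    to the complementary modulus. *)
Lemma half_period_ellK' a b :
  0 < a -> 0 < b ->
  ellK (sqrt ((e1r a b - e3r a b) / (e1r a b - e2r a b)))
  = sqrt (e1r a b - e2r a b) * (b / 2).
Proof.
  intros Ha Hb. pose proof (half_period_ellK b a Hb Ha) as H.
  assert (R1 : e1r b a = - e2r a b) by (rewrite (e2r_rot a b); auto; lra).
  assert (R2 : e2r b a = - e1r a b) by (rewrite (e2r_rot b a); auto).
  assert (R3 : e3r b a = - e3r a b) by (rewrite (e3r_rot a b); auto; lra).
  rewrite R1, R2, R3 in H.
  replace (- e2r a b - - e1r a b) with (e1r a b - e2r a b) in H by ring.
  replace (- e3r a b - - e1r a b) with (e1r a b - e3r a b) in H by ring. exact H.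
Qed.

(** * The Gauss map of the monopole *)

Lemma cder_C_derive f u l : cder f u l -> C_derive f u = l.
Proof.
  intros H. apply is_C_lim_unique. intros P HP. apply locally_Cmod in HP. destruct HP as [e [He HP]].
  destruct (H (e / 2) ltac:(lra)) as [d [Hd Hf]].
  apply locally_Cmod. exists d. split; [exact Hd|]. intros v Hv Hn. apply HP.
  pose proof (Cmod_minus_pos u v Hn) as Hp. specialize (Hf v Hv).
  assert (Hz : (v - u)%C <> 0) by (now apply Cmod_gt_0).
  replace ((f v - f u) / (v - u) - l)%C with ((f v - f u - (v - u) * l) / (v - u))%C by (field; exact Hz).
  rewrite Cmod_div by exact Hz. apply Rle_lt_trans with (e / 2); [|lra].
  apply Rmult_le_reg_r with (Cmod (v - u)); [exact Hp|].
  unfold Rdiv at 1. rewrite Rmult_assoc, Rinv_l by lra. lra.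
Qed.

(** Translation by [a / 2] leads here from the imaginary axis, where the value [s] is at most [e2].
    The map [s => e1 + c / (s - e1)] sends [s = e2] to [e3] and stays below [e1], which it
    approaches as [s] tends to minus infinity; lattice points of the axis correspond to the value
    [e1]. *)
Lemma wpr_middle_line a b y :
  0 < a -> 0 < b ->
  exists t, wpr a b (RtoC (a / 2) + Ci * RtoC y)%C = RtoC t /\ e3r a b <= t <= e1r a b.
Proof.
  intros Ha Hb. pose proof (e_order a b Ha Hb) as Ho.
  destruct (classic (in_lattice (a / 2) b (Ci * RtoC y)%C)) as [[p E]|Hn].
  - exists (e1r a b). split; [|lra].
    assert (Hm : IZR (fst p) * (a / 2) = 0) by (rewrite <- (re_rect _ b), <- E; cbn; ring).
    assert (Ep : (Ci * RtoC y)%C = rect a b (0, snd p)%Z).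
    { rewrite E. apply C_ext; rewrite ?re_rect, ?im_rect; cbn [fst snd]; [|reflexivity]. rewrite Hm. ring. }
    rewrite Ep, wpr_periodic by (auto; apply off_lattice_half; auto). now apply wpr_e1.
  - pose proof (off_half_lattice a b _ Hn) as [Hn1 _].
    pose proof (wpr_translate a b Ha Hb _ Hn) as T.
    replace (Ci * RtoC y + RtoC (a / 2))%C with (RtoC (a / 2) + Ci * RtoC y)%C in T by ring.
    pose proof (wpr_imag_le_e2 a b Ha Hb y Hn1) as Hle.
    rewrite (wpr_imag a b Ha Hb y Hn1) in T.
    set (s := Re (wpr a b (Ci * RtoC y)%C)) in *. set (f := wpr a b (RtoC (a / 2) + Ci * RtoC y)%C) in *.
    assert (Hs : RtoC (s - e1r a b) <> 0) by (apply RtoC_neq; lra).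
    set (c := (e1r a b - e2r a b) * (e1r a b - e3r a b)) in *.
    exists (e1r a b + c / (s - e1r a b)). split.
    + rewrite RtoC_plus, RtoC_div by lra. rewrite <- T, <- RtoC_minus. field. exact Hs.
    + assert (Hc : 0 < c) by (unfold c; nra).
      assert (c / (s - e1r a b) = - (c / (e1r a b - s))) by (field; lra).
      assert (0 < c / (e1r a b - s)) by (apply Rdiv_lt_0_compat; lra).
      assert (c / (e1r a b - s) <= e1r a b - e3r a b); [|lra].
      apply Rmult_le_reg_r with (e1r a b - s); [lra|].
      replace (c / (e1r a b - s) * (e1r a b - s)) with c by (field; lra). unfold c. nra.
Qed.

Section Monopole.
Context (k : R) (Hk : 0 < k < 1).

Let k' := compl_mod k.

Lemma compl_mod_sq : k' ^ 2 = 1 - k ^ 2.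
Proof. unfold k', compl_mod. rewrite <- Rsqr_pow2, Rsqr_sqrt; [reflexivity|]. simpl. nra. Qed.

Lemma compl_mod_range : 0 < k' < 1.
Proof.
  assert (H : 0 < k') by (apply sqrt_lt_R0; simpl; nra). split; [exact H|].
  pose proof compl_mod_sq as E. simpl in E. nra.
Qed.

(** Real side lengths with [omega1 k = per1 k] and [omega2 k = Ci * per2 k] by computation, so that
    [wpk k] is an instance of [wpr]. *)
Definition per1 (k : R) : R := 2 * sqrt (k * compl_mod k) * ellK k.
Definition per2 (k : R) : R := 2 * sqrt (k * compl_mod k) * ellK (compl_mod k).

Let a := per1 k.
Let b := per2 k.

Lemma sqrt_kk'_pos : 0 < sqrt (k * k').
Proof. pose proof compl_mod_range. apply sqrt_lt_R0. nra. Qed.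

Lemma per1_pos : 0 < a.
Proof.
  pose proof sqrt_kk'_pos. pose proof (ellK_pos k ltac:(lra)). unfold a, per1. fold k'. nra.
Qed.

Lemma per2_pos : 0 < b.
Proof.
  pose proof sqrt_kk'_pos. pose proof compl_mod_range. pose proof (ellK_pos k' ltac:(lra)).
  unfold b, per2. fold k'. nra.
Qed.

(* The modulus of the lattice is [k] because [ellK k' / ellK k] is strictly decreasing. *)
Lemma lattice_modulus :
  e1r a b - e2r a b = / (k * k') /\ e3r a b - e2r a b = k / k'.
Proof.
  pose proof per1_pos as Ha. pose proof per2_pos as Hb. pose proof compl_mod_range as Hk'.
  pose proof (e_order a b Ha Hb) as Ho.
  pose proof (half_period_ellK a b Ha Hb) as H1. pose proof (half_period_ellK' a b Ha Hb) as H2.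
  set (E := e1r a b - e2r a b) in *. assert (HE : 0 < E) by (unfold E; lra).
  set (m := (e3r a b - e2r a b) / E) in *.
  assert (Em : (e1r a b - e3r a b) / E = 1 - m) by (unfold m, E; field; fold E; lra).
  pose proof (modulus_range a b Ha Hb) as Hm. fold E in Hm. fold m in Hm. rewrite Em in H2.
  pose proof (ellK_pos k ltac:(lra)) as PK. pose proof (ellK_pos k' ltac:(lra)) as PK'.
  (* Both complete integrals of the lattice are [s] times those belonging to [k]. Unequal moduli
     would force [s < 1] from one equation and [s > 1] from the other; equal moduli give [s = 1],
     which fixes the scale [E]. *)
  set (s := sqrt E * sqrt (k * k')).
  assert (Hs : 0 < s) by (apply Rmult_lt_0_compat; [now apply sqrt_lt_R0|apply sqrt_kk'_pos]).
  assert (H1' : ellK (sqrt m) = s * ellK k) by (rewrite H1; unfold a, per1, s; fold k'; field).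
  assert (H2' : ellK (sqrt (1 - m)) = s * ellK k') by (rewrite H2; unfold b, per2, s; fold k'; field).
  pose proof compl_mod_sq as Ek'.
  assert (Hsm : forall x, 0 < x < 1 -> 0 < sqrt x < 1).
  { intros x Hx. split; [apply sqrt_lt_R0; lra|]. rewrite <- sqrt_1. apply sqrt_lt_1; lra. }
  pose proof (Hsm m Hm) as R1. pose proof (Hsm (1 - m) ltac:(lra)) as R2.
  assert (S1 : sqrt m ^ 2 = m) by (rewrite <- Rsqr_pow2; apply Rsqr_sqrt; lra).
  assert (S2 : sqrt (1 - m) ^ 2 = 1 - m) by (rewrite <- Rsqr_pow2; apply Rsqr_sqrt; lra).
  assert (Ekm : sqrt m = k).
  { destruct (Rtotal_order (sqrt m) k) as [Hlt|[He|Hgt]]; [exfalso|exact He|exfalso].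
    - pose proof (ellK_increasing (sqrt m) k ltac:(lra) ltac:(lra)) as I1.
      assert (k' < sqrt (1 - m)) by (simpl in *; nra).
      pose proof (ellK_increasing k' (sqrt (1 - m)) ltac:(lra) ltac:(lra)) as I2.
      rewrite H1' in I1. rewrite H2' in I2. nra.
    - pose proof (ellK_increasing k (sqrt m) ltac:(lra) ltac:(lra)) as I1.
      assert (sqrt (1 - m) < k') by (simpl in *; nra).
      pose proof (ellK_increasing (sqrt (1 - m)) k' ltac:(lra) ltac:(lra)) as I2.
      rewrite H1' in I1. rewrite H2' in I2. nra. }
  rewrite Ekm in *.
  assert (Es : s = 1) by (apply Rmult_eq_reg_r with (ellK k); lra).
  assert (EE : E = / (k * k')).
  { assert (Esq : E * (k * k') = 1).
    { rewrite <- (sqrt_sqrt E), <- (sqrt_sqrt (k * k')) by nra.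
      replace (sqrt E * sqrt E * (sqrt (k * k') * sqrt (k * k'))) with (s * s) by (unfold s; ring).
      rewrite Es. ring. }
    apply Rmult_eq_reg_r with (k * k'); [|nra]. rewrite Esq. field. lra. }
  split; [exact EE|].
  replace (e3r a b - e2r a b) with (m * E) by (unfold m; field; lra).
  rewrite EE, <- S1. field. lra.
Qed.

Lemma wpk_wpr : wpk k = wpr a b.
Proof. reflexivity. Qed.

Lemma half_RtoC x : (RtoC x / 2)%C = RtoC (x / 2).
Proof. rewrite RtoC_div by lra. reflexivity. Qed.

Lemma e2_eq : e2 k = RtoC (e2r a b).
Proof.
  rewrite <- (wpr_e2 a b per1_pos per2_pos), <- wpk_wpr. unfold e2. f_equal.
  rewrite <- half_RtoC. change (omega2 k) with (Ci * RtoC b)%C. unfold Cdiv. ring.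
Qed.

Lemma e3_eq : e3 k = RtoC (e3r a b).
Proof.
  rewrite <- (wpr_e3 a b per1_pos per2_pos), <- wpk_wpr. unfold e3. f_equal.
  rewrite <- !half_RtoC. change (omega3 k) with (RtoC a + Ci * RtoC b)%C. unfold Cdiv. ring.
Qed.

(** Full vertical lines, with [y] unrestricted: they contain the segments [V] as well as the images
    of [V'] under multiplication by [omega1]. *)
Definition on_quarter_line (k : R) (u : C) : Prop :=
  exists al y, (al = 1 / 4 \/ al = 3 / 4) /\ u = (RtoC al * omega1 k + Ci * RtoC y)%C.

Lemma quarter_line_coord u :
  on_quarter_line k u ->
  exists n y, (n = 0 \/ n = 1)%Z /\ u = (RtoC (a / 4 + IZR n * (a / 2)) + Ci * RtoC y)%C.
Proof.
  intros [al [y [Hal ->]]]. change (omega1 k) with (RtoC a).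
  destruct Hal as [->| ->]; [exists 0%Z, y|exists 1%Z, y]; (split; [tauto|]);
    rewrite <- RtoC_mult; do 2 f_equal; cbn; field.
Qed.

Lemma quarter_line_conj u :
  on_quarter_line k u -> Cconj (wpr a b u) = wpr a b (u + RtoC (a / 2))%C.
Proof.
  pose proof per1_pos as Ha. pose proof per2_pos as Hb.
  intros Hu. destruct (quarter_line_coord u Hu) as [n [y [Hn ->]]].
  set (u := (RtoC (a / 4 + IZR n * (a / 2)) + Ci * RtoC y)%C).
  assert (Hu0 : ~ in_lattice a b u).
  { apply off_lattice_strip; [exact Ha|]. unfold u. cbn. destruct Hn as [->| ->]; lra. }
  rewrite <- (wpr_conj a b Ha Hb) by exact Hu0.
  rewrite <- (wpr_even a b Ha Hb) by (apply off_lattice_conj; exact Hu0).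
  (* As [Re u = a / 4 + n * (a / 2)], one has [- Cconj u + (1 + n) a = u + a / 2]. *)
  rewrite <- (wpr_periodic a b Ha Hb _ (off_lattice_opp _ _ _ (off_lattice_conj _ _ _ Hu0)) (1 + n, 0)%Z).
  f_equal. apply C_ext; rewrite ?re_plus, ?im_plus, ?re_rect, ?im_rect; unfold u; cbn [fst snd];
    rewrite ?plus_IZR; cbn; field.
Qed.

Lemma quarter_line_off u : on_quarter_line k u -> ~ in_lattice (a / 2) (b / 2) u.
Proof.
  pose proof per1_pos as Ha.
  intros Hu. destruct (quarter_line_coord u Hu) as [n [y [Hn ->]]].
  replace (RtoC (a / 4 + IZR n * (a / 2)) + Ci * RtoC y)%C with ((a / 4 + IZR n * (a / 2), y) : C)
    by (apply C_ext; cbn; ring).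
  apply off_lattice_re. apply strictly_between_multiples with n; [lra|]. rewrite plus_IZR. lra.
Qed.

Lemma quarter_line_double u :
  on_quarter_line k u -> exists t, wpr a b (2 * u)%C = RtoC t /\ e3r a b <= t <= e1r a b.
Proof.
  pose proof per1_pos as Ha. pose proof per2_pos as Hb.
  intros Hu. destruct (quarter_line_coord u Hu) as [n [y [Hn ->]]].
  destruct (wpr_middle_line a b (2 * y) Ha Hb) as [t [Et Ht]]. exists t. split; [|exact Ht].
  rewrite <- Et. 
  rewrite <- (wpr_periodic a b Ha Hb (RtoC (a / 2) + Ci * RtoC (2 * y))%C) with (p := (n, 0%Z)).
  - f_equal. apply C_ext; rewrite ?re_plus, ?im_plus, ?re_rect, ?im_rect; cbn; field.
  - apply off_lattice_strip; [exact Ha|]. cbn. lra.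
Qed.

(* Every factor of [G] is expressed through the modulus of [wpr u - e_j]; the
   reflection [Cconj u = - u + const] gives [|wpr u - e1| = 1 / k]. *)
Lemma G_quarter_line u :
  on_quarter_line k u ->
  G k u = 4 / (k' ^ 2 * Cmod (wpk k (2 * u) - e2 k)).
Proof.
  pose proof per1_pos as Ha. pose proof per2_pos as Hb. pose proof compl_mod_range as Hk'.
  pose proof compl_mod_sq as Ek'.
  intros Hu. pose proof (quarter_line_off u Hu) as Hoff.
  destruct (off_quarter_lattice a b u Hoff) as [Q1 [_ [Q0 _]]].
  assert (Hre : 0 < Re u < a).
  { destruct (quarter_line_coord u Hu) as [n [y [Hn ->]]]. cbn. destruct Hn as [->| ->]; lra. }
  destruct (wpr_ne_e a b Ha Hb u Hoff) as [N1 [N2 N3]].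
  pose proof (wpr_duplication a b Ha Hb u Hoff) as D. cbv zeta in D.
  pose proof (wp_ode a b Ha Hb u Hre) as O.
  pose proof (wpr_translate a b Ha Hb u Q1) as T. rewrite <- quarter_line_conj in T by exact Hu.
  destruct lattice_modulus as [L1 L2].
  assert (L3 : e1r a b - e3r a b = k' / k).
  { replace (e1r a b - e3r a b) with ((e1r a b - e2r a b) - (e3r a b - e2r a b)) by ring.
    rewrite L1, L2. replace (/ (k * k') - k / k') with ((1 - k ^ 2) / (k * k')) by (field; lra).
    rewrite <- Ek'. field. lra. }
  assert (HG : gauss k = fun v => (wpr a b v - e3r a b)%C).
  { unfold gauss. rewrite e3_eq, wpk_wpr. reflexivity. }
  unfold G. rewrite HG, e2_eq, wpk_wpr.
  rewrite (cder_C_derive _ u (wp1 a b u - 0)%C)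
    by (apply cder_minus; [now apply cder_wpr|apply cder_const]).
  replace (wp1 a b u - 0)%C with (wp1 a b u) by ring.
  set (f := wpr a b u) in *. set (D2 := (wpr a b (2 * u) - e2r a b)%C) in *.
  set (Y := ((f - e2r a b) ^ 2 - (e2r a b - e1r a b) * (e2r a b - e3r a b))%C) in *.
  set (P := ((f - e1r a b) * (f - e2r a b) * (f - e3r a b))%C) in *.
  assert (NP : P <> 0) by (unfold P; repeat apply Cmult_neq_0; assumption).
  assert (HP : 0 < Cmod P) by now apply Cmod_gt_0.
  assert (M1 : Cmod (wp1 a b u) ^ 2 = 4 * Cmod P).
  { rewrite <- Cmod_pow. cbn [Cpow]. rewrite Cmult_1_r, O, Cmod_mult, Cmod_R, Rabs_pos_eq by lra. reflexivity. }
  assert (M2 : Cmod Y ^ 2 = 4 * Cmod D2 * Cmod P).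
  { rewrite <- Cmod_pow. replace (Y ^ 2)%C with (4 * D2 * P)%C by (rewrite D; field; exact NP).
    rewrite !Cmod_mult, Cmod_R, Rabs_pos_eq by lra. reflexivity. }
  assert (X1 : RtoC (e1r a b) = (e3r a b + k' / k)%C).
  { rewrite <- RtoC_div, <- RtoC_plus by lra. f_equal. lra. }
  assert (X2 : RtoC (e2r a b) = (e3r a b - k / k')%C).
  { rewrite <- RtoC_div, <- RtoC_minus by lra. f_equal. lra. }
  assert (Hkk : (RtoC k' * RtoC k' + RtoC k * RtoC k)%C = 1).
  { rewrite <- !RtoC_mult, <- RtoC_plus. f_equal. simpl in Ek'. lra. }
  assert (Nk : RtoC k <> 0) by (apply RtoC_neq; lra).
  assert (Nk' : RtoC k' <> 0) by (apply RtoC_neq; lra).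
  assert (T' : ((Cconj f - e1r a b) * (f - e1r a b))%C = RtoC (/ k ^ 2)).
  { rewrite T. f_equal. rewrite L1, L3. field. lra. }
  assert (M3 : Cmod (f - e1r a b) = / k).
  { apply Rsqr_inj; [apply Cmod_ge_0|left; apply Rinv_0_lt_compat; lra|]. rewrite !Rsqr_pow2.
    rewrite pow_inv. apply RtoC_inj. rewrite <- T', Cmod2_conj, Cminus_conj.
    replace (Cconj (e1r a b)) with (RtoC (e1r a b)) by (apply C_ext; cbn; ring). ring. }
  assert (M4 : 1 + Cmod (f - e3r a b) ^ 2 = k' * Cmod Y).
  (* Multiplication by [f - e1] removes the conjugate of [f], because
     [(Cconj f - e1) (f - e1) = / k ^ 2]. The claim becomes a polynomial identity in [f] whose two
     sides differ by a multiple of [1 - (k' ^ 2 + k ^ 2)]. *)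
  { assert (EC : (RtoC (1 + Cmod (f - e3r a b) ^ 2) * (f - e1r a b))%C = (k' / k * Y)%C).
    { rewrite RtoC_plus, Cmod2_conj, Cminus_conj.
      replace (Cconj (e3r a b)) with (RtoC (e3r a b)) by (apply C_ext; cbn; ring).
      replace ((1 + (f - e3r a b) * (Cconj f - e3r a b)) * (f - e1r a b))%C
        with ((f - e1r a b) + (f - e3r a b) * ((Cconj f - e1r a b) * (f - e1r a b))
              + (f - e3r a b) * (e1r a b - e3r a b) * (f - e1r a b))%C by ring.
      rewrite T', RtoC_inv, RtoC_pow by (apply pow_nonzero; lra). unfold Y. rewrite X1, X2.
      set (h := RtoC (e3r a b)). set (x := RtoC k) in *. set (x' := RtoC k') in *.
      apply Ceq_minus.
      replace (_ - _)%C with ((f - h) * (1 - (x' * x' + x * x)) / (x * x))%C; [rewrite Hkk; field; exact Nk|].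
      cbn [Cpow]. field. split; assumption. }
    apply (f_equal Cmod) in EC. rewrite !Cmod_mult, Cmod_div, !Cmod_R, M3 in EC by exact Nk.
    rewrite !Rabs_pos_eq in EC; [|lra|lra|pose proof (pow2_ge_0 (Cmod (f - e3r a b))); lra].
    apply Rmult_eq_reg_r with (/ k); [|apply Rinv_neq_0_compat; lra].
    rewrite EC. field. lra. }
  pose proof (pow2_ge_0 (Cmod (f - e3r a b))) as P2.
  assert (HY : 0 < Cmod Y) by (pose proof (Cmod_ge_0 Y); nra).
  assert (HD : 0 < Cmod D2).
  { pose proof (Cmod_ge_0 D2) as [?|E]; [assumption|]. exfalso. rewrite <- E in M2. simpl in M2. nra. }
  (* The numerator is [16 |P|] and the denominator [k' ^ 2 * 4 |D2| |P|], so the cubic [P]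
     cancels. *)
  rewrite M1, M4. rewrite Rpow_mult_distr, M2. field. repeat split; lra.
Qed.

Lemma G_quarter_line_value u :
  on_quarter_line k u ->
  exists t, wpk k (2 * u) = RtoC t /\ k / k' <= t - e2r a b <= / (k * k') /\
    G k u = 4 / (k' ^ 2 * (t - e2r a b)).
Proof.
  intros Hu. pose proof compl_mod_range as Hk'. destruct lattice_modulus as [L1 L2].
  destruct (quarter_line_double u Hu) as [t [Et Ht]]. exists t.
  split; [exact Et|]. split; [lra|].
  rewrite (G_quarter_line u Hu), e2_eq, wpk_wpr, Et, <- RtoC_minus, Cmod_R.
  assert (0 < k / k') by (apply Rdiv_lt_0_compat; lra). rewrite Rabs_pos_eq; [reflexivity|lra].
Qed.

Lemma G_formula u :
  on_quarter_line k u ->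
  RtoC (G k u) = (4 / (RtoC (compl_mod k) ^ 2 * (wpk k (2 * u) - e2 k)))%C.
Proof.
  intros Hu. pose proof compl_mod_range as Hk'. destruct (G_quarter_line_value u Hu) as [t [Et [Ht EG]]].
  assert (0 < k / k') by (apply Rdiv_lt_0_compat; lra).
  rewrite EG, Et, e2_eq. fold k'. rewrite <- RtoC_pow, <- RtoC_minus, <- RtoC_mult, <- RtoC_div; [reflexivity|].
  apply Rgt_not_eq, Rmult_lt_0_compat; [apply pow_lt|]; lra.
Qed.

(** * Lower bounds and divergence as [k] tends to 1 *)

Lemma G_lower_bound u : on_quarter_line k u -> 4 * k / k' <= G k u.
Proof.
  intros Hu. pose proof compl_mod_range as Hk'. destruct (G_quarter_line_value u Hu) as [t [_ [Ht ->]]].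
  assert (0 < k / k') by (apply Rdiv_lt_0_compat; lra).
  replace (4 * k / k') with (4 * / (k' ^ 2 * / (k * k'))) by (field; lra).
  unfold Rdiv. apply Rmult_le_compat_l; [lra|]. apply Rinv_le_contravar.
  - apply Rmult_lt_0_compat; [apply pow_lt|]; lra.
  - apply Rmult_le_compat_l; [apply pow2_ge_0|lra].
Qed.

Lemma V_on_quarter_line u : V k (1 / 4) u \/ V k (3 / 4) u -> on_quarter_line k u.
Proof.
  intros [[y [_ ->]]|[y [_ ->]]]; [exists (1 / 4), y|exists (3 / 4), y]; (split; [tauto|reflexivity]).
Qed.

Lemma V'_on_quarter_line z :
  V' k (1 / 4) z \/ V' k (3 / 4) z -> on_quarter_line k (omega1 k * z)%C.
Proof.
  change (omega1 k) with (RtoC a).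
  intros [[y [_ ->]]|[y [_ ->]]]; [exists (1 / 4), (a * y)|exists (3 / 4), (a * y)];
    (split; [tauto|]); change (omega1 k) with (RtoC a); rewrite (RtoC_mult a y); ring.
Qed.

(** Since [1 - k ^ 2 * sin x ^ 2 = cos x ^ 2 + k' ^ 2 * sin x ^ 2 <= (PI / 2 - x + k') ^ 2], the
    integrand dominates [/ (PI / 2 - x + k')]. Its integral is [ln (PI / 2 + k') - ln k'], and the
    first logarithm is positive. *)
Lemma ellK_log_bound : - ln k' <= ellK k.
Proof.
  pose proof compl_mod_range as Hk'. pose proof compl_mod_sq as Ek'.
  pose proof PI2_1 as HPI.
  assert (HI : is_RInt (fun x => / (PI / 2 - x + k')) 0 (PI / 2)
    (minus (- ln (PI / 2 - PI / 2 + k')) (- ln (PI / 2 - 0 + k')))).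
  { pose proof PI_RGT_0.
    apply (is_RInt_derive (V := R_CompleteNormedModule) (fun x => - ln (PI / 2 - x + k'))).
    - intros x Hx. rewrite Rmin_left, Rmax_right in Hx by lra. auto_derive; [lra|]. field. lra.
    - intros x Hx. rewrite Rmin_left, Rmax_right in Hx by lra.
      apply (ex_derive_continuous (fun x => / (PI / 2 - x + k'))). auto_derive. lra. }
  pose proof (is_RInt_unique _ _ _ _ HI) as EI.
  apply Rle_trans with (RInt (fun x => / (PI / 2 - x + k')) 0 (PI / 2)).
  - rewrite EI. change (- ln k' <= - ln (PI / 2 - PI / 2 + k') - - ln (PI / 2 - 0 + k')).
    replace (PI / 2 - PI / 2 + k') with k' by ring.
    pose proof (ln_increasing 1 (PI / 2 - 0 + k') ltac:(lra) ltac:(lra)) as Hln. rewrite ln_1 in Hln. lra.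
  - rewrite ellK_eq. assert (Hm : 0 <= k ^ 2 < 1) by (simpl; nra). apply RInt_le.
    + lra.
    + eexists. exact HI.
    + now apply ex_RInt_ell.
    + intros x Hx. pose proof (ell_radicand_pos _ x Hm) as Hp. unfold ell_integrand.
      apply Rinv_le_contravar; [now apply sqrt_lt_R0|].
      rewrite <- (sqrt_pow2 (PI / 2 - x + k')) by lra. apply sqrt_le_1_alt.
      assert (Hc : cos x <= PI / 2 - x) by (rewrite <- sin_shift; left; apply sin_lt_x; lra).
      assert (Hc0 : 0 <= cos x) by (apply cos_ge_0; lra).
      pose proof (sin2_cos2 x) as S. unfold Rsqr in S.
      pose proof (Rle_0_sqr (cos x)) as S2. unfold Rsqr in S2. simpl in *. nra.
Qed.

(** The factor [omega1 ^ 2 = 4 k k' K(k) ^ 2] cancels the [k'] in the lower bound [4 k / k'] for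
    [G], so the growth of [G1] comes from [K(k)] alone. *)
Lemma G1_lower_bound z : V' k (1 / 4) z \/ V' k (3 / 4) z -> (4 * k * ellK k) ^ 2 <= G1 k z.
Proof.
  intros Hz. pose proof (G_lower_bound _ (V'_on_quarter_line z Hz)) as H.
  pose proof compl_mod_range as Hk'. unfold G1.
  change (omega1 k) with (RtoC a) in *. rewrite Cmod_R, pow2_abs.
  replace ((4 * k * ellK k) ^ 2) with (a ^ 2 * (4 * k / k')).
  - apply Rmult_le_compat_l; [apply pow2_ge_0|exact H].
  - unfold a, per1. fold k'. rewrite !Rpow_mult_distr, <- (Rsqr_pow2 (sqrt _)), Rsqr_sqrt by nra.
    field. lra.
Qed.
End Monopole.

Theorem corollary8p4 :
  (forall (k : R) (u : C), 0 < k < 1 ->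
     V k (1 / 4) u \/ V k (3 / 4) u ->
     RtoC (G k u) =
       (4 / (RtoC (compl_mod k) ^ 2 * (wpk k (2 * u) - e2 k)))%C) /\
  (forall M : R, 0 < M ->
     exists kM : R, kM < 1 /\
       forall k : R, 0 < k < 1 -> kM < k ->
       forall z : C, V' k (1 / 4) z \/ V' k (3 / 4) z -> M < G1 k z).
Proof.
  split.
  - intros k u Hk Hu. apply G_formula; [exact Hk|]. now apply V_on_quarter_line.
  (* For [k > sqrt (1 - q ^ 2)] the complementary modulus is below [q = exp (- L)], so the
     logarithmic bound gives [K(k) > L]. With [k > 1 / 2] this yields [4 k K(k) > 2 (1 + M)], whose
     square exceeds [M]. *)
  - intros M HM. set (L := 1 + M). set (q := exp (- L)).
    assert (Hq : 0 < q < 1).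
    { unfold q. split; [apply exp_pos|]. rewrite <- exp_0. apply exp_increasing. unfold L. lra. }
    exists (Rmax (1 / 2) (sqrt (1 - q ^ 2))). split.
    { apply Rmax_lub_lt; [lra|]. rewrite <- sqrt_1 at 2. apply sqrt_lt_1_alt. simpl. nra. }
    intros k Hk Hmax z Hz.
    assert (H1 : 1 / 2 < k) by (eapply Rle_lt_trans; [apply Rmax_l|exact Hmax]).
    assert (H2 : sqrt (1 - q ^ 2) < k) by (eapply Rle_lt_trans; [apply Rmax_r|exact Hmax]).
    pose proof (compl_mod_range k Hk) as Hk'. pose proof (compl_mod_sq k Hk) as Ek'.
    assert (Hlt : compl_mod k < q).
    { assert (1 - q ^ 2 < k ^ 2); [|simpl in *; nra].
      rewrite <- (Rsqr_sqrt (1 - q ^ 2)) by (simpl; nra). rewrite Rsqr_pow2.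
      pose proof (sqrt_pos (1 - q ^ 2)). set (w := sqrt (1 - q ^ 2)) in *. simpl. nra. }
    assert (HK : L < ellK k).
    { eapply Rlt_le_trans; [|apply ellK_log_bound; exact Hk].
      pose proof (ln_increasing _ _ (proj1 Hk') Hlt) as Hln. unfold q in Hln. rewrite ln_exp in Hln. lra. }
    eapply Rlt_le_trans; [|apply G1_lower_bound; eassumption].
    unfold L in HK. assert (2 * (1 + M) < 4 * k * ellK k) by nra. simpl. nra.
Qed.
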